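(* Let $p\ge2$, $T>0$, let $E$ be a Banach space, let $\mathrm F$ be a continuous linear map from $\mathbb{R}^\ell$ to the space $\mathcal{C}^{[p]+1}_b(E,E)$ of vector fields on $E$, and let $\mathbf X$ be a weak geometric Hölder $p$-rough path over $\mathbb{R}^\ell$ on $[0,T]$. Then the rough differential equation $$d\varphi=\mathrm F^\otimes\,\mathbf X(dt)$$ has a unique solution flow $(\varphi_{ts})_{0\le s\le t\le T}$; it takes values in the space of uniformly Lipschitz continuous homeomorphisms of $E$ with uniformly Lipschitz continuous inverses, and depends continuously on $\mathbf X$.
   Context: $[p]$ is the integer part of $p$; $\mathcal{C}^k_b$ means $k$ times continuously differentiable, bounded, with bounded derivatives up to order $k$. Algebra: $T^{(N)}_\ell=\bigoplus_{r=0}^N(\mathbb{R}^\ell)^{\otimes r}$ is the truncated tensor algebra, with product $(\mathbf a\mathbf b)^r=\sum_{k=0}^ra^k\otimes b^{r-k}$ and bracket $[\mathbf a,\mathbf b]=\mathbf a\mathbf b-\mathbf b\mathbf a$; $\exp$ and $\log$ are given by the usual (truncated) series, mutually inverse between elements with zero $\mathbb{R}$-component and elements with $\mathbb{R}$-component $1$. $\mathfrak g^N_\ell$ is the Lie algebra generated by $\mathbb{R}^\ell$ in $T^{(N)}_\ell$, and $\mathfrak G^N_\ell=\exp(\mathfrak g^N_\ell)$, a group. A weak geometric Hölder $p$-rough path on $[0,T]$ is a $\mathfrak G^{[p]}_\ell$-valued path $\mathbf X_t=1\oplus X^1_t\oplus\cdots\oplus X^{[p]}_t$ such that, with $\mathbf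 X_{ts}:=\mathbf X_s^{-1}\mathbf X_t$, $\max_{1\le i\le[p]}\sup_{0\le s<t\le T}|X^i_{ts}|/|t-s|^{i/p}<\infty$. The distance is $d(\mathbf X,\mathbf Y)=\max_{1\le i\le[p]}\sup_{s<t}|X^i_{ts}-Y^i_{ts}|/|t-s|^{i/p}$. Differential operators: for $v\in\mathbb{R}^\ell$, $\mathrm F^\otimes(v)$ is the first order operator $g\mapsto D_\cdot g(\mathrm F(v)(\cdot))$; $\mathrm F^\otimes(1)=\mathrm{Id}$; $\mathrm F^\otimes(v_1\otimes\cdots\otimes v_k)=\mathrm F^\otimes(v_1)\cdots\mathrm F^\otimes(v_k)$; extended linearly. For $\Lambda\in\mathfrak g^{[p]}_\ell$, $\mathrm F^\otimes(\Lambda)$ is a first order operator, identified with the vector field $\mathrm F^\otimes(\Lambda)\mathrm{Id}$. Let $\mu_{ts}$ be the time-$1$ map ($x=y_0\mapsto y_1$) of $\dot y_u=\mathrm F^\otimes(\log\mathbf X_{ts})(y_u)$, $0\le u\le1$. A flow on $E$ is a family $(\varphi_{ts})_{0\le s\le t\le T}$ of maps $E\to E$ with $\varphi_{tt}=\mathrm{Id}$ and $\varphi_{ts}=\varphi_{tu}\circ\varphi_{us}$ for $s\le u\le t$. It is a solution flow to $d\varphi=\mathrm F^\otimes\mathbf X(dt)$ if there exist a constant $a>1$ independent of $\mathbf X$ and two possibly $\mathbf X$-dependent constants $\delta,c>0$ such that $\|\varphi_{ts}-\mu_{ts}\|_\infty\le c|t-s|^a$ for all $0\le s\le t\le T$ with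 $t-s\le\delta$. ''Uniformly Lipschitz'' means with Lipschitz constants bounded uniformly in $(s,t)$. Continuity of $\varphi$ as a function of $\mathbf X$ is with respect to $d$ and the uniform distance $\sup_{s\le t}\|\varphi_{ts}-\varphi'_{ts}\|_\infty$. *)

(* Defs.v *)
From HB Require Import structures.
From mathcomp Require Import all_boot all_order all_algebra.
From mathcomp Require Import all_classical all_reals all_analysis.
From mathcomp Require Import zify.

Set Implicit Arguments.
Unset Strict Implicit.
Unset Printing Implicit Defensive.
Import Order.TTheory GRing.Theory Num.Theory.
Import numFieldNormedType.Exports.
Local Open Scope classical_set_scope.
Local Open Scope ring_scope.

(* The truncated tensor algebra over R^l, in coordinates: the value of
   [a : tensor R l N] at the word [i_1; ...; i_r], r <= N, is the coefficient
   of e_{i_1} (x) ... (x) e_{i_r} in a. Hence words of size r carry the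
   component of a in (R^l)^{(x) r}, and the empty word its R-component. *)
Definition tensor (R : fieldType) (l N : nat) := {ffun N.-bseq 'I_l -> R^o}.

Section TensorAlgebra.
Context (R : fieldType) (l N : nat).
Local Notation tensor := (tensor R l N).
Implicit Types (a b c : tensor) (w : N.-bseq 'I_l).

HB.instance Definition _ := GRing.Lmodule.on tensor.

Definition tone : tensor := [ffun w : N.-bseq 'I_l => (size w == 0)%:R].

(* The coefficient of a word w in a product is the sum over all deconcatenations
   w = w1 w2 of the products of the coefficients of w1 and w2. *)
Definition tmul a b : tensor :=
  [ffun w : N.-bseq 'I_l => \sum_(k < (size w).+1)
    a (insub_bseq N (take k w)) * b (insub_bseq N (drop k w))].

Let conv (f g : seq 'I_l -> R) (s : seq 'I_l) : R :=
  \sum_(k < (size s).+1) f (take k s) * g (drop k s).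

Let ext a (s : seq 'I_l) : R := a (insub_bseq N s).

Let conv_cons f g x s :
  conv f g (x :: s) = f [::] * g (x :: s) + conv (f \o cons x) g s.
Proof. by rewrite /conv big_ord_recl. Qed.

Let conv_nil f g : conv f g [::] = f [::] * g [::].
Proof. by rewrite /conv big_ord1. Qed.

Let eq_conv f f' g g' s : (forall t, (size t <= size s)%N -> f t = f' t) ->
  (forall t, (size t <= size s)%N -> g t = g' t) -> conv f g s = conv f' g' s.
Proof.
move=> ff gg; apply: eq_bigr => k _; rewrite ff ?gg //.
  by rewrite size_drop leq_subr.
by rewrite size_take; case: ltnP => // /ltnW.
Qed.

Let convDl f f' g s : conv (f \+ f') g s = conv f g s + conv f' g s.
Proof. by rewrite -big_split; apply: eq_bigr => k _ /=; rewrite mulrDl. Qed.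

Let convZl x f g s : conv (fun t => x * f t) g s = x * conv f g s.
Proof. by rewrite mulr_sumr; apply: eq_bigr => k _ /=; rewrite mulrA. Qed.

Let convA f g h s : conv f (conv g h) s = conv (conv f g) h s.
Proof.
elim: s f g h => [|x s IH] f g h; first by rewrite !conv_nil mulrA.
rewrite conv_cons [RHS]conv_cons conv_cons conv_nil mulrDr mulrA -addrA.
congr (_ + _).
rewrite (_ : conv f g \o cons x =
  (fun t => f [::] * g (x :: t)) \+ conv (f \o cons x) g); last first.
  by apply/funext => t /=; rewrite conv_cons.
by rewrite convDl convZl IH.
Qed.

Let extE a w : ext a w = a w.
Proof. by congr (a _); apply/val_inj; rewrite /insub_bseq valKd. Qed.

Let ext_tmul a b s : (size s <= N)%N -> ext (tmul a b) s = conv (ext a) (ext b) s.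
Proof. by move=> sN; rewrite /ext ffunE /insub_bseq insubdK. Qed.

Let tmulE a b w : tmul a b w = conv (ext a) (ext b) w.
Proof. by rewrite -extE ext_tmul // size_bseq. Qed.

Fact tmulA : associative tmul.
Proof.
move=> a b c; apply/ffunP => w; rewrite !tmulE.
transitivity (conv (ext a) (conv (ext b) (ext c)) w).
  by apply: eq_conv => // t tw; rewrite ext_tmul// (leq_trans tw)// size_bseq.
rewrite convA; apply: eq_conv => // t tw.
by rewrite ext_tmul// (leq_trans tw)// size_bseq.
Qed.

Let ext_tone s : (size s <= N)%N -> ext tone s = (size s == 0)%:R.
Proof. by move=> sN; rewrite /ext ffunE /insub_bseq insubdK. Qed.

Fact tmul1r : left_id tone tmul.
Proof.
move=> a; apply/ffunP => w; rewrite tmulE -[RHS]extE /conv big_ord_recl.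
rewrite take0 drop0 ext_tone// mul1r big1 ?addr0// => k _.
rewrite ext_tone; last first.
  by apply: leq_trans (size_bseq w); rewrite size_take; case: ltnP => // /ltnW.
by rewrite size_takel ?mul0r //; exact: ltn_ord.
Qed.

Fact tmulr1 : right_id tone tmul.
Proof.
move=> a; apply/ffunP => w; rewrite tmulE -[RHS]extE /conv big_ord_recr /=.
rewrite take_size drop_size ext_tone// mulr1 big1 ?add0r// => k _.
rewrite ext_tone; last first.
  by apply: leq_trans (size_bseq w); rewrite size_drop leq_subr.
by rewrite size_drop subn_eq0 leqNgt ltn_ord mulr0.
Qed.

Fact tmulDl : left_distributive tmul +%R.
Proof.
move=> a b c; apply/ffunP => w; rewrite !ffunE -big_split.
by apply: eq_bigr => k _; rewrite ffunE mulrDl.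
Qed.

Fact tmulDr : right_distributive tmul +%R.
Proof.
move=> a b c; apply/ffunP => w; rewrite !ffunE -big_split.
by apply: eq_bigr => k _; rewrite ffunE mulrDr.
Qed.

Fact tone_neq0 : tone != 0.
Proof. by apply/eqP => /ffunP/(_ [bseq])/eqP; rewrite !ffunE oner_eq0. Qed.

HB.instance Definition _ := GRing.Zmodule_isNzRing.Build tensor
  tmulA tmul1r tmulr1 tmulDl tmulDr tone_neq0.

Fact tscaleAl x a b : x *: (a * b) = (x *: a) * b.
Proof.
apply/ffunP => w; rewrite !ffunE scaler_sumr; apply: eq_bigr => k _.
by rewrite ffunE scalerAl.
Qed.

HB.instance Definition _ := GRing.Lmodule_isLalgebra.Build R tensor tscaleAl.

Fact tscaleAr x a b : x *: (a * b) = a * (x *: b).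
Proof.
apply/ffunP => w; rewrite !ffunE scaler_sumr; apply: eq_bigr => k _.
by rewrite ffunE scalerAr.
Qed.

HB.instance Definition _ := GRing.Lalgebra_isAlgebra.Build R tensor tscaleAr.

(* An element is invertible if and only if its R-component a0 is nonzero; the
   inverse is then given by the (truncated) Neumann series for a / a0. *)
Definition tunit : pred tensor := fun a => a [bseq] != 0.

Definition tinv a : tensor :=
  if tunit a then
    (a [bseq])^-1 *: \sum_(n < N.+1) (1 - (a [bseq])^-1 *: a) ^+ n
  else a.

Let tmul_nil a b : (a * b) [bseq] = a [bseq] * b [bseq].
Proof. by rewrite [LHS]tmulE conv_nil -[in RHS](extE a) -[in RHS](extE b). Qed.

Let tnilp a n w : a [bseq] = 0 -> (size w < n)%N -> (a ^+ n) w = 0.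
Proof.
move=> a0; elim: n w => // n IH w wn; rewrite exprS [LHS]tmulE /conv.
rewrite big_ord_recl /= big1 => [|k _].
  rewrite take0 (_ : ext a [::] = 0) ?mul0r ?addr0//.
  by rewrite -a0 -(extE a).
rewrite (_ : ext (a ^+ n) _ = 0) ?mulr0//; apply: IH.
apply: (leq_ltn_trans (size_insub_bseq _ _)); rewrite size_drop /bump leq0n.
by rewrite ltn_subLR //= ?add1n; have := ltn_ord k; lia.
Qed.

Let one_nil : (1 : tensor) [bseq] = 1.
Proof. by rewrite ffunE. Qed.

Let neumann a : tunit a ->
  let u := (a [bseq])^-1 *: a in (1 - u) ^+ N.+1 = 0.
Proof.
move=> a0 u; apply/ffunP => w; rewrite tnilp ?ffunE// ?ltnS ?size_bseq//.
by rewrite /= [_ *: _](mulVf a0) subrr.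
Qed.

Fact tmulVr : {in tunit, left_inverse 1 tinv *%R}.
Proof.
move=> a ua; rewrite /tinv (ua : tunit a) -scalerAl.
have := neumann ua; set u := _ *: a => /= u0.
rewrite scalerAr -/u.
have {2}-> : u = - (1 - u - 1) by rewrite addrAC subrr sub0r opprK.
rewrite mulrN.
have -> : (\sum_(n < N.+1) (1 - u) ^+ n) * (1 - u - 1) =
    (1 - u - 1) * \sum_(n < N.+1) (1 - u) ^+ n.
  apply: commr_sym; apply: commr_sum => n _; apply: commrX.
  by apply: commr_sym; apply: commrB => //; apply: commr1.
by rewrite -subrX1 u0 sub0r opprK.
Qed.

Fact tmulrV : {in tunit, right_inverse 1 tinv *%R}.
Proof.
move=> a ua; rewrite -[RHS](tmulVr ua) /tinv (ua : tunit a).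
rewrite -scalerAr -scalerAl; congr (_ *: _).
apply: commr_sum => n _; apply: commrX; apply: commrB; first exact: commr1.
by rewrite /GRing.comm -scalerAl -scalerAr.
Qed.

Fact tunitP a b : b * a = 1 /\ a * b = 1 -> tunit a.
Proof.
move=> [_ /ffunP/(_ [bseq])]; rewrite tmul_nil one_nil => ab.
by apply: contra_eq_neq ab => ->; rewrite mul0r eq_sym oner_eq0.
Qed.

Fact tinv_out : {in [predC tunit], tinv =1 id}.
Proof. by move=> a; rewrite inE /tinv /in_mem /= => /negbTE ->. Qed.

HB.instance Definition _ := GRing.NzRing_hasMulInverse.Build tensor
  tmulVr tmulrV tunitP tinv_out.

End TensorAlgebra.

Section RoughPaths.
Context (R : realType) (l N : nat).
Local Notation tensor := (tensor R l N).
Implicit Types (a b : tensor) (X Y : R -> tensor).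

Definition tvec (v : 'rV[R]_l) : tensor :=
  [ffun w : N.-bseq 'I_l => if val w is [:: i] then v ord0 i else 0 : R].

Definition lie_bracket a b : tensor := a * b - b * a.

Definition texp a : tensor := \sum_(n < N.+1) n`!%:R^-1 *: a ^+ n.

Definition tlog a : tensor :=
  \sum_(1 <= n < N.+1) ((-1) ^+ n.+1 / n%:R) *: (a - 1) ^+ n.

Inductive free_nilpotent_lie : set tensor :=
| free_nilpotent_lie_vec v : free_nilpotent_lie (tvec v)
| free_nilpotent_lie_add a b : free_nilpotent_lie a -> free_nilpotent_lie b -> free_nilpotent_lie (a + b)
| free_nilpotent_lie_scale (x : R) a : free_nilpotent_lie a -> free_nilpotent_lie (x *: a)
| free_nilpotent_lie_bracket a b :
    free_nilpotent_lie a -> free_nilpotent_lie b -> free_nilpotent_lie (lie_bracket a b).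

Definition free_nilpotent_group : set tensor := texp @` free_nilpotent_lie.

(* The sup norm on the coordinates of the component in (R^l)^{(x) i}; this is
   consistent with the norm of the library on 'rV[R]_l, and equivalent to any
   other norm. *)
Definition level_norm (i : nat) a : R :=
  \big[Num.max/0]_(w : N.-bseq 'I_l | size w == i) `|a w|.

Definition increment X (s t : R) : tensor := (X s)^-1 * X t.

Definition holder_norm (p T : R) (A : R -> R -> tensor) : \bar R :=
  \big[maxe/0%E]_(1 <= i < N.+1)
    ereal_sup [set q | exists s t : R, [/\ 0 <= s, s < t, t <= T
      & q = (level_norm i (A s t) / `|t - s| `^ (i%:R / p))%:E]].

Definition rp_dist (p T : R) X Y : \bar R :=
  holder_norm p T (fun s t => increment X s t - increment Y s t).

End RoughPaths.

(* The integer part of p is [Num.truncn p], as p >= 0 in all uses. Only the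
   restriction of X to [0, T] matters. *)
Definition weak_geometric_rough_path (R : realType) (l : nat) (p T : R)
    (X : R -> tensor R l (Num.truncn p)) : Prop :=
  (forall t, 0 <= t <= T -> free_nilpotent_group (X t)) /\
  (holder_norm p T (increment X) < +oo)%E.
Arguments weak_geometric_rough_path {R l} p T X.

Section BoundedFunctions.
Context (R : realType) (E : normedModType R).
Implicit Types (f : E -> E) (k j : nat).

(* [iter_diff f [:: v_1; ...; v_j] x] is D^j f(x)(v_1, ..., v_j), with D^j f
   identified to D(D^{j-1} f), the outermost derivative being along v_1. *)
Definition iter_diff f (vs : seq E) : E -> E :=
  foldr (fun v (g : E -> E) => fun x => 'd g x v) f vs.

Definition diff_norm f j (x : E) : \bar R :=
  ereal_sup [set q | exists vs : j.-tuple E,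
    (forall v, v \in vs -> `|v| <= 1) /\ q = `|iter_diff f vs x|%:E].

Definition Ckb_norm k f : \bar R :=
  \big[maxe/0%E]_(j < k.+1) ereal_sup (range (diff_norm f j)).

(* The first two conditions are the Frechet differentiability of D^j f, j < k,
   and the continuity of D^k f, both with respect to the operator norm
   on the (bounded) multilinear maps. *)
Definition Ckb k f : Prop :=
  [/\ forall j, (j < k)%N -> forall (x : E) (e : R), 0 < e ->
        \forall h \near (0 : E), forall vs : j.-tuple E,
          `|iter_diff f vs (x + h) - iter_diff f vs x - iter_diff f (h :: vs) x|
            <= e * `|h| * \prod_(v <- vs) `|v|,
      forall (x : E) (e : R), 0 < e ->
        \forall h \near (0 : E), forall vs : k.-tuple E,
          `|iter_diff f vs (x + h) - iter_diff f vs x|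
            <= e * \prod_(v <- vs) `|v|
    & (Ckb_norm k f < +oo)%E].

Definition continuous_to_Ckb l k (F : {linear 'rV[R]_l -> (E -> E)}) : Prop :=
  (forall v, Ckb k (F v)) /\
  (forall (v0 : 'rV[R]_l) (e : R), 0 < e ->
    \forall v \near v0, (Ckb_norm k (F v - F v0)%R < e%:E)%E).

End BoundedFunctions.

Section SolutionFlows.
Context (R : realType) (E : normedModType R).
Context (l : nat) (F : {linear 'rV[R]_l -> (E -> E)}).

Definition dop1 (v : 'rV[R]_l) (g : E -> E) : E -> E := fun x => 'd g x (F v x).

(* The linear extension of e_{i_1} (x) ... (x) e_{i_r} |->
   F(e_{i_1}) o ... o F(e_{i_r}), where e_i = delta_mx ord0 i. *)
Definition dop N (a : tensor R l N) (g : E -> E) : E -> E :=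
  fun x => \sum_(w : N.-bseq 'I_l)
    a w *: foldr (fun i => dop1 (delta_mx ord0 i)) g w x.

Definition dop_field N (a : tensor R l N) : E -> E := dop a id.

Definition ode_path (V : E -> E) (x : E) (y : R -> E) : Prop :=
  [/\ y 0 = x, {within `[0, 1], continuous y}
    & forall u : R, 0 < u < 1 -> is_derive u (1 : R) y (V (y u))].

(* The equivalence expresses the well-posedness of the equation up to time 1 as
   well as the value of its time-1 map. *)
Definition time1_map (V m : E -> E) : Prop :=
  forall x z, m x = z <-> exists2 y, ode_path V x y & y 1 = z.

Definition sup_dist (f g : E -> E) : \bar R :=
  ereal_sup (range (fun x => `|f x - g x|%:E)).

(* Only the values phi s t with 0 <= s <= t <= T matter; phi s t is the map
   written phi_{ts}. *)
Definition flow (T : R) (phi : R -> R -> E -> E) : Prop :=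
  (forall t, 0 <= t <= T -> phi t t =1 id) /\
  (forall s u t : R, 0 <= s -> s <= u -> u <= t -> t <= T ->
    phi s t =1 phi u t \o phi s u).

Definition flow_dist (T : R) (phi psi : R -> R -> E -> E) : \bar R :=
  ereal_sup [set q | exists s t : R, [/\ 0 <= s, s <= t, t <= T
    & q = sup_dist (phi s t) (psi s t)]].

Definition solution_flow N (T a : R) (X : R -> tensor R l N)
    (phi : R -> R -> E -> E) : Prop :=
  flow T phi /\
  exists2 mu : R -> R -> E -> E,
    forall s t : R, 0 <= s -> s <= t -> t <= T ->
      time1_map (dop_field (tlog (increment X s t))) (mu s t)
  & exists delta c : R, [/\ 0 < delta, 0 < c
      & forall s t : R, 0 <= s -> s <= t -> t <= T -> t - s <= delta ->
          (sup_dist (phi s t) (mu s t) <= (c * `|t - s| `^ a)%R%:E)%E].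

Definition unif_lipschitz_homeo (T : R) (phi : R -> R -> E -> E) : Prop :=
  exists2 psi : R -> R -> E -> E,
    forall s t : R, 0 <= s -> s <= t -> t <= T ->
      [/\ cancel (phi s t) (psi s t), cancel (psi s t) (phi s t),
          continuous (phi s t) & continuous (psi s t)]
  & exists L : R, forall s t : R, 0 <= s -> s <= t -> t <= T ->
      L.-lipschitz (phi s t) /\ L.-lipschitz (psi s t).

End SolutionFlows.

(* Main.v *)
(* By Taylor expansion along the ordinary differential equation, and since
   F^⊗(Λ) is a first order operator for a Lie element Λ, the time-1 map mu_ts
   agrees with F^⊗(X_ts) Id up to an error which is of order |t - s|^a, with
   a = ([p] + 1) / p > 1, both in the uniform norm and as a Lipschitz function.
   Chen's relation X_su X_ut = X_ts then makes mu an almost flow: the defect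
   mu_tu o mu_us - mu_ts has order |t - s|^a. Together with a four-point estimate
   on mu, this is enough to let the compositions of mu along partitions converge
   to a flow that is uniformly Lipschitz and |t - s|^a-close to mu.

   Everything else is telescoping over n pieces of [s, t], where an error of order
   (T / n)^a on each piece sums up to O(n^(1 - a)): two flows close to mu are equal;
   the flow of the time-reversed rough path, whose increments are the inverses of
   those of X, inverts the flow of X; and flows of close rough paths are close,
   because their time-1 maps are on the pieces of a fixed partition. The time-1
   maps themselves are obtained by sewing the Euler scheme.

   That the increments stay in exp of the Lie algebra is proved without the
   Campbell-Hausdorff formula, through the derivation D acting as multiplication
   by r on the tensors of degree r: g is in the group if and only if D(g) g^-1 is
   in the Lie algebra. *)
Require Import Defs.
From HB Require Import structures.
From mathcomp Require Import all_boot all_order all_algebra.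
From mathcomp Require Import all_classical all_reals all_analysis.
From mathcomp Require Import zify ring lra.

Set Implicit Arguments.
Unset Strict Implicit.
Unset Printing Implicit Defensive.
Import Order.TTheory GRing.Theory Num.Theory.
Import numFieldNormedType.Exports.
Local Open Scope classical_set_scope.
Local Open Scope ring_scope.

(** * Linear combinations of vectors *)

(** Two obstacles shape the estimates. The Lipschitz constant of mu_ts is only 1 + O(|t - s|^(1/p)),
    and products of such constants over fine partitions blow up. Compositions along a partition are
    therefore compared with mu itself, including the Lipschitz constant of the difference: a
    partition is cut around its midpoint and, since 2 * 2^-a < 1, the errors of the two halves leave
    room for a factor 1 + O(eps) and for the defect, so the induction closes with constants
    independent of the partition. On the other side, F has only N + 1 derivatives, N = [p]. The
    field of a word of length r keeps N + 2 - r bounded derivatives: at least two for r <= N, just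
    enough for the four-point estimate. The tail of the Taylor expansion, made of derivatives of one
    such field along another, keeps one, just enough for a Lipschitz bound; expansions are cut by
    word length accordingly. Finally, tensors are estimated homogeneously: with h = |t - s|^(1/p),
    the coefficient of a word w is O(h^|w|), a property stable under products, exp and log. *)

Section LinearExpressions.
Context (R : comNzRingType) (V : lmodType R).

Inductive lexp :=
  | LVar of nat | LZero | LAdd of lexp & lexp | LOpp of lexp | LScale of R & lexp.

Fixpoint leval (env : seq V) (e : lexp) : V :=
  match e with
  | LVar n => nth 0 env n
  | LZero => 0
  | LAdd a b => leval env a + leval env b
  | LOpp a => - leval env a
  | LScale c a => c *: leval env a
  end.

Fixpoint lcoef (e : lexp) (n : nat) : R :=
  match e with
  | LVar m => if Nat.eqb m n then 1 else 0
  | LZero => 0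
  | LAdd a b => lcoef a n + lcoef b n
  | LOpp a => - lcoef a n
  | LScale c a => c * lcoef a n
  end.

(** Recursion on the number of atoms: on a concrete list, [/=] unfolds it into one scalar equation
    per atom, each left to [ring]. *)
Fixpoint lcoef_eq (n : nat) (e1 e2 : lexp) : Prop :=
  if n is n'.+1 then lcoef e1 n' = lcoef e2 n' /\ lcoef_eq n' e1 e2 else True.

Lemma levalE env e : leval env e = \sum_(i < size env) lcoef e i *: nth 0 env i.
Proof.
elim: e => /= [n||a -> b ->|a ->|c a ->].
- have [ns|sn] := ltnP n (size env).
    rewrite (bigD1 (Ordinal ns))//= PeanoNat.Nat.eqb_refl scale1r big1 ?addr0// => i.
    rewrite -val_eqE /= => /eqP ni; case: PeanoNat.Nat.eqb_spec => [nE|_]; last by rewrite scale0r.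
    by case: ni.
  rewrite nth_default// big1// => i _; case: PeanoNat.Nat.eqb_spec => [nE|_]; last by rewrite scale0r.
  by have := ltn_ord i; rewrite -nE ltnNge sn.
- by rewrite big1// => i _; rewrite scale0r.
- by rewrite -big_split; apply: eq_bigr => i _; rewrite scalerDl.
- by rewrite -sumrN; apply: eq_bigr => i _; rewrite scaleNr.
- by rewrite scaler_sumr; apply: eq_bigr => i _; rewrite scalerA.
Qed.

Lemma leval_eq env e1 e2 : lcoef_eq (size env) e1 e2 -> leval env e1 = leval env e2.
Proof.
move=> H; rewrite !levalE; apply: eq_bigr => i _; congr (_ *: _).
elim: (size env) i H => [|n IH] [i il]//= [H0 H].
move: il; rewrite ltnS leq_eqVlt => /predU1P[->//|il].
exact: (IH (Ordinal il)).
Qed.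

End LinearExpressions.

(* Two atoms may differ only by the inferred algebraic structures. *)
Ltac lin_find env t :=
  lazymatch env with
  | cons ?a ?l => match l with _ => let _ := match l with _ => unify a t end in constr:(O)
                  | _ => let n := lin_find l t in constr:(S n) end
  end.

Ltac lin_index env t :=
  lazymatch env with
  | context [cons t _] =>
    lazymatch env with
    | cons t _ => constr:(O)
    | cons _ ?l => let n := lin_index l t in constr:(S n)
    end
  | _ => lin_find env t
  end.

Ltac lin_atoms env t :=
  lazymatch t with
  | (?a + ?b)%R => let env := lin_atoms env a in lin_atoms env b
  | (- ?a)%R => lin_atoms env a
  | (?c *: ?a)%R => lin_atoms env a
  | (0)%R => env
  | _ => match env with
         | _ => let n := lin_index env t in env
         | _ => constr:(cons t env)
         end
  end.

Ltac lin_quote R env t :=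
  lazymatch t with
  | (?a + ?b)%R => let a := lin_quote R env a in let b := lin_quote R env b in
      constr:(LAdd a b)
  | (- ?a)%R => let a := lin_quote R env a in constr:(LOpp a)
  | (?c *: ?a)%R => let a := lin_quote R env a in constr:(@LScale R c a)
  | (0)%R => constr:(@LZero R)
  | _ => let n := lin_index env t in constr:(@LVar R n)
  end.

(* Proves identities between linear combinations of vectors, by comparing the
   coefficients with [ring]. *)
Ltac lmod :=
  lazymatch goal with
  | R : realType |- @eq ?T ?x ?y =>
    let env := lin_atoms (@nil T) x in let env := lin_atoms env y in
    let e1 := lin_quote R env x in let e2 := lin_quote R env y in
    refine (@leval_eq R _ env e1 e2 _); rewrite /=; repeat split; ring
  end.

(** * The truncated tensor algebra *)

Section Tensors.
Context (R : realType) (l N : nat).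
Local Notation tensor := (tensor R l N).
Local Notation word := (N.-bseq 'I_l).
Implicit Types (a b c Z : tensor) (w : word) (r k : nat).

Lemma tensor_mulE a b w : (a * b) w = \sum_(k < (size w).+1)
  a (insub_bseq N (take k w)) * b (insub_bseq N (drop k w)).
Proof. by rewrite (_ : a * b = tmul a b)// ffunE. Qed.

Lemma tensor_oneE w : (1 : tensor) w = (size w == 0)%:R.
Proof. by rewrite (_ : 1 = tone R l N)// ffunE. Qed.

Lemma tensor_scaleE (x : R) a w : (x *: a) w = x * a w.
Proof. by rewrite ffunE. Qed.

Lemma insub_bseq_take k w : insub_bseq N (take k w) = take k w :> seq 'I_l.
Proof.
rewrite /insub_bseq insubdK// unfold_in /= (leq_trans _ (size_bseq w))//.
by rewrite size_take; case: ltnP => // /ltnW.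
Qed.

Lemma insub_bseq_drop k w : insub_bseq N (drop k w) = drop k w :> seq 'I_l.
Proof.
by rewrite /insub_bseq insubdK// unfold_in /= (leq_trans _ (size_bseq w))// size_drop leq_subr.
Qed.

Lemma insub_bseq_val w : insub_bseq N w = w.
Proof. by rewrite /insub_bseq valKd. Qed.

(** Cutting a word is a bijection from pairs (w, k), k <= |w|, to pairs of words of total size at
    most N. With g the operator of a word, this turns products of tensors into compositions of
    operators. *)
Lemma sum_tensor_mul (V : lmodType R) a b (g : seq 'I_l -> V) :
  \sum_w (a * b) w *: g w =
  \sum_(v : word) \sum_(w : word | (size v + size w <= N)%N)
    (a v * b w) *: g (v ++ w).
Proof.
rewrite pair_big_dep /=.
under eq_bigr => w _ do rewrite tensor_mulE scaler_suml.
have -> : \sum_(w : word) \sum_(k < (size w).+1)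
    (a (insub_bseq N (take k w)) * b (insub_bseq N (drop k w))) *: g w =
  \sum_(w : word) \sum_(k < N.+1 | (k <= size w)%N)
    (a (insub_bseq N (take k w)) * b (insub_bseq N (drop k w))) *: g w.
  apply: eq_bigr => w _.
  by rewrite (big_ord_widen N.+1 (fun k => (a (insub_bseq N (take k w)) *
    b (insub_bseq N (drop k w))) *: g w)) ?ltnS ?size_bseq.
rewrite pair_big_dep /=.
rewrite (reindex_onto
  (fun q : word * word => (insub_bseq N (q.1 ++ q.2), inord (size q.1) : 'I_N.+1))
  (fun q : word * 'I_N.+1 => (insub_bseq N (take q.2 q.1), insub_bseq N (drop q.2 q.1)))) /=;
  last first.
  move=> [w k] /= kw; congr (_, _).
    by apply/val_inj; rewrite /= insub_bseq_take insub_bseq_drop cat_take_drop insub_bseq_val.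
  by apply/val_inj; rewrite /= insub_bseq_take size_takel// inordK// ltnS (leq_trans kw (size_bseq w)).
have cE (v w : word) : (size v + size w <= N)%N -> insub_bseq N (v ++ w) = v ++ w :> seq _.
  by move=> vw; rewrite /insub_bseq insubdK// unfold_in /= size_cat.
have sz (u : word) k : (k <= size u)%N ->
    (size (insub_bseq N (take k u)) + size (insub_bseq N (drop k u)) <= N)%N.
  move=> ku; rewrite insub_bseq_take insub_bseq_drop size_takel// size_drop subnKC//.
  exact: size_bseq.
apply: eq_big => [[v w]|[v w]] /=.
  rewrite inordK ?ltnS ?size_bseq//.
  apply/andP/idP => [[vN /eqP[vE wE]]|vw].
    by have := sz _ _ vN; rewrite vE wE.
  rewrite cE// size_cat leq_addr; split=> //; apply/eqP; congr (_, _).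
    by rewrite take_size_cat// insub_bseq_val.
  by rewrite drop_size_cat// insub_bseq_val.
rewrite inordK ?ltnS ?size_bseq// => /andP[vN /eqP[vE wE]].
have vw : (size v + size w <= N)%N by have := sz _ _ vN; rewrite vE wE.
by rewrite cE// take_size_cat// drop_size_cat// !insub_bseq_val.
Qed.

Definition level r a : tensor := [ffun w : word => if size w == r then a w else 0].

Lemma levelE r a w : level r a w = if size w == r then a w else 0.
Proof. by rewrite ffunE. Qed.

Lemma level_linear r : linear (level r).
Proof.
move=> x a b; apply/ffunP => w; rewrite !(ffunE, levelE).
by case: ifP => // _; rewrite scaler0 addr0.
Qed.

HB.instance Definition _ r :=
  @GRing.isLinear.Build R tensor tensor _ (level r) (@level_linear r).

Lemma level_level r k a : level r (level k a) = if r == k then level r a else 0.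
Proof.
apply/ffunP => w; rewrite !levelE; have [->|rk] := eqVneq r k.
  by rewrite levelE; case: (size w == k).
by rewrite ffunE; case: (eqVneq (size w) r) => // ->; rewrite (negbTE rk).
Qed.

Lemma level_mul r a b : level r (a * b) =
  \sum_(i < r.+1) level i a * level (r - i) b.
Proof.
apply/ffunP => w; rewrite levelE sum_ffunE; case: eqP => [wr|wr].
  rewrite tensor_mulE wr; apply: eq_bigr => i _.
  have ir : (i <= size w)%N by rewrite wr -ltnS.
  have iw : (i < (size w).+1)%N by rewrite ltnS.
  rewrite tensor_mulE (bigD1 (Ordinal iw))//= !levelE insub_bseq_take insub_bseq_drop.
  rewrite size_takel// size_drop (_ : (size w - i == r - i)%N) ?wr// eqxx big1 ?addr0// => j ji.
  rewrite levelE insub_bseq_take size_takel ?(ltn_ord j)//.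
    rewrite ifF ?mul0r//; apply: contraNF ji => /eqP ji.
    by apply/eqP/val_inj.
  by rewrite -ltnS.
rewrite big1// => i _; rewrite tensor_mulE big1// => j _.
have jw : (j <= size w)%N by rewrite -ltnS.
rewrite !levelE insub_bseq_take insub_bseq_drop size_takel// size_drop.
case: eqP => ji; last by rewrite mul0r.
case: eqP => jr; last by rewrite mulr0.
case: wr; move: jr (ltn_ord i) (ltn_ord j); rewrite ji; lia.
Qed.

(** The filtration by degree: [low k] is an ideal, degrees add under products, and [low N.+1] is
    zero, whence the nilpotency of [low 1]. *)
Definition low k a := forall w, (size w < k)%N -> a w = 0.

Lemma low0 a : low 0 a. Proof. by []. Qed.

Lemma lowW k k' a : (k' <= k)%N -> low k a -> low k' a.
Proof. by move=> kk ak w wk; apply: ak; exact: leq_trans wk kk. Qed.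

Lemma low_eq0 k a : (N < k)%N -> low k a -> a = 0.
Proof.
by move=> Nk ak; apply/ffunP => w; rewrite ak ?ffunE// (leq_ltn_trans (size_bseq w)).
Qed.

Lemma lowD k a b : low k a -> low k b -> low k (a + b).
Proof. by move=> ak bk w wk; rewrite ffunE ak// bk// addr0. Qed.

Lemma lowZ k x a : low k a -> low k (x *: a).
Proof. by move=> ak w wk; rewrite ffunE ak// scaler0. Qed.

Lemma lowN k a : low k a -> low k (- a).
Proof. by rewrite -scaleN1r; exact: lowZ. Qed.

Lemma low_sum (I : Type) (s : seq I) (P : pred I) k (f : I -> tensor) :
  (forall i, P i -> low k (f i)) -> low k (\sum_(i <- s | P i) f i).
Proof.
move=> fk; elim/big_ind: _ => //; last exact: lowD.
by move=> w _; rewrite ffunE.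
Qed.

Lemma lowM k j a b : low k a -> low j b -> low (k + j) (a * b).
Proof.
move=> ak bj w wkj; rewrite tensor_mulE big1// => i _.
have iw : (i <= size w)%N by rewrite -ltnS.
have [ik|ki] := ltnP i k.
  by rewrite ak ?mul0r// insub_bseq_take size_takel.
by rewrite [X in _ * X]bj ?mulr0// insub_bseq_drop size_drop; lia.
Qed.

Lemma low1P a : low 1 a <-> a [bseq] = 0.
Proof.
split=> [|a0 w]; first exact.
by rewrite ltnS leqn0 size_eq0 => /eqP w0; rewrite -[RHS]a0; congr (a _); apply/val_inj.
Qed.

Lemma lowX k a : low 1 a -> low k (a ^+ k).
Proof.
move=> a1; elim: k => [|k IH]; first exact: low0.
by rewrite exprS -add1n; exact: lowM.
Qed.

Lemma low_expr_eq0 k a : low 1 a -> (N < k)%N -> a ^+ k = 0.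
Proof. by move=> a1 Nk; apply: low_eq0 Nk _; exact: lowX. Qed.

Lemma low_level k a : (forall r, (r < k)%N -> level r a = 0) -> low k a.
Proof. by move=> ak w /ak /ffunP/(_ w); rewrite levelE eqxx ffunE. Qed.

Lemma level_low k r a : low k a -> (r < k)%N -> level r a = 0.
Proof.
by move=> ak rk; apply/ffunP => w; rewrite levelE ffunE; case: eqP => // wr; rewrite ak// wr.
Qed.

End Tensors.

(** * The free nilpotent group *)

Section AdjointPowers.
Context (A : nzRingType).
Implicit Types (x z : A).

Let ad z x := z * x - x * z.

(** Left multiplication by z is the sum of [ad z] and of right multiplication by z, which commute:
    this is the binomial formula. *)
Lemma mulX_ad z x n :
  z ^+ n * x = \sum_(k < n.+1) (iter k (ad z) x * z ^+ (n - k)) *+ 'C(n, k).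
Proof.
elim: n => [|n IH]; first by rewrite big_ord1 expr0 mul1r mulr1.
have zad y m : z * (y * z ^+ m) = ad z y * z ^+ m + y * z ^+ m.+1.
  by rewrite exprS !mulrA -mulrDl subrK.
rewrite exprS -mulrA IH mulr_sumr.
under eq_bigr => k _ do rewrite mulrnAr zad mulrnDl.
rewrite big_split /= [RHS]big_ord_recl bin0 subn0 /=.
under [X in _ = _ + X]eq_bigr => k _ do rewrite binS subSS mulrnDr.
rewrite [X in _ = _ + X]big_split /= [RHS]addrA [RHS]addrC; congr (_ + _).
rewrite big_ord_recl bin0 subn0 /=; congr (_ + _).
rewrite [RHS]big_ord_recr /= bin_small// mulr0n addr0.
by apply: eq_bigr => k _; rewrite /bump /= add1n subnSK.
Qed.

(** Divided by n! and summed over n, this gives the derivative of the exponential in terms of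
    iterated brackets. *)
Lemma derX_ad (D : {additive A -> A}) z n :
  (forall x y, D (x * y) = D x * y + x * D y) -> D 1 = 0 ->
  D (z ^+ n) = \sum_(k < n) (iter k (ad z) (D z) * z ^+ (n.-1 - k)) *+ 'C(n, k.+1).
Proof.
move=> DM D1; elim: n => [|n IH]; first by rewrite big_ord0 expr0 D1.
have zad y m : z * (y * z ^+ m) = ad z y * z ^+ m + y * z ^+ m.+1.
  by rewrite exprS !mulrA -mulrDl subrK.
rewrite exprS DM IH mulr_sumr /=.
under eq_bigr => k _ do rewrite mulrnAr zad mulrnDl.
rewrite big_split /=.
under [RHS]eq_bigr => k _ do rewrite binS mulrnDr.
rewrite [RHS]big_split /= addrA addrC; congr (_ + _).
  rewrite big_ord_recr /= bin_small// mulr0n addr0.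
  apply: eq_bigr => k _; congr (_ * z ^+ _ *+ _).
  by have := ltn_ord k; lia.
rewrite [RHS]big_ord_recl /= bin0 subn0; congr (_ + _).
apply: eq_bigr => k _; congr (_ * z ^+ _ *+ _).
by rewrite /bump /=; have := ltn_ord k; lia.
Qed.

(** The hypothesis expresses nilpotency: of the square of indices, only the triangle k + j <= N
    contributes. *)
Lemma cauchy_product (N : nat) (u v : nat -> A) :
  (forall k j, (N < k + j)%N -> u k * v j = 0) ->
  (\sum_(k < N.+1) u k) * (\sum_(j < N.+1) v j) =
  \sum_(n < N.+1) \sum_(k < n.+1) u k * v (n - k)%N.
Proof.
move=> uv; rewrite mulr_suml.
transitivity (\sum_(k < N.+1) \sum_(n < N.+1 | (k <= n)%N) u k * v (n - k)%N).
  apply: eq_bigr => k _; rewrite mulr_sumr.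
  rewrite -(big_mkord xpredT (fun j => u k * v j)).
  rewrite -(big_mkord (fun n => (k <= n)%N) (fun n => u k * v (n - k)%N)).
  have kN : (k <= N.+1)%N by rewrite ltnW.
  rewrite [RHS](big_cat_nat (leq0n k) kN)//= [X in _ = X + _]big_nat_cond [X in _ = X + _]big1 ?add0r; last first.
    by move=> i /andP[/andP[_ ik] ki]; move: ik; rewrite ltnNge ki.
  rewrite [RHS]big_nat_cond [RHS](eq_bigl (fun n => (k <= n < N.+1)%N)); last first.
    by move=> i /=; case: (k <= i)%N; rewrite ?andbF ?andbT.
  rewrite -[RHS]big_nat.
  transitivity (\sum_(0 + k <= i < N.+1) u k * v (i - k)%N); last by [].
  rewrite [RHS]big_addn.
  rewrite (@big_cat_nat _ _ _ (N.+1 - k)) //=; last by rewrite leq_subr.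
  rewrite [X in _ + X]big_nat_cond [X in _ + X]big1 ?addr0; last first.
    by move=> i /andP[/andP[iN _] _]; apply: uv; lia.
  by apply: eq_bigr => i _; rewrite addnK.
rewrite (exchange_big_dep xpredT)//=; apply: eq_bigr => n _.
by rewrite [RHS](big_ord_widen N.+1 (fun k => u k * v (n - k)%N)).
Qed.

End AdjointPowers.

Lemma invf_fact_bin (F : numFieldType) n k : (k <= n)%N ->
  n`!%:R^-1 * 'C(n, k)%:R = k`!%:R^-1 * (n - k)`!%:R^-1 :> F.
Proof.
move=> kn; rewrite -(bin_fact kn) !natrM.
have : k`!%:R != 0 :> F by rewrite pnatr_eq0 -lt0n fact_gt0.
have : (n - k)`!%:R != 0 :> F by rewrite pnatr_eq0 -lt0n fact_gt0.
have : 'C(n, k)%:R != 0 :> F by rewrite pnatr_eq0 -lt0n bin_gt0.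
by move=> C0 _ _; rewrite invfM mulrAC mulVf// mul1r invfM.
Qed.

(** * Truncated exponential and logarithm, and stability of the group under products *)

Section ExpLog.
Context (R : realType) (l N : nat).
Local Notation tensor := (tensor R l N).
Local Notation word := (N.-bseq 'I_l).
Local Notation Lie := (@free_nilpotent_lie R l N).
Implicit Types (a b c Z g h : tensor) (w : word) (r k : nat).

Lemma texp_cauchy a b : low 1 a -> low 1 b -> GRing.comm a b ->
  texp (a + b) = texp a * texp b.
Proof.
move=> a1 b1 ab; rewrite /texp.
rewrite (cauchy_product (u := fun n => n`!%:R^-1 *: a ^+ n) (v := fun n => n`!%:R^-1 *: b ^+ n)).
  apply: eq_bigr => n _; rewrite addrC exprDn_comm; last exact: commr_sym.
  rewrite scaler_sumr; apply: eq_bigr => k _.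
  rewrite -[_ *+ 'C(_, _)]scaler_nat -[in RHS]scalerAl -[in RHS]scalerAr !scalerA.
  rewrite (commrX _ (commr_sym (commrX _ ab))); congr (_ *: _).
  have kn : (k <= n)%N by rewrite -ltnS.
  exact: invf_fact_bin.
move=> k j kj; rewrite -scalerAl -scalerAr.
have -> : a ^+ k * b ^+ j = 0; last by rewrite !scaler0.
by apply: low_eq0 kj _; apply: lowM; exact: lowX.
Qed.

Lemma texp0 : texp 0 = 1 :> tensor.
Proof.
rewrite /texp big_ord_recl expr0 fact0 invr1 scale1r big1 ?addr0// => k _.
by rewrite expr0n /= scaler0.
Qed.

Lemma texpN a : low 1 a -> texp a * texp (- a) = 1.
Proof.
by move=> a1; rewrite -texp_cauchy ?subrr ?texp0//; [exact: lowN|exact/commrN/commr_refl].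
Qed.

Lemma texpNl a : low 1 a -> texp (- a) * texp a = 1.
Proof. by move=> /lowN/texpN; rewrite opprK. Qed.

Lemma low_texp a : low 1 a -> low 1 (texp a - 1).
Proof.
move=> a1; rewrite /texp big_ord_recl expr0 fact0 invr1 scale1r addrAC subrr add0r.
by apply: low_sum => k _; apply/lowZ/(@lowW _ _ _ k.+1) => //; exact: lowX.
Qed.

(** An identity of polynomials modulo X^(N+1), evaluated at the nilpotent element a: [f], the
    composition of the truncated log and exp, vanishes at 0 and has derivative 1 modulo X^N. *)
Lemma tlog_texp a : low 1 a -> tlog (texp a) = a.
Proof.
move=> a1.
pose expP : {poly R} := \sum_(n < N.+1) n`!%:R^-1 *: 'X^n.
pose logP : {poly R} := \sum_(1 <= n < N.+1) ((-1) ^+ n.+1 / n%:R) *: 'X^n.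
pose q := expP - 1; pose f := logP \Po q.
have expPE : horner_alg a expP = texp a.
  rewrite linear_sum; apply: eq_bigr => n _.
  by rewrite linearZ /= mulr_algl rmorphXn /= horner_algX.
have fE : horner_alg a f = tlog (texp a).
  rewrite /f /logP linear_sum /= rmorph_sum /=; apply: eq_bigr => n _.
  by rewrite comp_polyZ linearZ /= mulr_algl comp_Xn_poly rmorphXn /= rmorphB /= expPE rmorph1.
have q0 : q.[0] = 0.
  rewrite hornerD hornerN hornerC horner_sum big_ord_recl big1 => [|k _].
    by rewrite fact0 invr1 scale1r expr0 hornerC addr0 subrr.
  by rewrite !hornerE /= expr0n mulr0.
have /factor_theorem[q1 qE] : root q 0 by apply/rootP.
rewrite subr0 in qE.
have expP' : expP^`() = expP - N`!%:R^-1 *: 'X^N.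
  rewrite /expP raddf_sum /= big_ord_recl derivZ derivXn mulr0n scaler0 add0r.
  rewrite [in RHS]big_ord_recr /= addrK; apply: eq_bigr => k _.
  rewrite derivZ derivXn /bump /= add1n -['X^_ *+ _]scaler_nat scalerA factS natrM invfM.
  by rewrite mulrAC mulVf ?mul1r// pnatr_eq0.
have logP' : ('X + 1) * logP^`() = 1 - (- 'X) ^+ N.
  rewrite /logP raddf_sum /= big_add1 /=.
  under eq_bigr => n _ do rewrite derivZ derivXn -['X^_ *+ _]scaler_nat scalerA.
  have -> : \sum_(0 <= n < N) ((-1) ^+ n.+2 / n.+1%:R * n.+1%:R) *: 'X^(n.+1.-1) =
      \sum_(i < N) (- 'X : {poly R}) ^+ i.
    rewrite big_mkord; apply: eq_bigr => n _.
    rewrite divfK ?pnatr_eq0// !exprS !mulN1r opprK [in RHS]exprNn.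
    by rewrite -signr_odd scaler_sign -signr_odd mulr_sign.
  rewrite -(opprB _ 1) subrX1 -mulNr; congr (_ * _).
  by rewrite opprB opprK addrC.
(* The derivative of log(1 + X) times 1 + X is 1 up to X^N, and [expP] is its own derivative up to
   X^N; as q is divisible by X, both errors stay divisible by X^N after composition. *)
have f' : f^`() = 1 + 'X^N * (- (- q1) ^+ N - N`!%:R^-1 *: (logP^`() \Po q)).
  rewrite /f deriv_comp {2}/q derivB derivC subr0 expP' mulrBr.
  have -> : (logP^`() \Po q) * expP = 1 - (- q) ^+ N.
    have := congr1 (comp_poly q) logP'.
    rewrite rmorphM rmorphD rmorphB rmorphXn rmorphN /= comp_polyX !rmorph1 => <-.
    by rewrite /q subrK mulrC.
  have -> : (- q) ^+ N = (- q1) ^+ N * 'X^N by rewrite -exprMn mulNr -qE.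
  by rewrite -!mul_polyC; ring.
have fX k : (k < N.+1)%N -> (f - 'X)`_k = 0.
  case: k => [_|k kN].
    rewrite coefB coefX subr0 -horner_coef0 horner_comp q0 /logP.
    rewrite horner_sum big_nat big1// => n /andP[n0 _].
    by rewrite !hornerE expr0n gtn_eqF// mulr0.
  rewrite coefB coefX eqSS; apply/eqP; rewrite subr_eq0.
  have := congr1 (fun p : {poly R} => p`_k) f'.
  move: kN; rewrite ltnS => kN.
  rewrite coef_deriv coefD coefXnM kN addr0 coef1; case: k kN => [|k] kN /=.
    by rewrite mulr1n => ->.
  by move=> /eqP; rewrite mulrn_eq0 /=.
have : take_poly N.+1 (f - 'X) = 0.
  by apply/polyP => k; rewrite coef_take_poly coef0; case: ifP => // /fX.
move=> t0; have := poly_take_drop N.+1 (f - 'X); rewrite t0 add0r.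
move=> /(congr1 (horner_alg a)).
rewrite rmorphM rmorphXn rmorphB /= !horner_algX low_expr_eq0// mulr0 fE => /esym/eqP.
by rewrite subr_eq0 => /eqP.
Qed.

Definition grading a : tensor := [ffun w : word => (size w)%:R * a w].

Lemma gradingE a w : grading a w = (size w)%:R * a w.
Proof. by rewrite ffunE. Qed.

Lemma grading_linear : linear grading.
Proof. by move=> x a b; apply/ffunP => w; rewrite !ffunE mulrDr; congr (_ + _); exact: mulrCA. Qed.

HB.instance Definition _ := @GRing.isLinear.Build R tensor tensor _ grading grading_linear.

Lemma grading_level a : grading a = \sum_(r < N.+1) r%:R *: level r a.
Proof.
apply/ffunP => w; rewrite gradingE sum_ffunE.
rewrite (bigD1 (inord (size w)))//= tensor_scaleE levelE inordK ?ltnS ?size_bseq// eqxx.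
rewrite big1 ?addr0// => i iw; rewrite tensor_scaleE levelE; case: eqP => [wi|_]; last by rewrite mulr0.
by case/eqP: iw; apply/val_inj; rewrite /= inordK// wi.
Qed.

Lemma gradingM a b : grading (a * b) = grading a * b + a * grading b.
Proof.
apply/ffunP => w; rewrite [RHS]ffunE gradingE !tensor_mulE mulr_sumr -big_split /=.
apply: eq_bigr => k _; rewrite !gradingE insub_bseq_take insub_bseq_drop.
have kw : (k <= size w)%N by rewrite -ltnS.
by rewrite size_takel// size_drop natrB//; ring.
Qed.

Lemma grading1 : grading 1 = 0.
Proof.
apply/ffunP => w; rewrite gradingE tensor_oneE ffunE; case: (size w) => [|n].
  by rewrite mul0r.
by rewrite mulr0.
Qed.

Lemma low_grading1 a : low 1 (grading a).
Proof. by move=> w; rewrite ltnS leqn0 gradingE => /eqP ->; rewrite mul0r. Qed.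

Lemma low_grading k a : low k a -> low k (grading a).
Proof. by move=> ak w wk; rewrite gradingE ak// mulr0. Qed.

Lemma lie0 : Lie 0.
Proof. by rewrite -(scale0r (tvec N (0 : 'rV[R]_l))); do 2 constructor. Qed.

Lemma lieN a : Lie a -> Lie (- a).
Proof. by rewrite -scaleN1r; constructor. Qed.

Lemma lie_sum (I : Type) (s : seq I) (P : pred I) (f : I -> tensor) :
  (forall i, P i -> Lie (f i)) -> Lie (\sum_(i <- s | P i) f i).
Proof. by move=> fP; elim/big_ind: _ => //; [exact: lie0|exact: free_nilpotent_lie_add]. Qed.

Lemma lie_low a : Lie a -> low 1 a.
Proof.
elim=> [v|b c _ ? _ ?|x b _ ?|b c _ b1 _ c1].
- by apply/low1P; rewrite ffunE.
- exact: lowD.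
- exact: lowZ.
- by apply: lowD; [|apply: lowN]; apply: (@lowW _ _ _ 2) => //; apply: (@lowM _ _ _ 1 1).
Qed.

Lemma level_bracket r a b : level r (lie_bracket a b) =
  \sum_(i < r.+1) lie_bracket (level i a) (level (r - i) b).
Proof.
rewrite /lie_bracket linearB /= !level_mul sumrB; congr (_ - _).
rewrite (reindex_inj rev_ord_inj) /=; apply: eq_bigr => i _.
by rewrite subSS subKn// -ltnS.
Qed.

(** The Lie algebra is graded since its generators have degree one. Its stability under [grading]
    and the level by level construction in [lie_dlog] rest on this. *)
Lemma lie_level a : Lie a -> forall r, Lie (level r a).
Proof.
elim=> [v|b c _ IHb _ IHc|x b _ IHb|b c _ IHb _ IHc] r.
- have [->|r1] := eqVneq r 1%N.
    have -> : level 1 (tvec N v) = tvec N v; last by constructor.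
    apply/ffunP => w; rewrite levelE ffunE.
    by case: w => [[|? []] ?].
  have -> : level r (tvec N v) = 0; last exact: lie0.
  apply/ffunP => w; rewrite levelE !ffunE; case: eqP => // wr.
  by case: w wr => [[|? []] ?]//= wr; move: r1; rewrite -wr.
- by rewrite linearD; apply: free_nilpotent_lie_add; [exact: IHb|exact: IHc].
- by rewrite linearZ; apply/free_nilpotent_lie_scale/IHb.
- by rewrite level_bracket; apply: lie_sum => i _; constructor.
Qed.

Lemma lie_grading a : Lie a -> Lie (grading a).
Proof.
by move=> La; rewrite grading_level; apply: lie_sum => r _; constructor; exact: lie_level.
Qed.

Lemma lie_iter_bracket Z k a : Lie Z -> Lie a -> Lie (iter k (lie_bracket Z) a).
Proof. by move=> LZ La; elim: k => // k IH; constructor. Qed.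

Lemma low_iter_bracket Z k j a : low 1 Z -> low j a ->
  low (k + j) (iter k (lie_bracket Z) a).
Proof.
move=> Z1 aj; elim: k => // k IH; rewrite addSn.
by apply: lowD; [|apply: lowN; rewrite -addn1]; [exact: (@lowM _ _ _ 1)|exact: lowM].
Qed.

(** The conjugate is exp(ad Z) a, a finite combination of iterated brackets, by [mulX_ad]. *)
Lemma texp_conj Z a : Lie Z -> Lie a -> Lie (texp Z * a * texp (- Z)).
Proof.
move=> LZ La; have Z1 := lie_low LZ.
suff -> : texp Z * a = (\sum_(k < N.+1) k`!%:R^-1 *: iter k (lie_bracket Z) a) * texp Z.
  rewrite -mulrA texpN// mulr1; apply: lie_sum => k _; constructor.
  exact: lie_iter_bracket.
rewrite /texp (cauchy_product (u := fun k => k`!%:R^-1 *: iter k (lie_bracket Z) a)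
  (v := fun n => n`!%:R^-1 *: Z ^+ n)).
  rewrite mulr_suml; apply: eq_bigr => n _.
  rewrite -scalerAl mulX_ad scaler_sumr; apply: eq_bigr => k _.
  rewrite -[in RHS]scalerAl -[in RHS]scalerAr -[_ *+ 'C(_, _)]scaler_nat !scalerA; congr (_ *: _).
  have kn : (k <= n)%N by rewrite -ltnS.
  exact: invf_fact_bin.
move=> k j kj; rewrite -scalerAl -scalerAr.
rewrite (_ : _ * _ = 0) ?scaler0//; apply: low_eq0 kj _; apply: lowM; last exact: lowX.
by rewrite -[k in low k _]addn0; apply: low_iter_bracket.
Qed.

(** D(exp Z) exp(-Z) is the sum over k of (ad Z)^k (D Z) / (k + 1)!, a combination of iterated
    brackets. *)
Lemma lie_dexp Z : Lie Z -> Lie (grading (texp Z) * texp (- Z)).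
Proof.
move=> LZ; have Z1 := lie_low LZ.
suff -> : grading (texp Z) =
    (\sum_(k < N.+1) k.+1`!%:R^-1 *: iter k (lie_bracket Z) (grading Z)) * texp Z.
  rewrite -mulrA texpN// mulr1; apply: lie_sum => k _; constructor.
  exact/lie_iter_bracket/lie_grading.
pose u k := k.+1`!%:R^-1 *: iter k (lie_bracket Z) (grading Z).
pose v n := n`!%:R^-1 *: Z ^+ n.
have uv k j : (N < (k + j).+1)%N -> u k * v j = 0.
  move=> kj; rewrite -scalerAl -scalerAr.
  rewrite (_ : _ * _ = 0) ?scaler0//; apply: low_eq0 kj _.
  rewrite -addSn; apply: lowM; last exact: lowX.
  by rewrite -(addn1 k); apply: low_iter_bracket => //; exact: low_grading1.
rewrite {2}/texp (cauchy_product (u := u) (v := v)); last first.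
  by move=> k j kj; apply: uv; rewrite ltnW.
rewrite /texp linear_sum big_ord_recl /= expr0 linearZ /= grading1 scaler0 add0r.
(* The terms of index N vanish: [grading Z] has degree at least one, so the k-th bracket times
   [Z ^+ (N - k)] has degree above N. *)
rewrite [RHS]big_ord_recr /= [X in _ + X]big1 ?addr0; last first.
  by move=> k _; rewrite uv// subnKC// -ltnS.
apply: eq_bigr => n _; rewrite /bump /= add1n linearZ /=.
rewrite (derX_ad (D := grading))//; [|exact: gradingM|exact: grading1].
rewrite scaler_sumr; apply: eq_bigr => k _.
rewrite -[in RHS]scalerAl -[in RHS]scalerAr -[_ *+ 'C(_, _)]scaler_nat !scalerA; congr (_ *: _).
have kn : (k < n.+1)%N by [].
exact: (@invf_fact_bin _ n.+1 k.+1).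
Qed.

(* An element of the group is reconstructed from its logarithmic derivative
   with respect to the grading, level by level. *)
Lemma lie_dlog g h : g * h = 1 -> low 1 (g - 1) -> low 1 (h - 1) -> Lie (grading g * h) ->
  exists2 Z, Lie Z & texp Z = g.
Proof.
move=> gh g1 h1 Lg.
suff /(_ N)[Z LZ gZ] k : exists2 Z, Lie Z & low k.+1 (g - texp Z).
  by exists Z => //; apply/esym/eqP; rewrite -subr_eq0 (low_eq0 _ gZ).
elim: k => [|k [Z LZ gZ]]; first by exists 0; [exact: lie0|by rewrite texp0].
have Z1 := lie_low LZ.
set c0 := g - texp Z in gZ; pose c := level k.+1 c0.
(* The inverses agree to the same order, as h - exp(-Z) = - h (g - exp Z) exp(-Z). *)
have hZ : low k.+1 (h - texp (- Z)).
  have -> : h - texp (- Z) = - (h * c0 * texp (- Z)).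
    have hg : h * g = 1.
      have gu : g \is a GRing.unit.
        apply: (_ : tunit g); rewrite /tunit.
        have := g1 [bseq] isT; rewrite !ffunE /= => /eqP.
        by rewrite subr_eq0 => /eqP ->; exact: oner_neq0.
      by rewrite -(mulKr gu h) gh mulr1 mulVr.
    by rewrite /c0 mulrBr hg mulrBl mul1r -mulrA texpN// mulr1 opprB.
  by apply: lowN; rewrite -(addn0 k.+1); apply: lowM => //; rewrite -(add0n k.+1); apply: lowM.
(* First order perturbation: in degree k + 1 the two logarithmic derivatives differ by D(c) = (k +
   1) c, all else being of higher degree. Both are in the Lie algebra, hence so is c. *)
have cE : level k.+1 (grading g * h - grading (texp Z) * texp (- Z)) = k.+1%:R *: c.
  have -> : grading g * h - grading (texp Z) * texp (- Z) =
      grading c0 + (grading c0 * (h - 1) + grading (texp Z) * (h - texp (- Z))).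
    rewrite /c0 linearB /= !(mulrBr, mulrBl) !mulr1.
    by rewrite [RHS]addrA [X in _ = X + _]addrC subrK addrA subrK.
  rewrite linearD /= [X in _ + X](@level_low _ _ _ k.+2)// ?addr0; last first.
    apply: lowD; last by apply: (@lowM _ _ _ 1) => //; exact: low_grading1.
    by rewrite -addn1; apply: lowM => //; exact: low_grading.
  apply/ffunP => w; rewrite tensor_scaleE !levelE gradingE.
  by case: eqP => [->|] //; rewrite mulr0.
have Lc : Lie c.
  have -> : c = k.+1%:R^-1 *: (k.+1%:R *: c) by rewrite scalerA mulVf ?scale1r ?pnatr_eq0.
  constructor; rewrite -cE; apply: lie_level; apply: free_nilpotent_lie_add => //.
  exact/lieN/lie_dexp.
exists (Z + c); first exact: free_nilpotent_lie_add.
have ck : low k.+1 c by move=> w wk; rewrite levelE; case: eqP => // wE; rewrite wE ltnn in wk.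
have [Nk|kN] := leqP N k.
  have c00 : c0 = 0 by apply: low_eq0 gZ.
  have c0E : c = 0 by rewrite /c c00 linear0.
  by rewrite c0E addr0 -/c0 c00 => w _; rewrite ffunE.
(* Replacing Z by Z + c changes the n-th power only from degree n + k on; thus exp(Z + c) and exp Z
   + c agree up to degree k + 1, and Z + c corrects the defect in that degree. *)
have dlow n : low (n.+1 + k) ((Z + c) ^+ n.+1 - Z ^+ n.+1).
  elim: n => [|n IH]; first by rewrite !expr1 addrAC subrr add0r.
  rewrite [in X in low _ X]exprS [in X in low _ X](exprS Z).
  have -> : (Z + c) * (Z + c) ^+ n.+1 - Z * Z ^+ n.+1 =
      (Z + c) * ((Z + c) ^+ n.+1 - Z ^+ n.+1) + c * Z ^+ n.+1.
    by rewrite mulrBr mulrDl [X in _ - X + _]mulrDl opprD addrA subrK.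
  apply: lowD; first by apply: (@lowM _ _ _ 1) => //; apply: lowD => //; exact: (lowW _ ck).
  by apply: (@lowW _ _ _ (k.+1 + n.+1)); [lia|apply: lowM => //; exact: lowX].
have : low k.+2 (texp (Z + c) - texp Z - c).
  have N1 : (1 < N.+1)%N by lia.
  have -> : texp (Z + c) - texp Z - c = \sum_(n < N.+1)
      (n`!%:R^-1 *: ((Z + c) ^+ n - Z ^+ n) - if n == Ordinal N1 then c else 0).
    rewrite sumrB; congr (_ - _); last by rewrite -big_mkcond big_pred1_eq.
    by rewrite /texp -sumrB; apply: eq_bigr => n _; rewrite scalerBr.
  apply: low_sum => -[[|[|n]] nN] _; rewrite -val_eqE /=.
  - by rewrite subrr subr0 scaler0 => w _; rewrite ffunE.
  - by rewrite invr1 scale1r !expr1 [Z + c]addrC addrK subrr => w _; rewrite ffunE.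
  - by rewrite subr0; apply: lowZ; apply: (lowW _ (dlow _)); lia.
move=> lowc; have -> : g - texp (Z + c) = (c0 - c) - (texp (Z + c) - texp Z - c).
  by rewrite opprB addrA subrK /c0 opprB addrA subrK.
apply/lowD/lowN => //.
apply: low_level => r; rewrite ltnS leq_eqVlt linearB /= => /predU1P[->|rk].
  by rewrite level_level eqxx subrr.
by rewrite (level_low gZ)// (level_low ck)// subrr.
Qed.

Lemma free_nilpotent_group_low g : free_nilpotent_group g -> low 1 (g - 1).
Proof. by move=> [Z LZ <-]; exact/low_texp/lie_low. Qed.

(** D(gh) (gh)^-1 = D(g) g^-1 + g (D(h) h^-1) g^-1: the two terms are in the Lie algebra by
    [lie_dexp] and [texp_conj], and [lie_dlog] concludes. *)
Lemma free_nilpotent_groupM g h :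
  free_nilpotent_group g -> free_nilpotent_group h -> free_nilpotent_group (g * h).
Proof.
move=> [A LA <-] [B LB <-]; have A1 := lie_low LA; have B1 := lie_low LB.
have low1M (x y : tensor) : low 1 (x - 1) -> low 1 (y - 1) -> low 1 (x * y - 1).
  move=> x1 y1; have -> : x * y - 1 = (x - 1) * y + (y - 1).
    by rewrite mulrBl mul1r addrA subrK.
  by apply: lowD => //; apply: (@lowM _ _ _ 1 0).
apply: (@lie_dlog _ (texp (- B) * texp (- A))).
- by rewrite mulrA -[_ * _ * texp (- B)]mulrA texpN// mulr1 texpN.
- by apply: low1M; exact: low_texp.
- by apply: low1M; apply/low_texp/lowN.
rewrite gradingM mulrDl mulrA -[X in X * _ + _]mulrA texpN// mulr1.
apply: free_nilpotent_lie_add; first exact: lie_dexp.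
by rewrite mulrA -[texp A * _ * _]mulrA; apply: texp_conj => //; exact: lie_dexp.
Qed.

Lemma texp_unit Z : low 1 Z -> texp Z \is a GRing.unit.
Proof. by move=> Z1; apply/unitrP; exists (texp (- Z)); rewrite texpN// texpNl. Qed.

Lemma texp_inv Z : low 1 Z -> (texp Z)^-1 = texp (- Z).
Proof. by move=> Z1; rewrite -[LHS]mulr1 -(texpN Z1) mulKr// texp_unit. Qed.

Lemma free_nilpotent_groupV g : free_nilpotent_group g -> free_nilpotent_group g^-1.
Proof. by move=> [Z LZ <-]; rewrite texp_inv; [exact/imageP/lieN|exact: lie_low]. Qed.

Lemma free_nilpotent_group_log g : free_nilpotent_group g ->
  Lie (tlog g) /\ texp (tlog g) = g.
Proof. by move=> [Z LZ <-]; rewrite tlog_texp//; exact: lie_low. Qed.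

Lemma tlogV g : free_nilpotent_group g -> tlog g^-1 = - tlog g.
Proof.
move=> [Z LZ <-]; have Z1 := lie_low LZ.
by rewrite texp_inv// !tlog_texp//; exact: lowN.
Qed.

Lemma free_nilpotent_group_unit g : free_nilpotent_group g -> g \is a GRing.unit.
Proof. by move=> [Z /lie_low Z1 <-]; exact: texp_unit. Qed.

End ExpLog.

(** * Mean value and Gronwall inequalities *)

Section Epsilon.
Context (R : realType).
Implicit Types (V W : normedModType R).

Lemma near0P V (P : set V) : (\forall h \near (0 : V), P h) <->
  exists2 d : R, 0 < d & forall h, `|h| < d -> P h.
Proof.
split=> [/nbhs_ballP[d /= d0 dP]|[d d0 dP]].
  by exists d => // h hd; apply: dP; rewrite -ball_normE /= sub0r normrN.
by apply/nbhs_ballP; exists d => //= h; rewrite -ball_normE /= sub0r normrN; exact: dP.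
Qed.

Lemma differentiable_eps V W (f : V -> W) x : differentiable f x ->
  forall e : R, 0 < e -> exists2 d : R, 0 < d & forall h, `|h| < d ->
    `|f (x + h) - f x - 'd f x h| <= e * `|h|.
Proof.
move=> /diff_locallyP[_ /eqaddoP fo] e e0.
have /near0P[d d0 dP] := fo _ e0; exists d => // h /dP.
by rewrite /= !fctE /= opprD addrA [h + x]addrC.
Qed.

Lemma differentiable_intro V W (f : V -> W) (L : {linear V -> W}) (C : R) x :
  (forall h, `|L h| <= C * `|h|) ->
  (forall e : R, 0 < e -> exists2 d : R, 0 < d & forall h, `|h| < d ->
    `|f (x + h) - f x - L h| <= e * `|h|) ->
  differentiable f x /\ 'd f x = L :> (V -> W).
Proof.
move=> LC fL.
have Lc : continuous L.
  apply/linear_bounded_continuous/ex_bound.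
  exists (`|C|); apply/near0P; exists 1 => // h h1 /=.
  rewrite (le_trans (LC h))// (le_trans (ler_wpM2r _ (ler_norm C)))//.
  by rewrite ler_piMr// ltW.
have fo : f \o shift x = cst (f x) + L +o_ 0 id.
  apply/eqaddoP => e e0; apply/near0P; have [d d0 dP] := fL _ e0.
  exists d => // h /dP.
  by rewrite /= !fctE /= opprD addrA [h + x]addrC.
have dE := diff_unique Lc fo; split => //.
by apply/diff_locallyP; rewrite dE.
Qed.

Lemma is_derive_eps V (f : R -> V) u (d : V) : is_derive u (1 : R) f d <->
  forall e : R, 0 < e -> exists2 r : R, 0 < r & forall v, `|v - u| < r ->
    `|f v - f u - (v - u) *: d| <= e * `|v - u|.
Proof.
split=> [fd e e0|H].
  have fu : derivable f u 1 by [].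
  have /differentiable_eps/(_ _ e0)[r r0 rP] : differentiable f u by apply/derivable1_diffP.
  exists r => // v /rP.
  by rewrite deriv1E// derive1E derive_val [u + _]addrC subrK.
pose g (h : R) := h *: d.
have lin_g : linear g by move=> ? ? ?; rewrite /g scalerDl scalerA.
pose gM := GRing.isLinear.Build _ _ _ _ _ lin_g.
pose L : {linear R -> V} := HB.pack g gM.
have [df dE] : differentiable f u /\ 'd f u = L :> (R -> V).
  apply: (@differentiable_intro _ _ _ _ (`|d|)) => [h|e e0].
    by rewrite /= /g normrZ mulrC.
  have [r r0 rP] := H e e0; exists r => // h hr.
  by have := rP (u + h); rewrite addrAC subrr add0r; apply.
apply: DeriveDef; first exact/derivable1_diffP.
by rewrite deriveE// dE /= /g scale1r.
Qed.

Lemma within_continuous_eps V (f : R -> V) (a b : R) :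
  {within `[a, b], continuous f} <->
  forall x, a <= x <= b -> forall e : R, 0 < e -> exists2 d : R, 0 < d &
    forall y, a <= y <= b -> `|y - x| < d -> `|f y - f x| < e.
Proof.
split=> [/subspace_continuousP cf x xab e e0|H].
  have xI : `[a, b]%classic x by rewrite /= in_itv.
  have /cvgrPdist_lt/(_ e e0) := cf x xI.
  rewrite near_withinE => /nbhs_ballP[d /= d0 dP]; exists d => // y yab yd.
  rewrite distrC; apply: dP; last by rewrite /= in_itv.
  by rewrite -ball_normE /= distrC.
apply/subspace_continuousP => x; rewrite /= in_itv /= => xab.
apply/cvgrPdist_lt => e e0; rewrite near_withinE.
have [d d0 dP] := H x xab e e0; apply/nbhs_ballP; exists d => //= y.
rewrite -ball_normE /= distrC => yd; rewrite in_itv /= => yab.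
by rewrite distrC; exact: dP.
Qed.

End Epsilon.

Section MeanValue.
Context (R : realType).

(** A one-sided condition without derivatives, as it will be applied to norms of vector-valued
    curves, which need not be differentiable. *)
Lemma dini_le (phi : R -> R) (a b : R) : a <= b ->
  {within `[a, b], continuous phi} ->
  (forall u, a < u < b -> exists2 d : R, 0 < d &
    forall v, u < v < u + d -> phi v <= phi u) ->
  phi b <= phi a.
Proof.
rewrite le_eqVlt => /predU1P[->//|ab] /within_continuous_eps cphi dini.
rewrite leNgt; apply/negP => phiab.
pose m := (phi a + phi b) / 2.
have am : phi a < m by rewrite /m; lra.
have mb : m < phi b by rewrite /m; lra.
(* Let c be the last point where phi is at most the intermediate value m. Just to the right of c,
   phi exceeds m >= phi c, against the hypothesis at c. *)
pose S := [set u | a <= u <= b /\ phi u <= m].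
have Sa : S a by split; [rewrite lexx ltW|exact: ltW].
have ubS : ubound S b by move=> u [/andP[]].
have supS : has_sup S by split; [exists a|exists b].
set c := sup S.
have ac : a <= c by apply: ub_le_sup => //; exists b.
have cb : c <= b by apply: ge_sup => //; exists a.
have phic : phi c <= m.
  rewrite leNgt; apply/negP => mc.
  have [d d0 dP] := cphi c (introT andP (conj ac cb)) (phi c - m) ltac:(by rewrite subr_gt0).
  have [u [uab um] cdu] := sup_adherent d0 supS.
  have uc : u <= c by apply: ub_le_sup => //; exists b.
  have /(dP u uab) : `|u - c| < d by rewrite ler0_norm ?subr_le0// opprB; move: cdu; rewrite -/c; lra.
  by rewrite ltr_norml => /andP[+ _]; lra.
have cb' : c < b by rewrite lt_neqAle cb andbT; apply/eqP => cE; move: phic; rewrite cE; lra.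
have Sc u : c < u -> u <= b -> m < phi u.
  move=> cu ub; rewrite ltNge; apply/negP => um.
  suff : u <= c by rewrite leNgt cu.
  apply: ub_le_sup; first by exists b.
  by split=> //; rewrite (le_trans ac (ltW cu)).
(* The hypothesis holds in the open interval only; c = a is excluded by continuity, as phi a < m. *)
have : a < c.
  rewrite lt_neqAle ac andbT; apply/eqP => ca.
  have [d d0 dP] := cphi a ltac:(by rewrite lexx ltW) (m - phi a) ltac:(by rewrite subr_gt0).
  pose u := Order.min (a + d / 2) b.
  have au : a < u by rewrite lt_min ab andbT; lra.
  have ub : u <= b by rewrite ge_min lexx orbT.
  have ud : u <= a + d / 2 by rewrite ge_min lexx.
  have /(dP u) : a <= u <= b by rewrite ub ltW.
  rewrite gtr0_norm ?subr_gt0// => /(_ ltac:(lra)).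
  have := Sc u ltac:(by rewrite -ca) ub.
  by rewrite ltr_norml => ? /andP[_]; lra.
move=> ac'; have [d d0 dP] := dini c (introT andP (conj ac' cb')).
pose u := Order.min (c + d / 2) b.
have cu : c < u by rewrite lt_min cb' andbT; lra.
have ub : u <= b by rewrite ge_min lexx orbT.
have ud : u <= c + d / 2 by rewrite ge_min lexx.
have /dP : c < u < c + d by rewrite cu; lra.
by have := Sc u cu ub; lra.
Qed.

(** The function |f u - f a| - g u - e1 u satisfies the condition of [dini_le]: the slack e1 absorbs
    the errors, e1 / 2 each, of the expansions of f and g. *)
Lemma mean_value_ineq (E : normedModType R) (f f' : R -> E) (g g' : R -> R) (a b : R) :
  a <= b -> {within `[a, b], continuous f} -> {within `[a, b], continuous g} ->
  (forall u, a < u < b -> is_derive u (1 : R) f (f' u)) ->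
  (forall u, a < u < b -> is_derive u (1 : R) g (g' u)) ->
  (forall u, a < u < b -> `|f' u| <= g' u) ->
  `|f b - f a| <= g b - g a.
Proof.
move=> ab /within_continuous_eps cf /within_continuous_eps cg df dg fg.
apply/ler_addgt0Pr => e e0.
have ba0 : 0 < b - a + 1 by lra.
pose e1 := e / (b - a + 1).
have e10 : 0 < e1 by rewrite divr_gt0.
have e1b : e1 * (b - a) <= e by rewrite /e1 mulrAC ler_pdivrMr// ler_pM2l//; lra.
pose phi u := `|f u - f a| - g u - e1 * u.
suff : phi b <= phi a by rewrite /phi subrr normr0; nra.
apply: dini_le => //.
  apply/within_continuous_eps => x xab r r0.
  have [d1 d10 d1P] := cf x xab (r / 3) ltac:(lra).
  have [d2 d20 d2P] := cg x xab (r / 3) ltac:(lra).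
  pose d3 := r / 3 / e1.
  have d30 : 0 < d3 by rewrite divr_gt0//; lra.
  exists (Order.min d1 (Order.min d2 d3)); first by rewrite !lt_min d10 d20.
  move=> y yab; rewrite !lt_min => /and3P[/(d1P _ yab) fy /(d2P _ yab) gy y3].
  have ey : `|e1 * y - e1 * x| < r / 3.
    by rewrite -mulrBr normrM gtr0_norm// mulrC -ltr_pdivlMr.
  have := ler_dist_dist (f y - f a) (f x - f a).
  rewrite opprB addrA subrK => /le_lt_trans/(_ fy).
  move: gy ey; rewrite /phi !ltr_norml => /andP[? ?] /andP[? ?] /andP[? ?].
  by apply/andP; split; lra.
move=> u uab; have e20 : 0 < e1 / 2 by lra.
have /is_derive_eps/(_ _ e20)[d1 d10 d1P] := df u uab.
have /is_derive_eps/(_ _ e20)[d2 d20 d2P] := dg u uab.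
exists (Order.min d1 d2); first by rewrite lt_min d10.
move=> v /andP[uv]; rewrite -ltrBlDl lt_min => /andP[vd1 vd2].
have vu0 : 0 < v - u by lra.
have := d1P v; rewrite gtr0_norm// => /(_ vd1) H1.
have := d2P v; rewrite gtr0_norm// => /(_ vd2); rewrite ler_norml => /andP[H2 _].
have H3 : `|f v - f a| <= `|f u - f a| + `|f v - f u - (v - u) *: f' u| + (v - u) * `|f' u|.
  rewrite -{2}(gtr0_norm vu0) -normrZ -addrA.
  have -> : f v - f a = (f u - f a) + (f v - f u - (v - u) *: f' u + (v - u) *: f' u).
    by rewrite subrK [RHS]addrC addrA subrK.
  by rewrite (le_trans (ler_normD _ _))// lerD2l ler_normD.
have H4 : (v - u) * `|f' u| <= (v - u) * g' u by rewrite ler_pM2l//; exact: fg.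
move: H2; rewrite /= /phi -[_ *: g' u]/(_ * g' u) => H2.
by nra.
Qed.

Lemma affine_within_continuous (c k a b : R) : {within `[a, b], continuous (fun u : R => k + c * u)}.
Proof.
apply: continuous_subspaceT => x; apply: cvgD; first exact: cvg_cst.
by apply: cvgM; [exact: cvg_cst|exact: cvg_id].
Qed.

Lemma is_derive_affine (k c u : R) : is_derive u (1 : R) (fun u : R => k + c * u) c.
Proof.
apply/is_derive_eps => e e0; exists 1 => // v _.
have -> : k + c * v - (k + c * u) - (v - u) *: c = 0; last by rewrite normr0 mulr_ge0// ltW.
by rewrite -[_ *: c]/(_ * c); ring.
Qed.

Lemma mean_value_const (E : normedModType R) (f f' : R -> E) (M a b : R) :
  a <= b -> {within `[a, b], continuous f} ->
  (forall u, a < u < b -> is_derive u (1 : R) f (f' u)) ->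
  (forall u, a < u < b -> `|f' u| <= M) ->
  `|f b - f a| <= M * (b - a).
Proof.
move=> ab cf df fM.
have := mean_value_ineq ab cf (@affine_within_continuous M 0 a b) df
  (fun u _ => is_derive_affine 0 M u) fM.
by rewrite !add0r -mulrBr.
Qed.

(** If S is the maximum of |z u| exp(-2 K u), then K |z u| is at most K S exp(2 K u), which has the
    primitive S exp(2 K u) / 2. The exponent 2 K is there for this factor 1/2, which lets S be
    absorbed on the left and yields the leading 2 of the bound. *)
Lemma gronwall (E : normedModType R) (z z' : R -> E) (K B : R) : 0 <= K -> 0 <= B ->
  {within `[0, 1], continuous z} ->
  (forall u : R, 0 < u < 1 -> is_derive u (1 : R) z (z' u)) ->
  (forall u : R, 0 < u < 1 -> `|z' u| <= K * `|z u| + B) ->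
  forall u, 0 <= u <= 1 -> `|z u| <= 2 * expR (2 * K) * (`|z 0| + B).
Proof.
move=> K0 B0 cz dz zK.
pose w u := `|z u| * expR (- (2 * K * u)).
have cexp : {within `[0, 1], continuous (fun u : R => expR (- (2 * K * u)))}.
  apply: continuous_subspaceT => x; apply: continuous_comp; last exact: continuous_expR.
  by apply: cvgN; apply: cvgM; [exact: cvg_cst|exact: cvg_id].
have cw : {within `[0, 1], continuous w}.
  move=> x; apply: cvgM.
    by apply: continuous_comp; [exact: cz|exact: norm_continuous].
  exact: cexp.
have [c] := EVT_max ler01 cw.
rewrite in_itv /= => /andP[c0 c1] wc.
set S := w c in wc.
have zS u : 0 <= u <= 1 -> `|z u| <= S * expR (2 * K * u).
  move=> u01; have := wc u; rewrite in_itv /= => /(_ u01).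
  by rewrite /w -ler_pdivlMr ?expR_gt0// -expRN opprK.
have S0 : 0 <= S by rewrite mulr_ge0// expR_ge0.
pose g u := S * expR (2 * K * u) / 2 + B * u.
have dg u : is_derive u (1 : R) g (S * (K * expR (2 * K * u)) + B).
  have dexp : is_derive u (1 : R) (fun u : R => expR (2 * K * u)) (2 * K * expR (2 * K * u)).
    have dl : is_derive u (1 : R) (fun u : R => 2 * K * u) (2 * K).
      by have := is_derive_affine 0 (2 * K) u; under [X in is_derive _ _ X _]eq_fun do rewrite add0r.
    have -> : 2 * K * expR (2 * K * u) = expR (2 * K * u) * (2 * K) by ring.
    exact: (@is_derive1_comp _ expR (fun u : R => 2 * K * u) _ _ _ (is_derive_expR _) dl).
  have -> : g = ((S / 2) \*: (fun u : R => expR (2 * K * u))) + (fun u => 0 + B * u).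
    by apply/funext => x; rewrite /g !fctE /= add0r mulrAC.
  have -> : S * (K * expR (2 * K * u)) + B = (S / 2) *: (2 * K * expR (2 * K * u)) + B.
    by rewrite -[_ *: _]/(_ * _); field.
  have dE : is_derive u (1 : R) ((S / 2) \*: (fun u : R => expR (2 * K * u))) ((S / 2) *: (2 * K * expR (2 * K * u))).
    exact: is_deriveZ.
  have dA := is_derive_affine 0 B u; exact: is_deriveD.
have cg a b : {within `[a, b], continuous g}.
  by apply: derivable_within_continuous => x _; case: (dg x).
have Sle : S <= 2 * (`|z 0| + B).
  have zc : `|z c - z 0| <= g c - g 0.
    apply: (mean_value_ineq c0 _ (cg 0 c) _ (fun u _ => dg u)) => //.
    - move: cz => /within_continuous_eps cz; apply/within_continuous_eps => x /andP[x0 xc] e e0.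
      have [d d0 dP] := cz x ltac:(by rewrite x0 (le_trans xc)) e e0.
      by exists d => // y /andP[y0 yc]; apply: dP; rewrite y0 (le_trans yc).
    - by move=> u /andP[u0 uc]; apply: dz; rewrite u0 (lt_le_trans uc).
    - move=> u /andP[u0 uc].
      have u1 : u < 1 by rewrite (lt_le_trans uc).
      apply: le_trans (zK u _) _; first by rewrite u0.
      rewrite lerD2r mulrCA ler_wpM2l//; apply: zS.
      by rewrite (ltW u0) (ltW u1).
  have zc0 : `|z c| <= `|z 0| + (S * expR (2 * K * c) / 2 + B * c).
    have := ler_normD (z c - z 0) (z 0); rewrite subrK.
    move/le_trans; apply; rewrite addrC lerD2l (le_trans zc)//.
    by rewrite /g !mulr0 addr0 gerBl divr_ge0// mulr_ge0// expR_ge0.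
  have : S * expR (2 * K * c) = `|z c|.
    by rewrite /S /w -mulrA -expRD addNr expR0 mulr1.
  have e1 : 1 <= expR (2 * K * c).
    rewrite -expR0 ler_expR; apply: mulr_ge0 => //; exact: mulr_ge0.
  have := normr_ge0 (z 0); move: zc0 e1; set X := expR _ => zc0 e1 z0 SX.
  have : S * X <= 2 * (`|z 0| + B) * X by nra.
  by rewrite ler_pM2r//; lra.
move=> u u01; apply: le_trans (zS u u01) _.
have -> : 2 * expR (2 * K) * (`|z 0| + B) = 2 * (`|z 0| + B) * expR (2 * K) by ring.
apply: ler_pM => //.
by rewrite ler_expR; case/andP: u01 => u0 u1; rewrite ler_piMr// mulr_ge0.
Qed.

(** Here the initial norm enters with a factor K, unlike in [gronwall]: time-1 maps of small fields
    thus get Lipschitz constants close to 1, as sewing requires. *)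
Lemma gronwall_increment (E : normedModType R) (z z' : R -> E) (K B : R) : 0 <= K -> 0 <= B ->
  {within `[0, 1], continuous z} ->
  (forall u : R, 0 < u < 1 -> is_derive u (1 : R) z (z' u)) ->
  (forall u : R, 0 < u < 1 -> `|z' u| <= K * `|z u| + B) ->
  `|z 1 - z 0| <= K * (2 * expR (2 * K) * (`|z 0| + B)) + B.
Proof.
move=> K0 B0 cz dz zK; have zb := gronwall K0 B0 cz dz zK.
have := @mean_value_const _ z z' (K * (2 * expR (2 * K) * (`|z 0| + B)) + B) 0 1 ler01 cz dz.
rewrite subr0 mulr1; apply=> u u01; apply: le_trans (zK u u01) _.
rewrite lerD2r ler_wpM2l//; apply: zb.
by case/andP: u01 => u0 u1; rewrite !ltW.
Qed.

End MeanValue.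

(** * Classes of functions with bounded derivatives *)

Section Curves.
Context (R : realType) (E : normedModType R).
Implicit Types (f : E -> E) (x v w : E).

Lemma is_derive_line (p q : E) (u : R) : is_derive u (1 : R) (fun s : R => p + s *: q) q.
Proof.
apply/is_derive_eps => e e0; exists 1 => // s _.
have -> : p + s *: q - (p + u *: q) - (s - u) *: q = 0.
  by rewrite opprD addrACA subrr add0r -scalerBl subrr.
by rewrite normr0 mulr_ge0// ltW.
Qed.

Lemma is_derive_comp_curve f (y : R -> E) (u : R) (d : E) :
  differentiable f (y u) -> is_derive u (1 : R) y d ->
  is_derive u (1 : R) (f \o y) ('d f (y u) d).
Proof.
move=> df dy; have y1 : derivable y u 1 by [].
have yd : differentiable y u by apply/derivable1_diffP.
have fy : differentiable (f \o y) u by apply: differentiable_comp.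
apply: DeriveDef; first exact/derivable1_diffP.
by rewrite deriveE// diff_comp//= -(deriveE _ yd) derive_val.
Qed.

Lemma derive_within_continuous (V : normedModType R) (y y' : R -> V) (a b : R) :
  (forall u, is_derive u (1 : R) y (y' u)) -> {within `[a, b], continuous y}.
Proof. by move=> dy; apply: derivable_within_continuous => u _; case: (dy u). Qed.

Lemma derivative_lipschitz f (C : R) : (forall x, differentiable f x) ->
  (forall x v, `|'d f x v| <= C * `|v|) -> forall x y, `|f x - f y| <= C * `|x - y|.
Proof.
move=> df fC x y.
have dl u : is_derive u (1 : R) (f \o (fun s : R => y + s *: (x - y))) ('d f (y + u *: (x - y)) (x - y)).
  by apply: is_derive_comp_curve => //; exact: is_derive_line.
have := mean_value_const ler01 (derive_within_continuous dl) (fun u _ => dl u)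
  (fun u _ => fC (y + u *: (x - y)) (x - y)).
by rewrite /= scale1r scale0r addr0 subr0 mulr1 [y + (x - y)]addrC subrK.
Qed.

End Curves.

Section Classes.
Context (R : realType) (E : normedModType R).
Implicit Types (f g : E -> E) (x v w : E) (S : set (E -> E)).

Definition equibounded S := exists C : R, forall f, S f -> forall x, `|f x| <= C.

(** With directions in the unit ball, a uniform bound on this set is a bound on operator norms;
    [Db1_bound] extends it to all directions by homogeneity. *)
Definition derivatives S : set (E -> E) :=
  [set g | exists f v, [/\ S f, `|v| <= 1 & g = fun x => 'd f x v]].

(* A set of functions is [Db k] if its elements have derivatives up to order k
   that are bounded uniformly over the set, and [Cb k] if the functions
   themselves are moreover uniformly bounded. Contrary to [Ckb], the derivative
   of order k need not be continuous. *)
Fixpoint Db k S : Prop :=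
  if k is k'.+1 then
    [/\ forall f, S f -> forall x, differentiable f x,
        equibounded (derivatives S) & Db k' (derivatives S)]
  else True.

Definition Cb k S := equibounded S /\ Db k S.

Lemma equiboundedW S : equibounded S ->
  exists2 C : R, 0 <= C & forall f, S f -> forall x, `|f x| <= C.
Proof.
by case=> C SC; exists `|C| => // f Sf x; rewrite (le_trans (SC f Sf x))// ler_norm.
Qed.

Lemma equibounded_sub S S' : S `<=` S' -> equibounded S' -> equibounded S.
Proof. by move=> SS' [C SC]; exists C => f /SS'; exact: SC. Qed.

Lemma derivatives_sub S S' : S `<=` S' -> derivatives S `<=` derivatives S'.
Proof. by move=> SS' g [f [v [/SS' Sf v1 ->]]]; exists f, v. Qed.

Lemma Db_sub k S S' : S `<=` S' -> Db k S' -> Db k S.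
Proof.
elim: k S S' => // k IH S S' SS' [d b D]; split.
- by move=> f /SS'; exact: d.
- exact: equibounded_sub (derivatives_sub SS') b.
- exact: IH (derivatives_sub SS') D.
Qed.

Lemma Cb_sub k S S' : S `<=` S' -> Cb k S' -> Cb k S.
Proof. by move=> SS' [b D]; split; [exact: equibounded_sub b|exact: Db_sub D]. Qed.

Lemma DbW k j S : (j <= k)%N -> Db k S -> Db j S.
Proof. by elim: j k S => // j IH [//|k] S jk [d b D]; split=> //; exact: IH D. Qed.

Lemma CbW k j S : (j <= k)%N -> Cb k S -> Cb j S.
Proof. by move=> jk [b D]; split=> //; exact: DbW D. Qed.

Lemma DbS k S : Db k.+1 S <->
  (forall f, S f -> forall x, differentiable f x) /\ Cb k (derivatives S).
Proof. by split=> [[d b D]|[d [b D]]]; split. Qed.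

Lemma CbU k S S' : Cb k S -> Cb k S' -> Cb k (S `|` S').
Proof.
have bU A B : equibounded A -> equibounded B -> equibounded (A `|` B).
  move=> /equiboundedW[C C0 AC] /equiboundedW[D D0 BD]; exists (C + D).
  move=> f [/AC fC|/BD fD] x; first by rewrite (le_trans (fC x))// lerDl.
  by rewrite (le_trans (fD x))// lerDr.
have dU A B : derivatives (A `|` B) `<=` derivatives A `|` derivatives B.
  by move=> g [f [v [[Af|Bf] v1 ->]]]; [left|right]; exists f, v.
move=> [b D] [b' D']; split; first exact: bU.
elim: k S S' D D' {b b'} => // k IH S S' [d b D] [d' b' D']; split.
- by move=> f [/d|/d'].
- exact: equibounded_sub (@dU _ _) (bU _ _ b b').
- exact: Db_sub (@dU _ _) (IH _ _ D D').
Qed.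

Lemma Cb0 k : Cb k set0.
Proof.
have d0 : derivatives set0 `<=` set0 by move=> g [f [v []]].
split; first by exists 0.
elim: k => // k IH; split=> //; last exact: Db_sub d0 IH.
by apply: equibounded_sub d0 _; exists 0.
Qed.

Lemma Cb_bigcup k n (S : nat -> set (E -> E)) : (forall i, (i < n)%N -> Cb k (S i)) ->
  Cb k [set f | exists2 i, (i < n)%N & S i f].
Proof.
elim: n => [|n IH] Sk; first by apply: Cb_sub (Cb0 k) => f [].
apply: Cb_sub (CbU (IH _) (Sk n (ltnSn n))); last by move=> i ni; apply/Sk/ltnW.
move=> f [i]; rewrite ltnS leq_eqVlt => /predU1P[->|ni] Sf; first by right.
by left; exists i.
Qed.

Definition sum_set S S' : set (E -> E) :=
  [set h | exists f g, [/\ S f, S' g & h = f \+ g]].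

Lemma Db_sum k S S' : Db k S -> Db k S' -> Db k (sum_set S S').
Proof.
elim: k S S' => // k IH S S' [d b D] [d' b' D'].
have ds : derivatives (sum_set S S') `<=` sum_set (derivatives S) (derivatives S').
  move=> _ [_ [v [[f [g [Sf Sg ->]]] v1 ->]]].
  exists (fun x => 'd f x v), (fun x => 'd g x v); split; [by exists f, v|by exists g, v|].
  by apply/funext => x /=; rewrite diffD//; [exact: d|exact: d'].
split; last exact: Db_sub ds (IH _ _ D D').
  by move=> _ [f [g [Sf Sg ->]]] x; apply: differentiableD; [exact: d|exact: d'].
apply: equibounded_sub ds _; case: b b' => [C SC] [C' SC']; exists (C + C').
move=> _ [f [g [Sf Sg ->]]] x /=; rewrite (le_trans (ler_normD _ _))//.
by rewrite lerD//; [exact: SC|exact: SC'].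
Qed.

Lemma Cb_sum k S S' : Cb k S -> Cb k S' -> Cb k (sum_set S S').
Proof.
move=> [[C SC] D] [[C' SC'] D']; split; last exact: Db_sum.
exists (C + C') => _ [f [g [Sf Sg ->]]] x /=; rewrite (le_trans (ler_normD _ _))//.
by rewrite lerD//; [exact: SC|exact: SC'].
Qed.

Definition scale_set (c : R) S : set (E -> E) := [set c \*: f | f in S].

Lemma Cb_scale k c S : Cb k S -> Cb k (scale_set c S).
Proof.
have bs A : equibounded A -> equibounded (scale_set c A).
  move=> [C AC]; exists (`|c| * C) => _ [f Af <-] x /=.
  by rewrite normrZ ler_wpM2l//; exact: AC.
move=> [b D]; split; first exact: bs.
elim: k S D {b} => // k IH S [d b D].
have ds : derivatives (scale_set c S) `<=` scale_set c (derivatives S).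
  move=> _ [_ [v [[f Sf <-] v1 ->]]]; exists (fun x => 'd f x v); first by exists f, v.
  by apply/funext => x /=; rewrite diffZ//; exact: d.
split; first by move=> _ [f Sf <-] x; apply: differentiableZ; exact: d.
- exact: equibounded_sub ds (bs _ b).
- exact: Db_sub ds (IH _ D).
Qed.

Lemma Cb_sum1 k (I : Type) (s : seq I) (P : pred I) (c : I -> R) (F : I -> E -> E) :
  (forall i, P i -> Cb k [set F i]) ->
  Cb k [set fun x => \sum_(i <- s | P i) c i *: F i x].
Proof.
move=> FP; elim: s => [|i s IH].
  have -> : (fun x => \sum_(i <- [::] | P i) c i *: F i x) = cst 0.
    by apply/funext => x; rewrite big_nil.
  have C0 : Cb k [set cst 0].
    split; first by exists 0 => _ -> x; rewrite normr0.
    elim: k {FP} => // k IH.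
    have d0 : derivatives [set cst 0] `<=` [set cst 0].
      by move=> _ [_ [v [-> _ ->]]]; apply/funext => x; rewrite diff_cst.
    split; last exact: Db_sub IH.
      by move=> _ -> x.
    by apply: equibounded_sub d0 _; exists 0 => _ -> x; rewrite normr0.
  exact: C0.
have [Pi|Pi] := boolP (P i).
  apply: Cb_sub (Cb_sum (Cb_scale (c i) (FP i Pi)) IH) => _ ->.
  exists (c i \*: F i), (fun x => \sum_(i <- s | P i) c i *: F i x); split=> //.
    by exists (F i).
  by apply/funext => x; rewrite big_cons Pi.
by apply: Cb_sub IH => _ ->; apply/funext => x; rewrite big_cons (negbTE Pi).
Qed.

Lemma Db_id k : Db k [set id].
Proof.
have Cc j : Db j [set f | exists c, f = cst c].
  elim: j => // j IH.
  have dc : derivatives [set f | exists c, f = cst c] `<=` [set cst 0].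
    by move=> _ [_ [v [[c ->] _ ->]]]; apply/funext => x; rewrite diff_cst.
  split; first by move=> _ [c ->] x.
    by apply: equibounded_sub dc _; exists 0 => _ -> x; rewrite normr0.
  by apply: Db_sub IH; apply: subset_trans dc _ => _ ->; exists 0.
case: k => // k.
have di v : (fun x => 'd (@id E) x v) = cst v.
  by apply/funext => x; rewrite diff_val.
split; first by move=> _ -> x; exact: ex_diff.
  by exists 1 => _ [_ [v [-> v1 ->]]] x; rewrite (congr1 (@^~ x) (di v)).
by apply: Db_sub (Cc k) => _ [_ [v [-> v1 ->]]]; exists v; exact: di.
Qed.

Lemma Db1_bound S : Db 1 S -> exists2 C : R, 0 <= C &
  forall f, S f -> (forall x, differentiable f x) /\ (forall x v, `|'d f x v| <= C * `|v|).
Proof.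
move=> [d /equiboundedW[C C0 SC] _]; exists C => // f Sf; split; first exact: d.
move=> x v; have [->|v0] := eqVneq v 0; first by rewrite linear0 !normr0 mulr0.
have nv : `|v| != 0 by rewrite normr_eq0.
rewrite -{1}[v](scalerKV nv) linearZ /= normrZ normr_id mulrC ler_wpM2r//.
have := SC (fun x => 'd f x (`|v|^-1 *: v)); apply; exists f, (`|v|^-1 *: v); split=> //.
by rewrite normrZ normfV normr_id mulVf.
Qed.

Lemma Db1_lipschitz S : Db 1 S -> exists2 C : R, 0 <= C &
  forall f, S f -> forall x y, `|f x - f y| <= C * `|x - y|.
Proof.
move=> /Db1_bound[C C0 SC]; exists C => // f /SC[df fC]; exact: derivative_lipschitz.
Qed.

Lemma Db2_bound S : Db 2 S -> exists2 C : R, 0 <= C & forall f, S f -> forall v,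
  [/\ forall x, differentiable (fun y => 'd f y v) x,
      forall x w, `|'d (fun y => 'd f y v) x w| <= C * `|v| * `|w|
    & forall x y, `|'d f x v - 'd f y v| <= C * `|v| * `|x - y| ].
Proof.
move=> [d b /Db1_bound[C C0 DC]]; exists C => // f Sf v.
have H (u : E) : `|u| <= 1 -> [/\ forall x, differentiable (fun y => 'd f y u) x
    & forall x w, `|'d (fun y => 'd f y u) x w| <= C * `|w|].
  by move=> u1; apply: DC; exists f, u.
have H2 : [/\ forall x, differentiable (fun y => 'd f y v) x
    & forall x w, `|'d (fun y => 'd f y v) x w| <= C * `|v| * `|w|].
  have [v0|v0] := eqVneq v 0.
    have [H1 H2] : [/\ forall x, differentiable (fun y => 'd f y v) x
        & forall x w, 'd (fun y => 'd f y v) x w = 0].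
      have -> : (fun y => 'd f y v) = cst 0 by apply/funext => y; rewrite v0 linear0.
      by split=> // x w; rewrite diff_cst.
    by split=> // x w; rewrite H2 normr0 !mulr_ge0.
  have nv : `|v| != 0 by rewrite normr_eq0.
  pose u := `|v|^-1 *: v.
  have vE : (fun y => 'd f y v) = `|v| \*: (fun y => 'd f y u).
    by apply/funext => y; rewrite /u /= linearZ /= scalerA mulfV// scale1r.
  have [|Hd Hb] := H u; first by rewrite normrZ normfV normr_id mulVf.
  rewrite vE; split=> [x|x w]; first exact: differentiableZ.
  rewrite diffZ//= normrZ normr_id -mulrA mulrCA ler_wpM2l//.
by case: H2 => Hd Hb; split=> // x y; apply: (derivative_lipschitz Hd).
Qed.

(** Mean value inequality for [G], the difference of f along two parallel segments minus its
    expected growth. The derivative of [G] is controlled by the differentiability of y |-> Df(y) v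
    at the single point x, since [Db 2] gives no continuity of second derivatives. *)
Lemma second_difference f x v w : Db 2 [set f] ->
  forall e : R, 0 < e -> exists2 d : R, 0 < d & forall t : R, 0 < t < d ->
    `|f (x + t *: v + t *: w) - f (x + t *: v) - f (x + t *: w) + f x
      - t ^+ 2 *: 'd (fun y => 'd f y v) x w| <= e * t ^+ 2.
Proof.
move=> D2 e e0; have [df _ _] := D2; have {}df := df f erefl.
have [C C0 /(_ f erefl v)[dg _ _]] := Db2_bound D2.
pose A := 'd (fun y => 'd f y v) x.
pose k := 2 * `|v| + `|w| + 1.
have k0 : 0 < k by rewrite /k; have := normr_ge0 v; have := normr_ge0 w; lra.
have ek : 0 < e / k by rewrite divr_gt0.
have [d d0 dP] := differentiable_eps (dg x) ek.
exists (d / k); first exact: divr_gt0.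
move=> t /andP[t0 td].
pose G s := f ((x + t *: w) + s *: (t *: v)) - f (x + s *: (t *: v)) - s *: (t ^+ 2 *: A w).
pose G' s := 'd f ((x + t *: w) + s *: (t *: v)) (t *: v) - 'd f (x + s *: (t *: v)) (t *: v)
   - t ^+ 2 *: A w.
have dG s : is_derive s (1 : R) G (G' s).
  have d1 : is_derive s (1 : R) (f \o (fun s : R => (x + t *: w) + s *: (t *: v)))
      ('d f ((x + t *: w) + s *: (t *: v)) (t *: v)).
    by apply: is_derive_comp_curve => //; exact: is_derive_line.
  have d2 : is_derive s (1 : R) (f \o (fun s : R => x + s *: (t *: v)))
      ('d f (x + s *: (t *: v)) (t *: v)).
    by apply: is_derive_comp_curve => //; exact: is_derive_line.
  have d3 : is_derive s (1 : R) (fun s : R => s *: (t ^+ 2 *: A w)) (t ^+ 2 *: A w).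
    by have := is_derive_line 0 (t ^+ 2 *: A w) s; under eq_fun do rewrite add0r.
  exact: is_deriveB.
have G'b s : 0 < s < 1 -> `|G' s| <= e * t ^+ 2.
  move=> /andP[s0 s1].
  have st : `|s *: (t *: v)| <= t * `|v|.
    by rewrite !normrZ (gtr0_norm s0) (gtr0_norm t0) ler_piMl ?mulr_ge0// ltW.
  have tw : `|t *: w| = t * `|w| by rewrite normrZ gtr0_norm.
  have tkd : t * k < d by rewrite -ltr_pdivlMr.
  have v0 := normr_ge0 v; have w0 := normr_ge0 w.
  have h1b : `|t *: w + s *: (t *: v)| <= t * `|w| + t * `|v|.
    by rewrite (le_trans (ler_normD _ _))// tw lerD.
  have /dP H1 : `|t *: w + s *: (t *: v)| < d.
    by apply: le_lt_trans h1b _; apply: le_lt_trans tkd; rewrite /k; nra.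
  have /dP H2 : `|s *: (t *: v)| < d.
    by apply: le_lt_trans st _; apply: le_lt_trans tkd; rewrite /k; nra.
  have -> : G' s = t *: (('d f (x + (t *: w + s *: (t *: v))) v - 'd f x v - A (t *: w + s *: (t *: v)))
      - ('d f (x + s *: (t *: v)) v - 'd f x v - A (s *: (t *: v)))).
    have dZ (y u : E) (c : R) : 'd f y (c *: u) = c *: 'd f y u by rewrite linearZ.
    have AZ (u : E) (c : R) : A (c *: u) = c *: A u by rewrite linearZ.
    have AD (u1 u2 : E) : A (u1 + u2) = A u1 + A u2 by rewrite linearD.
    have E1 y : 'd f y (t *: v) = t *: 'd f y v := dZ _ _ _.
    have E2 : A (s *: (t *: v)) = s *: (t *: A v) := etrans (AZ _ _) (congr1 _ (AZ _ _)).
    have E3 : A (t *: w + s *: (t *: v)) = t *: A w + s *: (t *: A v) :=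
      etrans (AD _ _) (congr2 +%R (AZ _ _) E2).
    rewrite /G' E3 E2 !E1 (addrA x).
    have alg (a b c b1 b2 : E) : t *: a - t *: b - t ^+ 2 *: b1 =
      t *: (a - c - (t *: b1 + s *: (t *: b2)) - (b - c - s *: (t *: b2))) by lmod.
    exact: alg.
  rewrite normrZ gtr0_norm// (le_trans (ler_wpM2l (ltW t0) (ler_normB _ _)))//.
  have -> : e * t ^+ 2 = t * (e / k * (t * k)) by field; rewrite gt_eqF.
  rewrite ler_wpM2l ?(ltW t0)//; apply: le_trans (lerD H1 H2) _.
  rewrite -mulrDr ler_wpM2l ?(ltW ek)// (le_trans (lerD h1b st))// /k; nra.
have := mean_value_const ler01 (derive_within_continuous dG) (fun u _ => dG u) G'b.
rewrite subr0 mulr1; congr (`|_| <= _); rewrite /G !scale1r !scale0r !addr0 subr0.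
by rewrite [x + t *: w + _]addrAC; lmod.
Qed.

(** The second difference is symmetric in v and w; divided by t^2, it tends to both sides. *)
Lemma second_derivative_sym f x v w : Db 2 [set f] ->
  'd (fun y => 'd f y v) x w = 'd (fun y => 'd f y w) x v.
Proof.
move=> D2; apply/eqP; rewrite -subr_eq0 -normr_le0; apply/ler_addgt0Pr => e e0.
rewrite add0r; have e20 : 0 < e / 2 by lra.
have [d1 d10 H1] := second_difference x v w D2 e20.
have [d2 d20 H2] := second_difference x w v D2 e20.
pose t := Order.min d1 d2 / 2.
have m0 : 0 < Order.min d1 d2 by rewrite lt_min d10.
have t0 : 0 < t by rewrite divr_gt0.
have t1 : t < d1 by apply: (@lt_le_trans _ _ (Order.min d1 d2)); rewrite ?ge_min ?lexx// /t; lra.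
have t2 : t < d2 by apply: (@lt_le_trans _ _ (Order.min d1 d2)); rewrite ?ge_min ?lexx ?orbT// /t; lra.
have tt : 0 < t ^+ 2 by rewrite exprn_gt0.
move: H1 H2 => /(_ t (introT andP (conj t0 t1))) H1 /(_ t (introT andP (conj t0 t2))) H2.
rewrite -(ler_pM2l tt) -{1}(gtr0_norm tt) -normrZ.
set A := 'd _ _ _; set B := 'd _ _ _.
move: H1 H2; rewrite -/A -/B [x + t *: w + t *: v]addrAC => H1 H2.
have -> : t ^+ 2 *: (A - B) =
  (f (x + t *: v + t *: w) - f (x + t *: w) - f (x + t *: v) + f x - t ^+ 2 *: B)
  - (f (x + t *: v + t *: w) - f (x + t *: v) - f (x + t *: w) + f x - t ^+ 2 *: A) by lmod.
rewrite (le_trans (ler_normB _ _))// (le_trans (lerD H2 H1))//; nra.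
Qed.

(** The product rule, with three errors: the expansion of Df at the fixed vector V x, that of V
    under Df x, and the cross term (Df(x + h) - Df(x)) (V(x + h) - V x), which is quadratic in h
    because Df is Lipschitz uniformly over directions ([Db2_bound]). *)
Lemma diff_apply f (V : E -> E) x : Db 2 [set f] -> (forall x, differentiable V x) ->
  differentiable (fun y => 'd f y (V y)) x /\
  forall h, 'd (fun y => 'd f y (V y)) x h =
    'd (fun y => 'd f y (V x)) x h + 'd f x ('d V x h).
Proof.
move=> D2 dV; have [C1 C10 /(_ f erefl)[df fC1]] := Db1_bound (DbW (isT : (1 <= 2)%N) D2).
have [C2 C20 /(_ f erefl) H2] := Db2_bound D2.
have [dg gC _] := H2 (V x).
have [k k0 kV] := linear_lipschitz (diff_continuous (dV x)).
pose L : {linear E -> E} := 'd (fun y => 'd f y (V x)) x \+ ('d f x \o 'd V x).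
have [||] := @differentiable_intro R E E (fun y => 'd f y (V y)) L (C2 * `|V x| + C1 * k) x.
- move=> h /=; rewrite (le_trans (ler_normD _ _))// mulrDl lerD//.
  by rewrite -mulrA (le_trans (fC1 _ _))// ler_wpM2l.
- move=> e e0; pose e1 := e / 3 / (C1 + 1).
  have e10 : 0 < e1 by rewrite !divr_gt0//; lra.
  have [d1 d10 P1] := differentiable_eps (dg x) (ltac:(lra) : 0 < e / 3).
  have [d2 d20 P2] := differentiable_eps (dV x) e10.
  pose M := C2 * (e1 + k).
  have M0 : 0 <= M by rewrite /M mulr_ge0// addr_ge0// ltW.
  pose d3 := e / 3 / (M + 1).
  have d30 : 0 < d3 by rewrite !divr_gt0//; lra.
  have C1e : C1 * e1 <= e / 3.
    by rewrite /e1 mulrCA ler_piMr ?divr_ge0 ?(ltW e0)// ler_pdivrMr ?mul1r ?lerDl// ltr_wpDl.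
  have Md : M * d3 <= e / 3.
    by rewrite /d3 mulrCA ler_piMr ?divr_ge0 ?(ltW e0)// ler_pdivrMr ?mul1r ?lerDl// ltr_wpDl.
  have sum3 (y : R) : e / 3 * y + e / 3 * y + e / 3 * y = e * y by field.
  exists (Order.min d1 (Order.min d2 d3)); first by rewrite !lt_min d10 d20.
  move=> h; rewrite !lt_min => /and3P[/P1 Q1 /P2 Q2 h3].
  set u := V (x + h) - V x.
  have uh : `|u| <= (e1 + k) * `|h|.
    have -> : u = (u - 'd V x h) + 'd V x h by rewrite subrK.
    by rewrite (le_trans (ler_normD _ _))// mulrDl lerD.
  have [_ _ gu] := H2 u.
  have Q3 : `|'d f (x + h) u - 'd f x u| <= M * `|h| * `|h|.
    apply: le_trans (gu _ _) _; rewrite addrAC subrr add0r ler_wpM2r//.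
    by rewrite /M -mulrA ler_wpM2l.
  have -> : 'd f (x + h) (V (x + h)) - 'd f x (V x) - L h =
    ('d f (x + h) (V x) - 'd f x (V x) - 'd (fun y => 'd f y (V x)) x h)
    + 'd f x (u - 'd V x h) + ('d f (x + h) u - 'd f x u).
    have dB (y u1 u2 : E) : 'd f y (u1 - u2) = 'd f y u1 - 'd f y u2 by rewrite linearB.
    have -> : L h = 'd (fun y => 'd f y (V x)) x h + 'd f x ('d V x h) by [].
    have E1 : 'd f x (u - 'd V x h) = 'd f x (V (x + h)) - 'd f x (V x) - 'd f x ('d V x h) :=
      etrans (dB _ _ _) (congr1 (+%R^~ _) (dB _ _ _)).
    have E2 : 'd f (x + h) u = 'd f (x + h) (V (x + h)) - 'd f (x + h) (V x) := dB _ _ _.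
    have alg (a b c d a' b' : E) :
      a - b - (c + d) = (a' - b - c) + (b' - b - d) + (a - a' - (b' - b)) by lmod.
    have E3 : 'd f x u = 'd f x (V (x + h)) - 'd f x (V x) := dB _ _ _.
    by rewrite E1 E2 E3; exact: alg.
  have Q2' : `|'d f x (u - 'd V x h)| <= e / 3 * `|h|.
    rewrite (le_trans (fC1 _ _))// (le_trans (ler_wpM2l C10 Q2))// (mulrA C1) ler_wpM2r//.
  have Q3' : M * `|h| * `|h| <= e / 3 * `|h|.
    by rewrite ler_wpM2r//; apply: le_trans Md; rewrite ler_wpM2l// ltW.
  rewrite (le_trans (ler_normD _ _))// (le_trans (lerD (ler_normD _ _) (lexx _)))//.
  have := lerD (lerD Q1 Q2') (le_trans Q3 Q3'); move/le_trans; apply.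
  by rewrite sum3.
by move=> d1 d2; split=> // h; rewrite (congr1 (@^~ h) d2).
Qed.

Definition apply_set S S' : set (E -> E) :=
  [set h | exists f V, [/\ S f, S' V & h = fun x => 'd f x (V x)]].

Lemma Db_set1 k S f : Db k S -> S f -> Db k [set f].
Proof. by move=> D Sf; apply: Db_sub D => _ ->. Qed.

(* The derivative of [x |-> 'd f x (V x)] in the direction v is, by symmetry of
   the second derivative, ['d ('d f . v) x (V x) + 'd f x ('d V x v)]: both
   terms are again of the form considered. *)
Lemma Cb_apply k S S' : Db k.+1 S -> Cb k S' -> Cb k (apply_set S S').
Proof.
have bA S0 S0' : Db 1 S0 -> equibounded S0' -> equibounded (apply_set S0 S0').
  move=> /Db1_bound[C C0 SC] /equiboundedW[D D0 SD]; exists (C * D).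
  move=> _ [f [V [Sf SV ->]]] x; have [_ /(_ x (V x)) fC] := SC f Sf.
  by rewrite (le_trans fC)// ler_wpM2l//; exact: SD.
elim: k S S' => [|k IH] S S' D [b' D'].
  by split=> //; exact: bA D b'.
have D2 : Db 2 S by apply: DbW D.
have [d' _ _] := D'.
have dA : derivatives (apply_set S S') `<=`
    sum_set (apply_set (derivatives S) S') (apply_set S (derivatives S')).
  move=> _ [_ [v [[f [V [Sf SV ->]]] v1 ->]]].
  exists (fun x => 'd (fun y => 'd f y v) x (V x)), (fun x => 'd f x ('d V x v)); split.
  - by exists (fun y => 'd f y v), V; split=> //; exists f, v.
  - by exists f, (fun x => 'd V x v); split=> //; exists V, v.
  apply/funext => x /=; have [_ ->] := diff_apply x (Db_set1 D2 Sf) (d' V SV).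
  by congr (_ + _); apply: second_derivative_sym; exact: Db_set1 D2 Sf.
split; first exact: bA (DbW _ D) b'.
apply/DbS; split.
  by move=> _ [f [V [Sf SV ->]]] x; have [] := diff_apply x (Db_set1 D2 Sf) (d' V SV).
apply: Cb_sub dA _; apply: Cb_sum.
  apply: IH; first by case: D.
  by split=> //; exact: DbW D'.
by apply: IH; [exact: DbW D|case: D'].
Qed.

(** Mean value inequality for f o p - f o q, with p and q running along the segments [b, a] and
    [b', a']. The derivative splits into Df(p) applied to a - b - a' + b' and (Df(p) - Df(q))
    applied to a' - b'. *)
Lemma four_point f (M : R) : Db 2 [set f] ->
  (forall x v, `|'d f x v| <= M * `|v|) ->
  (forall x y v, `|'d f x v - 'd f y v| <= M * `|v| * `|x - y|) ->
  forall a b a' b', `|f a - f b - f a' + f b'| <=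
    M * `|a - b - a' + b'| + M * (`|a - a'| + `|b - b'|) * `|a' - b'|.
Proof.
move=> D2 M1 M2 a b a' b'; have [df _ _] := D2; have {}df := df f erefl.
have M0 : forall v : E, 0 <= M * `|v| by move=> v; apply: le_trans (M1 0 v).
pose p s := b + s *: (a - b); pose q s := b' + s *: (a' - b').
have dl s : is_derive s (1 : R) ((f \o p) - (f \o q)) ('d f (p s) (a - b) - 'd f (q s) (a' - b')).
  have dp : is_derive s (1 : R) (f \o p) ('d f (p s) (a - b)).
    by apply: is_derive_comp_curve => //; exact: is_derive_line.
  have dq : is_derive s (1 : R) (f \o q) ('d f (q s) (a' - b')).
    by apply: is_derive_comp_curve => //; exact: is_derive_line.
  exact: is_deriveB.
have := mean_value_const ler01 (derive_within_continuous dl) (fun u _ => dl u).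
move=> /(_ (M * `|a - b - a' + b'| + M * (`|a - a'| + `|b - b'|) * `|a' - b'|)).
rewrite subr0 mulr1 !fctE /= /p /q !scale1r !scale0r !addr0.
rewrite ![_ + (_ - _)]addrC !subrK => H.
have -> : f a - f b - f a' + f b' = f a - f a' - (f b - f b') by lmod.
apply: H => s /andP[s0 s1].
have -> : 'd f (b + s *: (a - b)) (a - b) - 'd f (b' + s *: (a' - b')) (a' - b') =
  'd f (b + s *: (a - b)) (a - b - a' + b') +
  ('d f (b + s *: (a - b)) (a' - b') - 'd f (b' + s *: (a' - b')) (a' - b')).
  have -> : a - b - a' + b' = (a - b) - (a' - b') by lmod.
  by rewrite [in RHS]linearB; lmod.
rewrite (le_trans (ler_normD _ _))// lerD//.
apply: le_trans (M2 _ _ _) _; rewrite [leRHS]mulrAC ler_wpM2l//.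
have -> : b + s *: (a - b) - (b' + s *: (a' - b')) = s *: (a - a') + (1 - s) *: (b - b') by lmod.
rewrite (le_trans (ler_normD _ _))// !normrZ gtr0_norm// gtr0_norm ?subr_gt0//.
by rewrite lerD// ler_piMl//; lra.
Qed.

End Classes.

(** * Differential operators associated with words *)

Section WordFields.
Context (R : realType) (E : normedModType R).
Implicit Types (f g : E -> E) (x v : E) (S : set (E -> E)).

Lemma Ckb_norm_bound k f : (Ckb_norm k f < +oo)%E ->
  exists2 C : R, 0 <= C & forall j, (j <= k)%N -> forall (vs : j.-tuple E) x,
    (forall v, v \in vs -> `|v| <= 1) -> `|iter_diff f vs x| <= C.
Proof.
move=> fk; have k0 : (0 <= Ckb_norm k f)%E by apply: bigmax_ge_id.
have fin : Ckb_norm k f \is a fin_num by rewrite ge0_fin_numE.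
exists (fine (Ckb_norm k f)); first exact: fine_ge0.
move=> j jk vs x vs1; rewrite -lee_fin fineK//.
have jk' : (j < k.+1)%N by [].
apply: le_trans (le_bigmax _ _ (Ordinal jk')) => /=.
apply: le_trans (ereal_sup_ubound _); last by exists x.
by apply: ereal_sup_ubound; exists vs.
Qed.

(** The class [D j] gathers the derivatives of order j in unit directions; [D j] has k - j bounded
    derivatives left, by induction on k - j. *)
Lemma Ckb_Cb k f : Ckb k f -> Cb k [set f].
Proof.
move=> [fd _ /Ckb_norm_bound[C C0 fC]].
pose D j : set (E -> E) := [set g | exists vs : j.-tuple E,
  (forall v, v \in vs -> `|v| <= 1) /\ g = iter_diff f vs].
have Db0 j : (j <= k)%N -> equibounded (D j).
  by move=> jk; exists C => _ [vs [vs1 ->]] x; exact: fC.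
have Dder j : derivatives (D j) `<=` D j.+1.
  move=> _ [_ [v [[vs [vs1 ->]] v1 ->]]]; exists (cons_tuple v vs); split=> // u.
  by rewrite inE => /predU1P[->//|]; exact: vs1.
have Ddiff j : (j < k)%N -> forall g, D j g -> forall x, differentiable g x.
  move=> jk _ [vs [vs1 ->]] x.
  have [||//] := @differentiable_intro R E E (iter_diff f vs) ('d (iter_diff f vs) x) C x.
  - move=> h; have [->|h0] := eqVneq h 0; first by rewrite linear0 !normr0 mulr0.
    have nh : `|h| != 0 by rewrite normr_eq0.
    rewrite -{1}[h](scalerKV nh) linearZ /= normrZ normr_id mulrC ler_wpM2r//.
    apply: (fC j.+1 jk (cons_tuple (`|h|^-1 *: h) vs) x) => u.
    rewrite inE => /predU1P[->|]; last exact: vs1.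
    by rewrite normrZ normfV normr_id mulVf.
  - move=> e e0; have /near0P[d d0 dP] := fd j jk x e e0.
    exists d => // h /dP/(_ vs) /le_trans; apply.
    rewrite ler_piMr ?mulr_ge0 ?(ltW e0)//.
    by rewrite big_seq; apply: prodr_ile1 => v /vs1 ->; rewrite normr_ge0.
have DD i j : (i + j)%N = k -> Db i (D j).
  elim: i j => // i IH j ijk; split.
  - by apply: Ddiff; lia.
  - by apply: equibounded_sub (@Dder j) (Db0 _ _); lia.
  - by apply: Db_sub (@Dder j) (IH _ _); lia.
have sub : [set f] `<=` D 0%N by move=> _ ->; exists [tuple].
split; first exact: equibounded_sub sub (Db0 _ _).
by apply: Db_sub sub (DD _ _ _); rewrite addn0.
Qed.

Lemma diff_add f g x : differentiable f x -> differentiable g x ->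
  differentiable (fun y => f y + g y) x /\
  forall v, 'd (fun y => f y + g y) x v = 'd f x v + 'd g x v.
Proof.
move=> df dg; split=> [|v]; first exact: (@differentiableD _ _ _ f g).
by rewrite (congr1 (@^~ v) (@diffD _ _ _ f g x df dg)).
Qed.

Lemma diff_scale (c : R) f x : differentiable f x ->
  differentiable (fun y => c *: f y) x /\ forall v, 'd (fun y => c *: f y) x v = c *: 'd f x v.
Proof.
move=> df; split=> [|v]; first exact: (@differentiableZ _ _ _ f).
by rewrite (congr1 (@^~ v) (@diffZ _ _ _ f c x df)).
Qed.

Lemma diff_sumZ (I : Type) (s : seq I) (P : pred I) (c : I -> R) (G : I -> E -> E) x :
  (forall i, P i -> differentiable (G i) x) ->
  differentiable (fun y => \sum_(i <- s | P i) c i *: G i y) x /\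
  forall v, 'd (fun y => \sum_(i <- s | P i) c i *: G i y) x v = \sum_(i <- s | P i) c i *: 'd (G i) x v.
Proof.
move=> dG; elim: s => [|i s IH].
  have -> : (fun y => \sum_(i <- [::] | P i) c i *: G i y) = cst 0.
    by apply/funext => y; rewrite big_nil.
  by split=> // v; rewrite big_nil diff_cst.
have [Pi|Pi] := boolP (P i); last first.
  have -> : (fun y => \sum_(j <- i :: s | P j) c j *: G j y) =
      (fun y => \sum_(j <- s | P j) c j *: G j y).
    by apply/funext => y; rewrite big_cons (negbTE Pi).
  by case: IH => IHd IH; split=> // v; rewrite big_cons (negbTE Pi).
have -> : (fun y => \sum_(j <- i :: s | P j) c j *: G j y) =
    (fun y => c i *: G i y + \sum_(j <- s | P j) c j *: G j y).
  by apply/funext => y; rewrite big_cons Pi.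
move: IH; set H := fun y => \sum_(j <- s | P j) c j *: G j y => -[IHd IH].
have [dc dcE] := diff_scale (c i) (dG i Pi).
have [d dE] := diff_add dc IHd.
by split=> // v; apply: etrans (dE v) _; rewrite dcE IH big_cons Pi.
Qed.

Context (l N : nat) (F : {linear 'rV[R]_l -> (E -> E)}).
Hypothesis hF : forall v : 'rV[R]_l, Ckb N.+1 (F v).
Local Notation tensor := (tensor R l N).
Local Notation word := (N.-bseq 'I_l).

Definition word_op (w : seq 'I_l) g : E -> E :=
  foldr (fun i => dop1 F (delta_mx ord0 i)) g w.

Lemma word_op_cat (v w : seq 'I_l) g : word_op (v ++ w) g = word_op v (word_op w g).
Proof. by rewrite /word_op foldr_cat. Qed.

Definition base_fields : set (E -> E) :=
  [set f | exists i : 'I_l, f = F (delta_mx ord0 i)].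

Definition word_fields r : set (E -> E) :=
  [set f | exists w : seq 'I_l, size w = r /\ f = word_op w id].

Lemma Cb_base_fields : Cb N.+1 base_fields.
Proof.
have : forall i, (i < l)%N ->
    Cb N.+1 [set f | exists j : 'I_l, j = i :> nat /\ f = F (delta_mx ord0 j)].
  move=> i il; apply: Cb_sub (Ckb_Cb (hF (delta_mx ord0 (Ordinal il)))).
  by move=> _ [j [ji ->]]; congr (F (delta_mx _ _)); exact/val_inj.
move=> /Cb_bigcup; apply: Cb_sub => _ [i ->]; exists i => //; by exists i.
Qed.

Lemma word_op1 (i : 'I_l) : word_op [:: i] id = F (delta_mx ord0 i).
Proof. by apply/funext => x; rewrite /word_op /= /dop1 diff_val. Qed.

(** The field of i :: w is the derivative of the field of w along F(e_i), so each letter after the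
    first costs one derivative. In particular the class is [Cb 2] for words of length N. *)
Lemma Cb_word_fields r : (r <= N.+1)%N -> Cb (N.+1 - r) (word_fields r.+1).
Proof.
elim: r => [_|r IH rN].
  rewrite subn0; apply: Cb_sub Cb_base_fields => _ [[|i [|? ?]] [//= _ ->]].
  by exists i; exact: word_op1.
have sub : word_fields r.+2 `<=` apply_set (word_fields r.+1) base_fields.
  move=> _ [[|i w] [//= [wr] ->]].
  by exists (word_op w id), (F (delta_mx ord0 i)); split=> //; [exists w|exists i].
apply: Cb_sub sub (Cb_apply _ _); last by apply: CbW Cb_base_fields; lia.
by have [_] := IH (ltnW rN); rewrite subnS prednK// subn_gt0.
Qed.

(** Boundedness is claimed for nonempty words only: g is often the identity, which has bounded
    derivatives but is unbounded. *)
Lemma Db_word_op k w g : Db (k + size w) [set g] -> (k + size w <= N.+2)%N ->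
  Db k [set word_op w g] /\ (0 < size w -> Cb k [set word_op w g])%N.
Proof.
elim: w k => [|i w IH] k /=; first by rewrite addn0.
rewrite addnS -addSn => D kN; have [D1 _] := IH _ D kN.
suff H : Cb k [set word_op (i :: w) g] by split=> //; case: H.
apply: Cb_sub (Cb_apply D1 (CbW _ Cb_base_fields)).
  move=> _ ->; exists (word_op w g), (F (delta_mx ord0 i)); split=> //; by exists i.
by lia.
Qed.

Lemma word_op_sumZ (I : Type) (s : seq I) (P : pred I) (c : I -> R) (G : I -> E -> E)
    (w : seq 'I_l) : (size w <= N.+2)%N -> (forall i, P i -> Db (size w) [set G i]) ->
  word_op w (fun x => \sum_(i <- s | P i) c i *: G i x) =
  fun x => \sum_(i <- s | P i) c i *: word_op w (G i) x.
Proof.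
elim: w => // j w IH wN DG.
rewrite [LHS]/= IH; last 2 first.
- exact: ltnW.
- by move=> i Pi; apply: DbW (DG i Pi) => /=.
apply/funext => x; rewrite /dop1.
have [] // := @diff_sumZ _ s P c (fun i => word_op w (G i)) x.
move=> i Pi; have [||[d _ _] _] := @Db_word_op 1 w (G i); last exact: d.
- exact: DG.
- exact: wN.
Qed.

Lemma dopE (a : tensor) g x : dop F a g x = \sum_(w : word) a w *: word_op w g x.
Proof. by []. Qed.

Lemma dop_linear (a b : tensor) (c : R) g x :
  dop F (c *: a + b) g x = c *: dop F a g x + dop F b g x.
Proof.
rewrite !dopE scaler_sumr -big_split; apply: eq_bigr => w _ /=.
by rewrite !ffunE scalerDl scalerA.
Qed.

Lemma dop0 g x : dop F (0 : tensor) g x = 0.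
Proof. by rewrite dopE big1// => w _; rewrite ffunE scale0r. Qed.

Lemma dopD (a b : tensor) g x : dop F (a + b) g x = dop F a g x + dop F b g x.
Proof. by rewrite -{1}[a]scale1r dop_linear scale1r. Qed.

Lemma dopZ (c : R) (a : tensor) g x : dop F (c *: a) g x = c *: dop F a g x.
Proof. by rewrite -[c *: a]addr0 dop_linear dop0 addr0. Qed.

Lemma dopB (a b : tensor) g x : dop F (a - b) g x = dop F a g x - dop F b g x.
Proof. by rewrite dopD -scaleN1r dopZ scaleN1r. Qed.

Lemma dop_sum (I : Type) (s : seq I) (P : pred I) (a : I -> tensor) g x :
  dop F (\sum_(i <- s | P i) a i) g x = \sum_(i <- s | P i) dop F (a i) g x.
Proof.
elim/big_rec2: _ => [|i y b _ <-]; first exact: dop0.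
exact: dopD.
Qed.

Lemma dop_level (a : tensor) r g x :
  dop F (level r a) g x = \sum_(w : word | size w == r) a w *: word_op w g x.
Proof.
rewrite dopE [RHS]big_mkcond /=; apply: eq_bigr => w _; rewrite levelE.
by case: ifP => // _; rewrite scale0r.
Qed.

Lemma Cb_dop_level k r (a : tensor) g : (0 < r)%N -> (k + r <= N.+2)%N ->
  Db (k + r) [set g] -> Cb k [set dop F (level r a) g].
Proof.
move=> r0 kr D.
have -> : dop F (level r a) g = fun x => \sum_(w : word | size w == r) a w *: word_op w g x.
  by apply/funext => x; rewrite dop_level.
apply: Cb_sum1 => w /eqP wr; have [||_] := @Db_word_op k w g; rewrite ?wr//.
by apply.
Qed.

(** Operators compose as tensors multiply, provided that i + j <= N keeps the product clear of the
    truncation. *)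
Lemma dop_level_mul i j (a b : tensor) g x : (i + j <= N)%N -> Db (i + j) [set g] ->
  dop F (level i a * level j b) g x = dop F (level i a) (dop F (level j b) g) x.
Proof.
move=> ijN D; rewrite dopE (sum_tensor_mul _ _ (fun w => word_op w g x)).
rewrite dop_level [RHS]big_mkcond /=; apply: eq_bigr => v _.
case: eqP => vi; last first.
  by rewrite big1// => w _; rewrite levelE; case: eqP => //; rewrite mul0r scale0r.
have -> : dop F (level j b) g = fun x => \sum_(w : word | size w == j) b w *: word_op w g x.
  by apply/funext => y; rewrite dop_level.
rewrite word_op_sumZ; last 2 first.
- by rewrite vi; lia.
- move=> w /eqP wj; rewrite vi; have [||//] := @Db_word_op i w g; rewrite wj//; lia.
rewrite scaler_sumr big_mkcond [RHS]big_mkcond /=; apply: eq_bigr => w _.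
rewrite !levelE vi eqxx; case: (eqVneq (size w) j) => [->|_].
  by rewrite ijN scalerA word_op_cat.
by rewrite mulr0 scale0r if_same.
Qed.

(* For Lie elements, the higher order derivatives of g cancel: the operators
   of order i and j have a commutator of order one by the symmetry of the
   second derivative. *)
Lemma dop_lie (a : tensor) : free_nilpotent_lie a -> forall r, (r <= N)%N -> forall g,
  Db r [set g] -> forall x, dop F (level r a) g x = 'd g x (dop F (level r a) id x).
Proof.
elim=> [v|b c _ IHb _ IHc|y b _ IHb|b c Lb IHb Lc IHc] r rN g D x.
- rewrite !dop_level linear_sum; apply: eq_bigr => w /eqP wr.
  have [r1|r1] := eqVneq r 1%N; last first.
    have -> : tvec N v w = 0; last by rewrite !scale0r linear0.
    by rewrite ffunE; case: w wr r1 => [[|? []] ?] //= <-.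
  rewrite [RHS]linearZ /=; congr (_ *: _).
  case: w wr => [[|i [|? ?]] ?]; rewrite r1//= => _.
  by rewrite /dop1; congr ('d g x _); rewrite diff_val.
- by rewrite linearD /= !dopD IHb// IHc// linearD.
- by rewrite linearZ /= !dopZ IHb// linearZ.
have b0 : level 0 b = 0 by apply: (@level_low _ _ _ 1) => //; exact: lie_low.
have c0 : level 0 c = 0 by apply: (@level_low _ _ _ 1) => //; exact: lie_low.
rewrite level_bracket !dop_sum linear_sum; apply: eq_bigr => -[i /= ir] _.
have [->|i0] := posnP i; first by rewrite b0 /lie_bracket mul0r mulr0 subr0 !dop0 linear0.
have [j0|j0] := posnP (r - i); first by rewrite j0 c0 /lie_bracket mul0r mulr0 subr0 !dop0 linear0.
set j := (r - i)%N in j0 *.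
have rE : r = (i + j)%N by rewrite /j; lia.
pose V := dop F (level i b) id; pose W := dop F (level j c) id.
have CV : Cb 1 [set V] by apply: Cb_dop_level => //; [lia|exact: Db_id].
have CW : Cb 1 [set W] by apply: Cb_dop_level => //; [lia|exact: Db_id].
have dV : forall x, differentiable V x by case: CV => _ [d _ _]; exact: d.
have dW : forall x, differentiable W x by case: CW => _ [d _ _]; exact: d.
have D2 : Db 2 [set g] by apply: DbW D; lia.
(* For h = id this is the bracket DW.V - DV.W of the two fields. For h = g, the product rule adds
   the terms D^2 g (V, W) and D^2 g (W, V), which cancel by symmetry, leaving Dg applied to that
   bracket. *)
have key h : Db r [set h] -> dop F (lie_bracket (level i b) (level j c)) h x =
    'd (fun y => 'd h y (W y)) x (V x) - 'd (fun y => 'd h y (V y)) x (W x).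
  move=> Dh; rewrite /lie_bracket dopB !dop_level_mul -?rE//; last 2 first.
  - by rewrite addnC -rE.
  - by rewrite addnC -rE.
  have -> : dop F (level j c) h = fun y => 'd h y (W y).
    by apply/funext => y; apply: IHc; [lia|apply: DbW Dh; lia].
  have -> : dop F (level i b) h = fun y => 'd h y (V y).
    by apply/funext => y; apply: IHb; [lia|apply: DbW Dh; lia].
  have DW : Db i [set fun y => 'd h y (W y)].
    have CWi : Cb i [set W] by apply: Cb_dop_level => //; [lia|exact: Db_id].
    have Dhi : Db i.+1 [set h] by apply: DbW Dh; lia.
    have [_ D'] := Cb_apply Dhi CWi.
    by apply: Db_sub D' => _ ->; exists h, W.
  have DV : Db j [set fun y => 'd h y (V y)].
    have CVj : Cb j [set V] by apply: Cb_dop_level => //; [lia|exact: Db_id].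
    have Dhj : Db j.+1 [set h] by apply: DbW Dh; lia.
    have [_ D'] := Cb_apply Dhj CVj.
    by apply: Db_sub D' => _ ->; exists h, V.
  by rewrite IHb//; [rewrite IHc//; lia|lia].
rewrite key// (key id); last exact: Db_id.
have idE (U : E -> E) : (fun y => 'd (@id E) y (U y)) = U.
  by apply/funext => y; rewrite diff_val.
have [_ EW] := diff_apply x D2 dW; have [_ EV] := diff_apply x D2 dV.
have dB u1 u2 : 'd g x (u1 - u2) = 'd g x u1 - 'd g x u2 by rewrite linearB.
have alg (u1 u2 u3 u4 : E) : u1 = u3 -> u1 + u2 - (u3 + u4) = u2 - u4 by move=> ->; lmod.
transitivity ('d g x ('d W x (V x) - 'd V x (W x))).
  apply: etrans (congr2 (fun a b => a - b) (EW (V x)) (EV (W x))) _.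
  exact: etrans (alg _ _ _ _ (second_derivative_sym x (W x) (V x) D2)) (esym (dB _ _)).
exact: congr1 (congr2 (fun a b => a - b) (congr1 (fun U => 'd U x (V x)) (esym (idE W)))
  (congr1 (fun U => 'd U x (W x)) (esym (idE V)))).
Qed.

End WordFields.

(** * Sewing of almost flows *)

Section Partitions.
Context (R : realType).
Implicit Types (P Q : seq R) (s t u v w : R).

(** The last point of the unsorted partition before the midpoint. With its counterpart [sel_right],
    it cuts [s, t] into two parts of at most half the length and a middle gap free of partition
    points. *)
Lemma sel_left P s mid : s <= mid -> exists v, [/\ v = s \/ v \in P, s <= v, v <= mid
  & forall q, q \in P -> q <= v \/ mid < q].
Proof.
move=> smid; elim: P => [|p P [v [vP sv vmid H]]]; first by exists s; split=> //; left.
have [pv|vp] := leP p v.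
  exists v; split=> //; first by case: vP => [|vP]; [left|right; rewrite inE vP orbT].
  by move=> q; rewrite inE => /predU1P[->|/H//]; left.
have [pmid|midp] := leP p mid.
  exists p; split=> //; first by right; rewrite inE eqxx.
    by rewrite (le_trans sv)// ltW.
  move=> q; rewrite inE => /predU1P[->|/H[qv|]]; [by left| |by right].
  by left; rewrite (le_trans qv)// ltW.
exists v; split=> //; first by case: vP => [|vP]; [left|right; rewrite inE vP orbT].
by move=> q; rewrite inE => /predU1P[->|/H//]; right.
Qed.

Lemma sel_right P mid t : mid < t -> exists w, [/\ w = t \/ w \in P, mid < w, w <= t
  & forall q, q \in P -> q <= mid \/ w <= q].
Proof.
move=> midt; elim: P => [|p P [w [wP midw wt H]]]; first by exists t; split=> //; left.
have [wp|pw] := leP w p.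
  exists w; split=> //; first by case: wP => [|wP]; [left|right; rewrite inE wP orbT].
  by move=> q; rewrite inE => /predU1P[->|/H//]; right.
have [pmid|midp] := leP p mid.
  exists w; split=> //; first by case: wP => [|wP]; [left|right; rewrite inE wP orbT].
  by move=> q; rewrite inE => /predU1P[->|/H//]; left.
exists p; split=> //; first by right; rewrite inE eqxx.
  by rewrite (le_trans (ltW pw)).
move=> q; rewrite inE => /predU1P[->|/H[|wq]]; [by right|by left|].
by right; rewrite (le_trans (ltW pw)).
Qed.

Definition interior P s t := count (fun q : R => (s < q < t)%R) P.

Lemma interior_split P s t v : v \in P -> s < v < t ->
  (interior P s v + interior P v t < interior P s t)%N.
Proof.
move=> vP /andP[sv vt]; rewrite /interior.
have H (Q : seq R) : (count (fun q : R => (s < q < v)%R) Q + count (fun q : R => (v < q < t)%R) Q + count_mem v Q <=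
    count (fun q : R => (s < q < t)%R) Q)%N.
  elim: Q => //= q Q IH.
  have [->|qv] := eqVneq q v; first by rewrite sv vt !ltxx /=; lia.
  have [qv'|vq|qE] := ltgtP q v; last by rewrite qE eqxx in qv.
    by rewrite (lt_trans qv' vt) !andbT/=; lia.
  by rewrite (lt_trans sv vq) andbF/=; lia.
have := H P; have : (0 < count_mem v P)%N by rewrite -has_count has_pred1.
lia.
Qed.

Lemma interior0 P s t : interior P s t = 0%N -> forall q, q \in P -> ~ (s < q < t).
Proof.
move=> /eqP; rewrite /interior -leqn0 leqNgt -has_count => /hasPn H q qP sqt.
by have := H q qP; rewrite sqt.
Qed.

Context (E : Type) (T : R) (m : R -> R -> E -> E).
Hypothesis m_refl : forall t, 0 <= t <= T -> m t t = id.

(* Composition of m along the points of P lying in [s, t]; the list P need not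
   be sorted. *)
Fixpoint pcomp P s t : E -> E :=
  if P is u :: P' then
    if s <= u <= t then pcomp P' u t \o pcomp P' s u else pcomp P' s t
  else m s t.

Lemma pcomp_refl P t : 0 <= t <= T -> pcomp P t t = id.
Proof.
move=> tT; elim: P => [|u P IH] /=; first exact: m_refl.
by case: ifP => //; rewrite -eq_le => /eqP <-; rewrite IH.
Qed.

(** The composition does not depend on the order of insertion: the head u of the list splits one of
    [s, v] and [v, t], and the induction hypothesis applies on the side of u that contains v. *)
Lemma pcomp_split P s t v : 0 <= s -> t <= T -> s <= v <= t -> v \in P ->
  pcomp P s t = pcomp P v t \o pcomp P s v.
Proof.
elim: P s t => // u P IH s t s0 tT /andP[sv vt].
have vT : 0 <= v <= T by rewrite (le_trans s0 sv) (le_trans vt tT).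
rewrite inE => /predU1P[vu|vP] /=.
  by rewrite vu in sv vt vT *; rewrite sv vt lexx /= !pcomp_refl.
case: ifP => [/andP[su ut]|sut].
  have [vu|uv] := leP v u.
    rewrite ut /= (IH s u)//; [|exact: le_trans ut tT|exact/andP].
    case: ifP => // /andP[_ uv].
    have -> : u = v by apply/eqP; rewrite eq_le uv vu.
    by rewrite pcomp_refl.
  by rewrite /= (ltW uv) su /= (IH u t)//; [exact: le_trans su|rewrite (ltW uv) vt].
rewrite ifN; last by apply: contraFN sut => /andP[vu ->]; rewrite (le_trans sv vu).
rewrite ifN; last by apply: contraFN sut => /andP[-> uv]; rewrite (le_trans uv vt).
by apply: IH => //; rewrite sv.
Qed.

Lemma pcomp_split_or P s t v : 0 <= s -> t <= T -> s <= v <= t ->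
  [\/ v = s, v = t | v \in P] -> pcomp P s t = pcomp P v t \o pcomp P s v.
Proof.
move=> s0 tT /[dup] svt /andP[sv vt] [vE|vE|vP]; last exact: pcomp_split.
- by rewrite vE pcomp_refl//; rewrite s0 (le_trans _ tT)// (le_trans sv vt).
- by rewrite vE pcomp_refl//; rewrite (le_trans s0 (le_trans sv vt)).
Qed.

Lemma pcomp_empty P s t : 0 <= s -> s <= t -> t <= T ->
  (forall q, q \in P -> ~ (s < q < t)) -> pcomp P s t = m s t.
Proof.
move=> s0 st tT; have sT : 0 <= s <= T by rewrite s0 (le_trans st).
have tT' : 0 <= t <= T by rewrite (le_trans s0 st).
elim: P => //= u P IH H.
have HP q : q \in P -> ~ (s < q < t) by move=> qP; apply: H; rewrite inE qP orbT.
case: ifP => [/andP[su ut]|_]; last exact: IH.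
have := H u (mem_head _ _); move: su ut; rewrite !le_eqVlt.
move=> /predU1P[<- _ _|su /predU1P[->|ut]]; last by rewrite su ut.
  by rewrite pcomp_refl// IH.
by move=> _; rewrite pcomp_refl// IH.
Qed.

End Partitions.

(** * Estimates on compositions along a partition, uniform in the partition *)

Section Sewing.
Context (R : realType) (E : normedModType R).
Implicit Types (m : R -> R -> E -> E) (P Q : seq R) (s t u : R).

Definition approx (A B : E -> E) (al al' : R) :=
  (forall x, `|A x - B x| <= al) /\
  (forall x y, `|A x - B x - (A y - B y)| <= al' * `|x - y|).

Record almost_flow (T delta eps C a : R) m : Prop := AlmostFlow {
  almost_flow_refl : forall t, 0 <= t <= T -> m t t = id;
  almost_flow_lip : forall s t, 0 <= s -> s <= t -> t <= T -> t - s <= delta ->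
    forall x y, `|m s t x - m s t y| <= (1 + eps) * `|x - y|;
  almost_flow_comp : forall s u t, 0 <= s -> s <= u -> u <= t -> t <= T -> t - s <= delta ->
    approx (m u t \o m s u) (m s t) (C * (t - s) `^ a) (C * (t - s) `^ a);
  almost_flow_four : forall s t, 0 <= s -> s <= t -> t <= T -> t - s <= delta ->
    forall x y x' y', `|m s t x - m s t y - (m s t x' - m s t y')| <=
      (1 + eps) * `|x - y - (x' - y')| + C * (`|x - x'| + `|y - y'|) * `|x' - y'| }.

Lemma approx_refl (A : E -> E) (al al' : R) : 0 <= al -> 0 <= al' -> approx A A al al'.
Proof. by move=> ? ?; split=> [x|x y]; rewrite !subrr ?subr0 normr0// mulr_ge0. Qed.

Lemma approxW (A B : E -> E) (al al' be be' : R) : al <= be -> al' <= be' ->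
  approx A B al al' -> approx A B be be'.
Proof.
move=> ab ab' [H H']; split=> [x|x y]; first exact: le_trans (H x) ab.
by apply: le_trans (H' x y) _; rewrite ler_wpM2r.
Qed.

Let sewing_const (p c e X : R) : 0 <= p -> 0 <= c -> 0 < e -> e <= 1 / 2 ->
  p * (2 + 5 * e) + 3 * c <= X -> p + (1 + e) * ((1 + e) * p + c) + c <= X.
Proof.
move=> p0 c0 e0 e12 H; have e3 : 0 <= 3 - e by lra.
have e1 : 0 <= 1 - e by lra.
have := mulr_ge0 (mulr_ge0 p0 (ltW e0)) e3; have := mulr_ge0 c0 e1; lra.
Qed.

Section Bounds.
Context (T delta eps C a : R) (m : R -> R -> E -> E).
Hypotheses (eps0 : 0 < eps) (C0 : 0 <= C).
Hypothesis mP : almost_flow T delta eps C a m.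

(** B o A is compared with m_ut o A, then with m_ut o m_su, then with m_st. The Lipschitz part of
    the second comparison is a difference of four values of m_ut, whence the four-point property; it
    brings in the uniform error [al]. *)
Lemma approx_comp (A B : E -> E) s u t (al al' be be' : R) :
  0 <= s -> s <= u -> u <= t -> t <= T -> t - s <= delta -> 0 <= al -> 0 <= be' ->
  approx A (m s u) al al' -> approx B (m u t) be be' ->
  approx (B \o A) (m s t) (be + (1 + eps) * al + C * (t - s) `^ a)
    (be' * (1 + eps + al') + (1 + eps) * al' + 2 * C * (1 + eps) * al + C * (t - s) `^ a).
Proof.
move=> s0 su ut tT td al0 be0 [HA HA'] [HB HB'].
have ust : u - s <= delta by apply: le_trans td; rewrite lerD2r.
have utd : t - u <= delta by apply: le_trans td; rewrite lerD2l lerN2.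
have uT : u <= T := le_trans ut tT.
have u0 : 0 <= u := le_trans s0 su.
have [H2 H3] := almost_flow_comp mP s0 su ut tT td.
have lip1 := almost_flow_lip mP s0 su uT ust.
have lip2 := almost_flow_lip mP u0 ut tT utd.
have e1 : 0 <= 1 + eps by rewrite addr_ge0// ltW.
split=> [x|x y] /=.
  have -> : B (A x) - m s t x = (B (A x) - m u t (A x)) + (m u t (A x) - m u t (m s u x)) +
     (m u t (m s u x) - m s t x) by lmod.
  rewrite (le_trans (ler_normD _ _))// lerD//; last exact: H2.
  rewrite (le_trans (ler_normD _ _))// lerD//.
  by rewrite (le_trans (lip2 _ _))// ler_wpM2l.
have Alip : `|A x - A y| <= (1 + eps + al') * `|x - y|.
  have -> : A x - A y = (m s u x - m s u y) + (A x - m s u x - (A y - m s u y)) by lmod.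
  by rewrite (le_trans (ler_normD _ _))// mulrDl lerD.
have -> : B (A x) - m s t x - (B (A y) - m s t y) =
  (B (A x) - m u t (A x) - (B (A y) - m u t (A y)))
  + (m u t (A x) - m u t (A y) - (m u t (m s u x) - m u t (m s u y)))
  + ((m u t (m s u x) - m s t x) - (m u t (m s u y) - m s t y)) by lmod.
rewrite (le_trans (ler_normD _ _))// mulrDl lerD//; last exact: H3.
rewrite (le_trans (ler_normD _ _))// -(addrA (be' * _)) mulrDl lerD//.
  by rewrite (le_trans (HB' _ _))// -mulrA ler_wpM2l.
apply: le_trans (almost_flow_four mP u0 ut tT utd _ _ _ _) _.
rewrite [leRHS]mulrDl lerD//.
  have -> : A x - A y - (m s u x - m s u y) = A x - m s u x - (A y - m s u y) by lmod.
  by rewrite -mulrA ler_wpM2l.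
have -> : 2 * C * (1 + eps) * al * `|x - y| = C * (al + al) * ((1 + eps) * `|x - y|) by ring.
apply: ler_pM => //; first by rewrite mulr_ge0// addr_ge0.
by rewrite ler_wpM2l// lerD.
Qed.

Context (th K K' : R).
Hypotheses (eps12 : eps <= 1 / 2) (a1 : 1 < a) (thE : th = 2^-1 `^ a).
Hypotheses (K0 : 0 <= K) (K'0 : 0 <= K').
(** Closing conditions of the induction on partitions. Each half contributes th = 2^-a times a
    Lipschitz factor; in the worse case, that of Lipschitz constants, (1 + 2 eps) + (1 + eps)^2 <= 2
    + 5 eps. The conditions can be solved when th (2 + 5 eps) < 1. *)
Hypothesis KE : K * (th * (2 + 5 * eps)) + 3 * C <= K.
Hypothesis K'E : K' * (th * (2 + 5 * eps)) +
  (2 * (4 * C * K + C) + 4 * C * (2 * K + C) + C) <= K'.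
Hypothesis deltaE : delta `^ a * (2 * K' + 4 * C * K + C) <= eps.
Hypothesis delta0 : 0 <= delta.

Let th0 : 0 <= th. Proof. by rewrite thE powR_ge0. Qed.
Let th1 : th <= 1.
Proof.
have a1' := a1; suff : 2^-1 `^ a <= 1 `^ a by rewrite powR1 thE.
by rewrite ge0_ler_powR ?nnegrE//; lra.
Qed.

Lemma pow_half (x y : R) : 0 <= x -> x <= y / 2 -> x `^ a <= th * y `^ a.
Proof.
move=> x0 xy; have y0 : 0 <= y by lra.
have a1' := a1; rewrite thE -powRM ?invr_ge0// mulrC ge0_ler_powR ?nnegrE//; lra.
Qed.

Lemma pow_delta s t : s <= t -> t - s <= delta -> (t - s) `^ a * (2 * K' + 4 * C * K + C) <= eps.
Proof.
move=> st td; apply: le_trans deltaE; rewrite ler_wpM2r//.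
  by rewrite !addr_ge0// !mulr_ge0.
by have a1' := a1; rewrite ge0_ler_powR ?nnegrE ?subr_ge0//; lra.
Qed.

(** Induction on the number of interior points. The interval is cut at the points of P on either
    side of its midpoint: the outer parts have at most half the length, so their errors carry the
    factor th, and the two junctions add multiples of C (t - s)^a. *)
Lemma pcomp_approx P s t : 0 <= s -> s <= t -> t <= T -> t - s <= delta ->
  approx (pcomp m P s t) (m s t) (K * (t - s) `^ a) (K' * (t - s) `^ a).
Proof.
move: (eps0) (eps12) (a1) (delta0) (C0) (K0) (K'0) => e0 e12 a1' d0 c0 k0 k'0.
have mr := almost_flow_refl mP.
move: {2}(interior P s t) (leqnn (interior P s t)) => n.
elim: n s t => [|n IH] s t.
  rewrite leqn0 => /eqP i0 s0 st tT td.
  rewrite (pcomp_empty mr s0 st tT (interior0 i0)).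
  by apply: approx_refl; rewrite mulr_ge0// powR_ge0.
move=> iP s0; rewrite le_eqVlt => /predU1P[<-|st] tT td.
  rewrite (pcomp_refl mr) ?s0// mr ?s0//.
  by apply: approx_refl; rewrite mulr_ge0// powR_ge0.
set mid := (s + t) / 2.
have smid : s <= mid by rewrite /mid; lra.
have midt : mid < t by rewrite /mid; lra.
have [v [vP sv vmid Hv]] := sel_left P smid.
have [w [wP midw wt Hw]] := sel_right P midt.
have vw : v <= w := le_trans vmid (ltW midw).
have sw : s <= w := le_trans sv vw.
have vt : v <= t := le_trans vw wt.
have v0 : 0 <= v := le_trans s0 sv. have w0 : 0 <= w := le_trans s0 sw.
have wT : w <= T := le_trans wt tT. have vT : v <= T := le_trans vw wT.
set h := (t - s) `^ a.
have h0 : 0 <= h := powR_ge0 _ _.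
have A1 : approx (pcomp m P s v) (m s v) (K * (th * h)) (K' * (th * h)).
  have [->|vs] := eqVneq v s.
    rewrite (pcomp_refl mr) ?s0 ?(le_trans (ltW st))// mr ?s0 ?(le_trans (ltW st))//.
    by apply: approx_refl; rewrite !mulr_ge0.
  have hh : (v - s) `^ a <= th * h by apply: pow_half; rewrite /mid in vmid; lra.
  have sv' : s < v by rewrite lt_neqAle eq_sym vs.
  have vt' : v < t := le_lt_trans vmid midt.
  apply: approxW (IH s v _ s0 sv vT _); rewrite ?ler_wpM2l//; last by lra.
  case: vP => [vE|vP]; first by rewrite vE eqxx in vs.
  rewrite -ltnS (leq_trans _ iP)// (leq_ltn_trans (leq_addr _ _) (interior_split vP _))//.
  by rewrite sv'.
have A3 : approx (pcomp m P w t) (m w t) (K * (th * h)) (K' * (th * h)).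
  have [wE|wt'] := eqVneq w t.
    rewrite wE (pcomp_refl mr) ?tT ?(le_trans s0 (ltW st))// mr ?tT ?(le_trans s0 (ltW st))//.
    by apply: approx_refl; rewrite !mulr_ge0.
  have hh : (t - w) `^ a <= th * h by apply: pow_half; rewrite /mid in midw; lra.
  have wt2 : w < t by rewrite lt_neqAle wt'.
  have sw' : s < w := le_lt_trans smid midw.
  apply: approxW (IH w t _ w0 wt tT _); rewrite ?ler_wpM2l//; last by lra.
  case: wP => [wE|wP]; first by rewrite wE eqxx in wt'.
  rewrite -ltnS (leq_trans _ iP)// (leq_ltn_trans (leq_addl _ _) (interior_split wP _))//.
  by rewrite sw'.
(* No point of P lies strictly between v and w, so the middle piece is exact. *)
have A2 : pcomp m P v w = m v w.
  apply: (pcomp_empty mr) => // q qP /andP[vq qw].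
  case: (Hv q qP) => [|midq]; first by rewrite leNgt vq.
  by case: (Hw q qP); rewrite leNgt ?midq ?qw.
rewrite (pcomp_split_or mr s0 tT (introT andP (conj sw wt))); last first.
  by case: wP; [constructor 2|constructor 3].
rewrite (pcomp_split_or mr s0 wT (introT andP (conj sv vw))); last first.
  by case: vP; [constructor 1|constructor 3].
rewrite A2.
have ws : (w - s) `^ a <= h.
  by rewrite ge0_ler_powR ?nnegrE ?subr_ge0 ?lerD2r// ?(ltW st)//; lra.
have wsd : w - s <= delta by lra.
have Kth0 : 0 <= K * (th * h) by rewrite !mulr_ge0.
have B1 := approx_comp s0 sv vw wT wsd Kth0 (lexx 0) A1 (approx_refl (m v w) (lexx 0) (lexx 0)).
set al1 := (1 + eps) * (K * (th * h)) + C * h.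
set al1' := (1 + eps) * (K' * (th * h)) + 2 * C * (1 + eps) * (K * (th * h)) + C * h.
have {}B1 : approx (m v w \o pcomp m P s v) (m s w) al1 al1'.
  by apply: approxW B1; rewrite ?mul0r !add0r lerD2l ler_wpM2l.
have al10 : 0 <= al1.
  by rewrite /al1 addr_ge0 ?mulr_ge0// addr_ge0// ltW.
have hd : h * (2 * K' + 4 * C * K + C) <= eps by apply: pow_delta => //; exact: ltW.
have Kh0 : 0 <= K * h by rewrite mulr_ge0.
have K'h0 : 0 <= K' * h by rewrite mulr_ge0.
have Ch0 : 0 <= C * h by rewrite mulr_ge0.
have CKh0 : 0 <= C * (K * h) by rewrite mulr_ge0.
have thK' : K' * (th * h) <= K' * h by rewrite mulrCA ler_piMl.
have thK : K * (th * h) <= K * h by rewrite mulrCA ler_piMl.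
have thK0 : 0 <= K * (th * h) by rewrite !mulr_ge0.
have thK'0 : 0 <= K' * (th * h) by rewrite !mulr_ge0.
have CthK : C * (K * (th * h)) <= C * (K * h) by rewrite ler_wpM2l.
have CthK0 : 0 <= C * (K * (th * h)) by rewrite mulr_ge0.
have al1'b : al1' <= (1 + eps) * (K' * (th * h)) + (4 * C * K + C) * h.
  rewrite /al1'; have : 2 * C * (1 + eps) * (K * (th * h)) <= 4 * (C * (K * h)) by nra.
  by nra.
(* The smallness of delta serves here: the composition over the first two pieces keeps the Lipschitz
   constant 1 + 2 eps. *)
have al1'e : al1' <= eps.
  apply: le_trans al1'b (le_trans _ hd).
  have : (1 + eps) * (K' * (th * h)) <= 2 * (K' * h) by nra.
  nra.
have al1b : al1 <= (2 * K + C) * h by rewrite /al1; nra.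
have B2 := approx_comp s0 sw wt tT td al10 thK'0 B1 A3.
rewrite -/h in B2; apply: approxW B2.
  have : K * h * (th * (2 + 5 * eps)) + 3 * (C * h) <= K * h.
    have := ler_wpM2r h0 KE; rewrite mulrDl; lra.
  have -> : K * h * (th * (2 + 5 * eps)) = K * (th * h) * (2 + 5 * eps) by ring.
  by rewrite /al1; exact: sewing_const.
have K'h : K' * (th * h) * (2 + 5 * eps) +
    (2 * (4 * C * K + C) + 4 * C * (2 * K + C) + C) * h <= K' * h.
  by have := ler_wpM2r h0 K'E; rewrite mulrDl; lra.
have X1 : K' * (th * h) * (1 + eps + al1') <= K' * (th * h) * (1 + 2 * eps).
  by rewrite ler_wpM2l//; lra.
have CC : 0 <= C * C by rewrite mulr_ge0.
have X2 : (1 + eps) * al1' <= (1 + eps) * (1 + eps) * (K' * (th * h)) + 2 * (4 * C * K + C) * h.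
  have CKC : 0 <= (4 * C * K + C) * h by nra.
  have : (1 + eps) * al1' <= (1 + eps) * ((1 + eps) * (K' * (th * h)) + (4 * C * K + C) * h).
    by rewrite ler_wpM2l//; lra.
  by nra.
have X3 : 2 * C * (1 + eps) * al1 <= 4 * C * (2 * K + C) * h.
  have : 2 * C * (1 + eps) <= 4 * C by nra.
  move=> H; apply: le_trans (ler_wpM2r al10 H) _.
  by rewrite -[leRHS]mulrA ler_wpM2l// mulr_ge0.
have X4 : (1 + 2 * eps) + (1 + eps) * (1 + eps) <= 2 + 5 * eps by nra.
by have := ler_wpM2l thK'0 X4; lra.
Qed.

Lemma pcomp_lip2 P s t : 0 <= s -> s <= t -> t <= T -> t - s <= delta ->
  forall x y, `|pcomp m P s t x - pcomp m P s t y| <= 2 * `|x - y|.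
Proof.
move=> s0 st tT td x y; have [_ H] := pcomp_approx P s0 st tT td.
have -> : pcomp m P s t x - pcomp m P s t y =
  (m s t x - m s t y) + (pcomp m P s t x - m s t x - (pcomp m P s t y - m s t y)) by lmod.
have H1 := almost_flow_lip mP s0 st tT td x y.
apply: le_trans (ler_normD _ _) (le_trans (lerD H1 (H x y)) _).
rewrite -mulrDl ler_wpM2r//.
have e12 := eps12; have := pow_delta st td; set h := _ `^ _.
have : 0 <= h := powR_ge0 _ _.
have CK0 : 0 <= C * K by rewrite mulr_ge0.
move=> h0; rewrite !mulrDr.
have : 0 <= h * (4 * C * K) by rewrite !mulr_ge0.
have : 0 <= h * C by rewrite !mulr_ge0.
have : 0 <= K' * h by rewrite !mulr_ge0.
lra.
Qed.

Definition mesh P (eta : R) := forall s t, 0 <= s -> s < t -> t <= T -> eta < t - s ->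
  exists2 g, g \in P & s < g < t.

(** Beyond length delta, the interval is split at points of the fixed coarse list G only, each piece
    having constant 2. The bound thus depends on G and not on P. *)
Lemma pcomp_lip G P s t : mesh G delta -> {subset G <= P} -> 0 <= s -> s <= t -> t <= T ->
  forall x y, `|pcomp m P s t x - pcomp m P s t y| <= 2 ^+ (size G).+1 * `|x - y|.
Proof.
move=> mG GP s0 st tT x y.
apply: (@le_trans _ _ (2 ^+ (interior G s t).+1 * `|x - y|)); last first.
  by rewrite ler_wpM2r// ler_weXn2l ?ler1n// ltnS count_size.
have mr := almost_flow_refl mP.
move: {2}(interior G s t) (leqnn (interior G s t)) => n.
elim: n s t s0 st tT x y => [|n IH] s t s0 st tT x y iG.
  have [td|dt] := leP (t - s) delta.
    apply: le_trans (pcomp_lip2 P s0 st tT td x y) _; rewrite ler_wpM2r//.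
    by rewrite exprS ler_peMr// exprn_ege1// ler1n.
  have sltt : s < t by rewrite -subr_gt0 (le_lt_trans delta0).
  have [g gG sgt] := mG s t s0 sltt tT dt.
  by move: iG; rewrite leqn0 => /eqP/interior0/(_ g gG).
have [td|dt] := leP (t - s) delta.
  apply: le_trans (pcomp_lip2 P s0 st tT td x y) _; rewrite ler_wpM2r//.
  by rewrite exprS ler_peMr// exprn_ege1// ler1n.
have sltt : s < t by rewrite -subr_gt0 (le_lt_trans delta0).
have [g gG sgt] := mG s t s0 sltt tT dt.
have iS := interior_split gG sgt.
case/andP: sgt => sg gt.
rewrite (pcomp_split mr s0 tT (introT andP (conj (ltW sg) (ltW gt))) (GP _ gG)) /=.
apply: le_trans (IH g t _ (ltW gt) tT _ _ _) _; first exact: le_trans s0 (ltW sg).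
  by rewrite -ltnS (leq_trans _ iG)// (leq_ltn_trans _ iS)// leq_addl.
have gT : g <= T := le_trans (ltW gt) tT.
apply: le_trans (ler_wpM2l _ (IH s g s0 (ltW sg) gT _ _ _)) _; first exact: exprn_ge0.
  by rewrite -ltnS (leq_trans _ iG)// (leq_ltn_trans _ iS)// leq_addr.
by rewrite mulrA -exprD ler_wpM2r// ler_weXn2l ?ler1n// addSn addnS ltnS addnC.
Qed.

(** Telescoping over the cells of P: on a cell of length x <= eta the error is K x^a <= K eta^(a-1)
    x, and the rest of the composition amplifies it by a factor uniform in Q. The errors add up to a
    multiple of the total length. *)
Lemma pcomp_refine G P Q eta s t : mesh G delta -> {subset G <= Q} -> {subset P <= Q} ->
  mesh P eta -> 0 <= eta -> eta <= delta -> 0 <= s -> s <= t -> t <= T ->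
  forall x, `|pcomp m Q s t x - pcomp m P s t x| <=
    2 ^+ (size G).+1 * (K * eta `^ (a - 1)) * (t - s).
Proof.
have a1' := a1; have d0 := delta0.
move=> mG GQ PQ mP' eta0 etad; set L := 2 ^+ _ : R.
have L1 : 1 <= L by rewrite exprn_ege1// ler1n.
have mr := almost_flow_refl mP.
have pE (x : R) : 0 <= x -> x `^ a = x `^ (a - 1) * x.
  move=> x0; rewrite -{3}(powRr1 x0) -powRD ?subrK//.
  by rewrite (gt_eqF (lt_trans ltr01 a1')).
have small s' t' x : 0 <= s' -> s' <= t' -> t' <= T -> t' - s' <= eta ->
    `|pcomp m Q s' t' x - m s' t' x| <= (K * eta `^ (a - 1)) * (t' - s').
  move=> s0 st tT te.
  have [H _] := pcomp_approx Q s0 st tT (le_trans te etad).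
  apply: le_trans (H x) _; rewrite pE ?subr_ge0// mulrA ler_wpM2r ?subr_ge0// ler_wpM2l//.
  by rewrite ge0_ler_powR ?nnegrE ?subr_ge0//; lra.
have KE0 : 0 <= K * eta `^ (a - 1) by rewrite mulr_ge0// powR_ge0.
have base s' t' x : 0 <= s' -> s' <= t' -> t' <= T -> (forall q, q \in P -> ~ (s' < q < t')) ->
    `|pcomp m Q s' t' x - pcomp m P s' t' x| <= L * (K * eta `^ (a - 1)) * (t' - s').
  move=> s0 st tT H; rewrite (pcomp_empty mr s0 st tT H).
  have te : t' - s' <= eta.
    rewrite leNgt; apply/negP => te.
    have st' : s' < t' by rewrite -subr_gt0 (le_lt_trans eta0).
    by have [g gP /(H g gP)] := mP' s' t' s0 st' tT te.
  apply: le_trans (small _ _ x s0 st tT te) _.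
  by rewrite ler_wpM2r ?subr_ge0// ler_peMl.
move: {2}(interior P s t) (leqnn (interior P s t)) => n.
elim: n s t => [|n IH] s t.
  by rewrite leqn0 => /eqP/interior0 H s0 st tT x; exact: base.
move=> iP s0; rewrite le_eqVlt => /predU1P[<-|st] tT x.
  by apply: base => // q _ /andP[sq qs]; have := lt_trans sq qs; rewrite ltxx.
(* w is the first point of P after s, so that the composition along P over [s, w] is a single m. *)
have [w [wP sw wt Hw]] := sel_right P st.
have noint q : q \in P -> ~ (s < q < w).
  by move=> /Hw[|] H /andP[sq qw]; move: H; rewrite leNgt ?sq ?qw.
case: wP => [wE|wP]; first by rewrite wE in noint; apply: base => //; exact: ltW.
have [wE|wt'] := eqVneq w t; first by rewrite wE in noint; apply: base => //; exact: ltW.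
have {}wt' : w < t by rewrite lt_neqAle wt'.
have w0 : 0 <= w := le_trans s0 (ltW sw). have wT : w <= T := le_trans wt tT.
have swt : s <= w <= t by rewrite (ltW sw).
rewrite (pcomp_split mr s0 tT swt (PQ _ wP)) (pcomp_split mr s0 tT swt wP) /=.
have B1 := base s w x s0 (ltW sw) wT noint.
rewrite (pcomp_empty mr s0 (ltW sw) wT noint) in B1 *.
have te : w - s <= eta.
  by rewrite leNgt; apply/negP => /(mP' s w s0 sw wT)[g gP /(noint g gP)].
have -> : pcomp m Q w t (pcomp m Q s w x) - pcomp m P w t (m s w x) =
  (pcomp m Q w t (pcomp m Q s w x) - pcomp m Q w t (m s w x)) +
  (pcomp m Q w t (m s w x) - pcomp m P w t (m s w x)) by lmod.
have -> : t - s = (w - s) + (t - w) by ring.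
rewrite mulrDr (le_trans (ler_normD _ _))// lerD//; last first.
  apply: IH => //; rewrite -ltnS (leq_trans _ iP)// (leq_ltn_trans (leq_addl _ _) (interior_split wP _))//.
  by rewrite sw.
apply: le_trans (pcomp_lip mG GQ w0 wt tT _ _) _.
rewrite -[leRHS]mulrA; apply: ler_wpM2l; [exact: le_trans ler01 L1|].
exact: small s0 (ltW sw) wT te.
Qed.

End Bounds.
End Sewing.

(** * Passage to the limit over grids *)

Section SewingTheorem.
Context (R : realType).

Lemma powR_small (b e : R) : 0 < b -> 0 < e -> exists2 d : R, 0 < d &
  forall x, 0 <= x -> x <= d -> x `^ b < e.
Proof.
move=> b0 e0; exists ((e / 2) `^ b^-1) => [|x x0 xd]; first by rewrite powR_gt0// divr_gt0.
apply: (@le_lt_trans _ _ (e / 2)); last by lra.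
have -> : e / 2 = ((e / 2) `^ b^-1) `^ b.
  by rewrite -powRrM mulVf ?gt_eqF// powRr1// divr_ge0// ltW.
by rewrite ge0_ler_powR ?nnegrE ?powR_ge0// ltW.
Qed.

Lemma invn_small (e : R) : 0 < e -> exists n : nat, forall k, (n <= k)%N -> k.+1%:R^-1 <= e.
Proof.
move=> e0; have ei : 0 <= e^-1 by rewrite invr_ge0 ltW.
have ne := archi_boundP ei; exists (Num.bound e^-1) => k nk; rewrite -[leRHS]invrK lef_pV2 ?posrE ?invr_gt0 ?ltr0n//.
by rewrite (le_trans (ltW ne))// ler_nat (leq_trans nk).
Qed.

Lemma cauchy_limit (E : completeNormedModType R) (u : nat -> E) (r : nat -> R) :
  (forall e : R, 0 < e -> exists n, forall k, (n <= k)%N -> r k < e) ->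
  (forall n k, `|u n - u k| <= r n + r k) ->
  exists l, forall n, `|u n - l| <= r n.
Proof.
move=> r0 ur.
have cu : cvg (u @ \oo).
  apply/cauchy_cvgP/cauchy_ballP => e e0; near_simpl.
  have [n nr] := r0 (e / 2) ltac:(by rewrite divr_gt0).
  exists ([set k | (n <= k)%N], [set k | (n <= k)%N]) => /=.
    by split; exists n.
  move=> [i j] [/= ni nj]; rewrite -ball_normE /=.
  apply: le_lt_trans (ur i j) _; have := nr i ni; have := nr j nj; lra.
exists (lim (u @ \oo)) => n; apply/ler_addgt0Pr => e e0.
have /cvgrPdist_lt/(_ (e / 2) ltac:(by rewrite divr_gt0)) [k1 _ H1] : u @ \oo --> lim (u @ \oo) := cu.
have [k2 H2] := r0 (e / 2) ltac:(by rewrite divr_gt0).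
pose k := maxn k1 k2.
have := H1 k (leq_maxl _ _); have := H2 k (leq_maxr _ _) => rk /= uk.
have -> : u n - lim (u @ \oo) = (u n - u k) - (lim (u @ \oo) - u k) by lmod.
apply: le_trans (ler_normB _ _) _; have := ur n k; lra.
Unshelve. all: by end_near. Qed.

Definition grid (T : R) (n : nat) : seq R :=
  [seq k%:R / n.+1%:R | k <- iota 0 (Num.truncn (T * n.+1%:R)).+1].

Lemma mesh_grid T n : mesh T (grid T n) n.+1%:R^-1.
Proof.
move=> s t s0 st tT nst; have n0 : 0 < n.+1%:R :> R by rewrite ltr0n.
pose k := (Num.truncn (s * n.+1%:R)).+1.
have sn0 : 0 <= s * n.+1%:R by rewrite mulr_ge0// ltW.
have /andP[k1 k2] := truncn_itv sn0.
have kt : k%:R / n.+1%:R < t.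
  rewrite ltr_pdivrMr//; move: nst; rewrite -(ltr_pM2r n0) mulVf ?gt_eqF// mulrBl.
  move: k1; rewrite /k -natr1; lra.
exists (k%:R / n.+1%:R); last by rewrite kt andbT ltr_pdivlMr.
apply/mapP; exists k => //; rewrite mem_iota /= add0n ltnS.
rewrite -(natrK (R := R) k) le_truncn// -(ler_pM2r (x := n.+1%:R^-1)) ?invr_gt0// mulfK ?gt_eqF//.
by rewrite ltW// (lt_le_trans kt).
Qed.

Lemma mesh_sub T P Q (eta : R) : {subset P <= Q} -> mesh T P eta -> mesh T Q eta.
Proof.
move=> PQ mP s t s0 st tT st'; have [g gP sgt] := mP s t s0 st tT st'.
by exists g => //; exact: PQ.
Qed.

Lemma sewing (E : completeNormedModType R) (T delta eps C a th K K' : R) (m : R -> R -> E -> E) :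
  0 < eps -> 0 <= C -> almost_flow T delta eps C a m -> eps <= 1 / 2 -> 1 < a ->
  th = 2^-1 `^ a -> 0 <= K -> 0 <= K' -> K * (th * (2 + 5 * eps)) + 3 * C <= K ->
  K' * (th * (2 + 5 * eps)) + (2 * (4 * C * K + C) + 4 * C * (2 * K + C) + C) <= K' ->
  delta `^ a * (2 * K' + 4 * C * K + C) <= eps -> 0 < delta -> 0 <= T ->
  exists phi : R -> R -> E -> E, [/\ flow T phi,
    forall s t, 0 <= s -> s <= t -> t <= T -> t - s <= delta ->
      forall x, `|phi s t x - m s t x| <= K * (t - s) `^ a
   & exists2 L : R, 0 <= L & forall s t, 0 <= s -> s <= t -> t <= T ->
      forall x y, `|phi s t x - phi s t y| <= L * `|x - y| ].
Proof.
move=> eps0 C0 mP eps12 a1 thE K0 K'0 KE K'E deltaE delta0 T0.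
have [n0 Hn0] := invn_small delta0.
(* The coarse grid G is part of every partition, for the sake of [pcomp_lip]. *)
pose G := grid T n0; pose P n := G ++ grid T (n0 + n).
pose eta n : R := (n0 + n).+1%:R^-1.
have eta0 n : 0 <= eta n by rewrite invr_ge0.
have etad n : eta n <= delta by apply: Hn0; rewrite leq_addr.
have mG : mesh T G delta.
  by move=> s t s0 st tT dst; apply: mesh_grid => //; apply: le_lt_trans dst; exact: Hn0.
have mPn n : mesh T (P n) (eta n).
  by apply: mesh_sub (@mesh_grid _ _) => q; rewrite mem_cat orbC => ->.
have [L LE] : exists L : R, 2 ^+ (size G).+1 = L by eexists.
have L0 : 0 <= L by rewrite -LE exprn_ge0.
pose r n := L * (K * eta n `^ (a - 1)) * T.
have r_small e : 0 < e -> exists n, forall k, (n <= k)%N -> r k < e.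
  move=> e0; pose B := L * K * T + 1.
  have B0 : 0 < B by rewrite /B; have := mulr_ge0 (mulr_ge0 L0 K0) T0; lra.
  have [||d d0 dP] := @powR_small (a - 1) (e / B); [by rewrite subr_gt0|by rewrite divr_gt0|].
  have [n Hn] := invn_small d0; exists n => k nk.
  have := dP (eta k) (eta0 k) (Hn _ (leq_trans nk (leq_addl _ _))).
  rewrite ltr_pdivlMr// => /(le_lt_trans _); apply.
  rewrite /r /B mulrDr mulr1 -!mulrA.
  have -> : L * (K * (eta k `^ (a - 1) * T)) = eta k `^ (a - 1) * (L * (K * T)) by ring.
  by rewrite lerDl powR_ge0.
have refine n Q s t : {subset P n <= Q} -> 0 <= s -> s <= t -> t <= T ->
    forall x, `|pcomp m Q s t x - pcomp m (P n) s t x| <= r n.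
  move=> PQ s0 st tT x.
  have GQ : {subset G <= Q} by move=> q qG; apply: PQ; rewrite mem_cat qG.
  apply: le_trans (pcomp_refine eps0 C0 mP eps12 a1 thE K0 K'0 KE K'E deltaE (ltW delta0)
    mG GQ PQ (@mPn n) (eta0 n) (etad n) s0 st tT x) _.
  rewrite LE /r ler_wpM2l//; last by rewrite lerBlDr (le_trans tT)// lerDl.
  by rewrite !mulr_ge0// powR_ge0.
have lim_ex s t x : exists l, 0 <= s -> s <= t -> t <= T ->
    forall n, `|pcomp m (P n) s t x - l| <= r n.
  have [s0|] := boolP (0 <= s); last by exists 0.
  have [st|] := boolP (s <= t); last by exists 0.
  have [tT|] := boolP (t <= T); last by exists 0.
  have [|l Hl] := cauchy_limit (u := fun n => pcomp m (P n) s t x) r_small; last by exists l.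
  move=> n k.
  (* Successive grids need not be nested; two of them are compared through their union. *)
  have H1 : {subset P n <= P n ++ P k} by move=> q qn; rewrite mem_cat qn.
  have H2 : {subset P k <= P n ++ P k} by move=> q qn; rewrite mem_cat qn orbT.
  have -> : pcomp m (P n) s t x - pcomp m (P k) s t x =
    (pcomp m (P n ++ P k) s t x - pcomp m (P k) s t x) -
    (pcomp m (P n ++ P k) s t x - pcomp m (P n) s t x) by lmod.
  apply: le_trans (ler_normB _ _) _; rewrite addrC lerD//; exact: refine.
have [phi phiP] : exists phi : R -> R -> E -> E, forall s t x, 0 <= s -> s <= t -> t <= T ->
    forall n, `|pcomp m (P n) s t x - phi s t x| <= r n.
  pose phi s t x := sval (cid (lim_ex s t x)).
  by exists phi => s t x; exact: svalP (cid (lim_ex s t x)).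
have GP n : {subset G <= P n} by move=> q qG; rewrite mem_cat qG.
have limle (z B c : R) : 0 <= c -> (forall n, z <= B + c * r n) -> z <= B.
  move=> c0 H; apply/ler_addgt0Pr => e e0.
  have [|n Hn] := r_small (e / (c + 1)); first by rewrite divr_gt0// ltr_wpDl.
  apply: le_trans (H n) _; rewrite lerD2l.
  have := Hn n (leqnn n); rewrite ltr_pdivlMr ?ltr_wpDl// => /ltW.
  have rn0 : 0 <= r n by rewrite !mulr_ge0// powR_ge0.
  by apply: le_trans; rewrite mulrDr mulr1 mulrC lerDl.
have mr := almost_flow_refl mP.
exists phi; split.
- split=> [t /[dup] tT /andP[t0 tT'] x|s u t s0 su ut tT x].
    apply/eqP; rewrite -subr_eq0 -normr_le0; apply: (limle _ _ 1) => // n.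
    by have := phiP t t x t0 (lexx t) tT' n; rewrite (pcomp_refl mr)// distrC add0r mul1r.
  have u0 := le_trans s0 su; have uT := le_trans ut tT; have st := le_trans su ut.
  apply/eqP; rewrite -subr_eq0 -normr_le0; apply: (limle _ _ (3 + L)); first by rewrite addr_ge0.
  move=> n; rewrite add0r.
  (* With u at the head of the list, the composition splits at u by computation. *)
  have uP : {subset P n <= u :: P n} by move=> q qn; rewrite inE qn orbT.
  have H1 := refine n _ s t uP s0 st tT x.
  have H2 := phiP s t x s0 st tT n.
  have H3 := phiP u t (phi s u x) u0 ut tT n.
  have H4 := pcomp_lip eps0 C0 mP eps12 a1 thE K0 K'0 KE K'E deltaE (ltW delta0) mG (GP n) u0 ut tT
     (pcomp m (P n) s u x) (phi s u x).
  have H5 := ler_wpM2l L0 (phiP s u x s0 su uT n).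
  move: H1 H4; rewrite LE /= su ut /= => H1 H4.
  have -> : phi s t x - phi u t (phi s u x) =
    - (pcomp m (P n) s t x - phi s t x)
    - (pcomp m (P n) u t (pcomp m (P n) s u x) - pcomp m (P n) s t x)
    + (pcomp m (P n) u t (pcomp m (P n) s u x) - pcomp m (P n) u t (phi s u x))
    + (pcomp m (P n) u t (phi s u x) - phi u t (phi s u x)) by lmod.
  have -> : (3 + L) * r n = r n + r n + L * r n + r n by ring.
  rewrite (le_trans (ler_normD _ _))// lerD// (le_trans (ler_normD _ _))// lerD//.
    by rewrite (le_trans (ler_normB _ _))// normrN lerD.
  exact: le_trans H4 H5.
- move=> s t s0 st tT td x; apply: (limle _ _ 1) => // n; rewrite mul1r.
  have [H1 _] := pcomp_approx eps0 C0 mP eps12 a1 thE K0 K'0 KE K'E deltaE (ltW delta0) (P n) s0 st tT td.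
  have -> : phi s t x - m s t x = (pcomp m (P n) s t x - m s t x) - (pcomp m (P n) s t x - phi s t x) by lmod.
  by rewrite (le_trans (ler_normB _ _))// lerD//; exact: phiP.
exists L => // s t s0 st tT x y; apply: (limle _ _ 2) => // n.
have H4 := pcomp_lip eps0 C0 mP eps12 a1 thE K0 K'0 KE K'E deltaE (ltW delta0) mG (GP n) s0 st tT x y.
rewrite LE in H4.
have -> : phi s t x - phi s t y = (pcomp m (P n) s t x - pcomp m (P n) s t y)
  - ((pcomp m (P n) s t x - phi s t x) - (pcomp m (P n) s t y - phi s t y)) by lmod.
rewrite (le_trans (ler_normB _ _))// lerD// (le_trans (ler_normB _ _))//.
by rewrite mulr_natl mulr2n lerD//; exact: phiP.
Qed.

End SewingTheorem.

(** * Time-1 maps *)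

Section Ode.
Context (R : realType).

(** The order of quantifiers matters: eps, K and the maximal delta depend on a and C only, so they
    serve all almost flows with these constants. *)
Lemma sewing_const_exists (a C : R) : 1 < a -> 0 <= C ->
  exists eps K delta0 : R, [/\ 0 < eps, 0 <= K, 0 < delta0 &
  forall (E : completeNormedModType R) (T delta : R) (m : R -> R -> E -> E),
    0 < delta -> delta <= delta0 -> 0 <= T -> almost_flow T delta eps C a m ->
  exists phi : R -> R -> E -> E, [/\ flow T phi,
    forall s t, 0 <= s -> s <= t -> t <= T -> t - s <= delta ->
      forall x, `|phi s t x - m s t x| <= K * (t - s) `^ a
   & exists2 L : R, 0 <= L & forall s t, 0 <= s -> s <= t -> t <= T ->
      forall x y, `|phi s t x - phi s t y| <= L * `|x - y| ] ].
Proof.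
move=> a1 C0; pose th : R := 2^-1 `^ a.
have th0 : 0 <= th by exact: powR_ge0.
have th12 : th < 1 / 2.
  have -> : th = 2^-1 `^ (a - 1) * 2^-1.
    rewrite -[X in _ = _ * X]powRr1 ?invr_ge0// -powRD; first by rewrite subrK.
    by rewrite subrK gt_eqF//; lra.
  rewrite div1r gtr_pMl ?invr_gt0//.
  rewrite -[ltRHS](_ : 1 `^ (a - 1) = 1); last by rewrite powR1.
  by apply: gt0_ltr_powR; rewrite ?nnegrE ?subr_gt0//; lra.
(* With this choice 1 - th (2 + 5 eps) = (1 - th) (1 - 2 th), which is positive as th < 1 / 2. *)
pose eps := (1 - 2 * th) / 5.
have e0 : 0 < eps by rewrite /eps; lra.
have e12 : eps <= 1 / 2 by rewrite /eps; lra.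
pose q := th * (2 + 5 * eps).
have q1 : q < 1 by rewrite /q /eps; nra.
have q1' : 0 < 1 - q by lra.
pose K := 3 * C / (1 - q).
have K0 : 0 <= K by rewrite /K divr_ge0//; lra.
have KE : K * q + 3 * C <= K.
  have : K * (1 - q) = 3 * C by rewrite /K divfK// gt_eqF.
  lra.
pose M := 2 * (4 * C * K + C) + 4 * C * (2 * K + C) + C.
have CK : 0 <= C * K by rewrite mulr_ge0.
have CC : 0 <= C * C by rewrite mulr_ge0.
have M0 : 0 <= M by rewrite /M; nra.
pose K' := M / (1 - q).
have K'0 : 0 <= K' by rewrite /K' divr_ge0//; lra.
have K'E : K' * q + M <= K'.
  have : K' * (1 - q) = M by rewrite /K' divfK// gt_eqF.
  lra.
pose B := 2 * K' + 4 * C * K + C.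
have B0 : 0 <= B by rewrite /B; nra.
have [||d d0 dP] := @powR_small R a (eps / (B + 1)); [by lra|by rewrite divr_gt0//; lra|].
exists eps, K, d; split=> // E T delta m delta0 deltad T0 mP.
apply: (sewing e0 C0 mP e12 a1 (erefl th) K0 K'0 KE K'E) => //.
have := dP delta (ltW delta0) deltad; rewrite ltr_pdivlMr; last by lra.
by rewrite mulrDr mulr1 -/B; have := powR_ge0 delta a; lra.
Qed.

(** What sewing and Gronwall use of a field with two bounded derivatives, in a form without
    derivatives; the same K bounds all three conditions. *)
Definition tame (E : normedModType R) (K : R) (V : E -> E) :=
  [/\ forall x, `|V x| <= K, forall x y, `|V x - V y| <= K * `|x - y|
    & forall a b a' b', `|V a - V b - V a' + V b'| <=
        K * `|a - b - a' + b'| + K * (`|a - a'| + `|b - b'|) * `|a' - b'| ].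

(** The defect (t - u) (V (x + (u - s) V x) - V x) of the Euler scheme is quadratic in t - s, hence
    the exponent 2. In the constant, K^2 (3 + K) bounds this defect and K comes from the four-point
    property of V. *)
Lemma euler_almost_flow (E : normedModType R) (V : E -> E) (K eps delta : R) :
  tame K V -> 0 <= K -> 0 < eps -> delta <= 1 -> delta * K <= eps ->
  almost_flow 1 delta eps (K ^+ 2 * (3 + K) + K) 2 (fun s t x => x + (t - s) *: V x).
Proof.
move=> [V0 V1 V2] K0 e0 d1 dK.
have powE (h : R) : 0 <= h -> h `^ 2 = h ^+ 2 by move=> h0; rewrite -powR_mulrn.
have C0 : 0 <= K ^+ 2 * (3 + K) by rewrite mulr_ge0 ?exprn_ge0//; lra.
split=> [t _|s t s0 st t1 td x y|s u t s0 su ut t1 td|s t s0 st t1 td x y x' y'].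
- by apply/funext => x; rewrite subrr scale0r addr0.
- have -> : x + (t - s) *: V x - (y + (t - s) *: V y) = (x - y) + (t - s) *: (V x - V y) by lmod.
  rewrite (le_trans (ler_normD _ _))// mulrDl mul1r lerD// normrZ ger0_norm ?subr_ge0//.
  apply: (@le_trans _ _ ((t - s) * (K * `|x - y|))); first by rewrite ler_wpM2l ?subr_ge0.
  by rewrite mulrA ler_wpM2r// (le_trans _ dK)// ler_wpM2r.
- have tu0 : 0 <= t - u by rewrite subr_ge0.
  have us0 : 0 <= u - s by rewrite subr_ge0.
  rewrite powE ?subr_ge0 ?(le_trans su)//.
  have hh : (t - u) * (u - s) <= (t - s) ^+ 2 by nra.
  have hh0 : 0 <= (t - u) * (u - s) by rewrite mulr_ge0.
  have cE x : ((fun x => x + (t - u) *: V x) \o (fun x => x + (u - s) *: V x)) x - (x + (t - s) *: V x) =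
      (t - u) *: (V (x + (u - s) *: V x) - V x).
    by rewrite /=; lmod.
  split=> [x|x y].
    rewrite cE normrZ ger0_norm// (le_trans (ler_wpM2l tu0 (V1 _ _)))//.
    rewrite addrAC subrr add0r normrZ ger0_norm//.
    have : (t - u) * (K * ((u - s) * `|V x|)) <= ((t - u) * (u - s)) * (K * K).
      have -> : (t - u) * (K * ((u - s) * `|V x|)) = (t - u) * (u - s) * (K * `|V x|) by ring.
      by rewrite ler_wpM2l// ler_wpM2l.
    move/le_trans; apply; rewrite mulrC ler_pM ?mulr_ge0//.
    by have := exprn_ge0 3 K0; rewrite !exprS expr0; nra.
  rewrite !cE -scalerBr normrZ ger0_norm//.
  have -> : V (x + (u - s) *: V x) - V x - (V (y + (u - s) *: V y) - V y) =
    V (x + (u - s) *: V x) - V x - V (y + (u - s) *: V y) + V y by lmod.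
  apply: le_trans (ler_wpM2l tu0 (V2 _ _ _ _)) _.
  have -> : x + (u - s) *: V x - x - (y + (u - s) *: V y) + y = (u - s) *: (V x - V y) by lmod.
  have -> : x + (u - s) *: V x - (y + (u - s) *: V y) = (x - y) + (u - s) *: (V x - V y) by lmod.
  have -> : y + (u - s) *: V y - y = (u - s) *: V y by lmod.
  have H1 : `|(u - s) *: (V x - V y)| <= (u - s) * (K * `|x - y|).
    by rewrite normrZ ger0_norm// ler_wpM2l.
  have H2 : `|(u - s) *: V y| <= (u - s) * K by rewrite normrZ ger0_norm// ler_wpM2l.
  have us1 : u - s <= 1 by lra.
  have H3 : `|x - y + (u - s) *: (V x - V y)| + `|x - y| <= (2 + K) * `|x - y|.
    have := ler_normD (x - y) ((u - s) *: (V x - V y)).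
    have : (u - s) * (K * `|x - y|) <= K * `|x - y| by rewrite ler_piMl ?mulr_ge0.
    by have := normr_ge0 (x - y); lra.
  set N := `|x - y| in H1 H3 *; have N0 : 0 <= N by exact: normr_ge0.
  apply: (@le_trans _ _ ((t - u) * (K * ((u - s) * (K * N)) + K * ((2 + K) * N) * ((u - s) * K)))).
    rewrite ler_wpM2l// lerD ?ler_wpM2l// ler_pM// ?mulr_ge0 ?addr_ge0 ?ler_wpM2l//.
  have -> : (t - u) * (K * ((u - s) * (K * N)) + K * ((2 + K) * N) * ((u - s) * K)) =
     ((t - u) * (u - s)) * (K ^+ 2 * (3 + K) * N) by ring.
  rewrite [leRHS]mulrAC [leRHS]mulrC; apply: ler_pM => //; first exact: mulr_ge0.
  by rewrite ler_wpM2r// lerDl.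
- have ts0 : 0 <= t - s by rewrite subr_ge0.
  have -> : x + (t - s) *: V x - (y + (t - s) *: V y) - (x' + (t - s) *: V x' - (y' + (t - s) *: V y')) =
    (x - y - (x' - y')) + (t - s) *: (V x - V y - V x' + V y') by lmod.
  rewrite (le_trans (ler_normD _ _))// mulrDl mul1r -[leRHS]addrA lerD// normrZ ger0_norm//.
  apply: le_trans (ler_wpM2l ts0 (V2 _ _ _ _)) _; rewrite mulrDr lerD//.
    have -> : x - y - x' + y' = x - y - (x' - y') by lmod.
    by rewrite mulrA ler_wpM2r// (le_trans _ dK)// ler_wpM2r.
  apply: (@le_trans _ _ (K * (`|x - x'| + `|y - y'|) * `|x' - y'|)).
    by rewrite ler_piMl ?mulr_ge0 ?addr_ge0//; lra.
  by rewrite ler_wpM2r// ler_wpM2r ?addr_ge0// lerDr.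
Qed.

Section Solutions.
Context (E : completeNormedModType R).
Implicit Types (V W : E -> E).

(** The sewn Euler scheme, started at x at time 0, solves the equation: its increments differ from
    (v - u) V (y u) by O((v - u)^2). *)
Lemma ode_exists V (K : R) x : tame K V -> 0 <= K -> exists y, ode_path V x y.
Proof.
move=> tV K0; have [V0 V1 _] := tV.
have C0 : 0 <= K ^+ 2 * (3 + K) + K by rewrite addr_ge0// mulr_ge0 ?exprn_ge0//; lra.
have [eps [K1 [d0 [e0 K10 d00 H]]]] := @sewing_const_exists 2 _ ltac:(lra) C0.
have [delta [delta0 dd0 d1 dK]] : exists delta : R,
    [/\ 0 < delta, delta <= d0, delta <= 1 & delta * K <= eps].
  exists (Order.min d0 (Order.min 1 (eps / (K + 1)))); split.
  - by rewrite !lt_min d00 ltr01 divr_gt0//; lra.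
  - by rewrite ge_min lexx.
  - by rewrite !ge_min lexx orbT.
  set d := Order.min _ _; have : d <= eps / (K + 1) by rewrite !ge_min lexx !orbT.
  have : 0 <= d by rewrite !le_min (ltW d00) ler01 divr_ge0 ?(ltW e0)//; lra.
  by rewrite ler_pdivlMr; [nra|lra].
have [phi [[phi_id phi_flow] phi_near _]] :=
  H E 1 delta _ delta0 dd0 ler01 (euler_almost_flow tV K0 e0 d1 dK).
pose y u := phi 0 u x.
have powE (h : R) : 0 <= h -> h `^ 2 = h ^+ 2 by move=> h0; rewrite -powR_mulrn.
have near1 u v : 0 <= u -> u <= v -> v <= 1 -> v - u <= delta ->
    `|y v - y u - (v - u) *: V (y u)| <= K1 * (v - u) ^+ 2.
  move=> u0 uv v1 uvd; rewrite /y (phi_flow 0 u v (lexx 0) u0 uv v1) /=.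
  have := phi_near u v u0 uv v1 uvd (phi 0 u x); rewrite powE ?subr_ge0//.
  by rewrite opprD addrA.
have lip1 u v : 0 <= u -> u <= v -> v <= 1 -> v - u <= delta ->
    `|y v - y u| <= (K + K1) * (v - u).
  move=> u0 uv v1 uvd; have H1 := near1 u v u0 uv v1 uvd.
  have -> : y v - y u = (y v - y u - (v - u) *: V (y u)) + (v - u) *: V (y u) by lmod.
  have vu0 : 0 <= v - u by rewrite subr_ge0.
  have H2 : `|(v - u) *: V (y u)| <= K * (v - u).
    by rewrite normrZ ger0_norm// mulrC ler_wpM2r.
  have H3 : K1 * (v - u) ^+ 2 <= K1 * (v - u).
    by rewrite ler_wpM2l// expr2 ler_piMl//; lra.
  by rewrite (le_trans (ler_normD _ _))//; lra.
have lip u v : 0 <= u <= 1 -> 0 <= v <= 1 -> `|v - u| <= delta ->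
    `|y v - y u| <= (K + K1) * `|v - u|.
  move=> /andP[u0 u1] /andP[v0 v1]; have [uv|vu] := leP u v.
    by rewrite ger0_norm ?subr_ge0//; exact: lip1.
  rewrite (distrC v u) (distrC (y v) (y u)).
  by rewrite ger0_norm ?subr_ge0 ?(ltW vu)// => uvd; apply: lip1 => //; exact: ltW.
pose C := K1 + K * (K + K1).
have C1 : 0 <= C by rewrite addr_ge0 ?mulr_ge0 ?addr_ge0.
(* For v < u the expansion is made at v, and V (y v) is then replaced by V (y u) at the cost K (K +
   K1) |v - u|^2. *)
have der u v : 0 <= u <= 1 -> 0 <= v <= 1 -> `|v - u| <= delta ->
    `|y v - y u - (v - u) *: V (y u)| <= C * `|v - u| * `|v - u|.
  move=> /andP[u0 u1] /andP[v0 v1] vud.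
  have KK : 0 <= K * (K + K1) by rewrite mulr_ge0 ?addr_ge0.
  have [uv|vu] := leP u v.
    have vu0 : 0 <= v - u by rewrite subr_ge0.
    move: vud; rewrite ger0_norm// => vud.
    rewrite (le_trans (near1 u v u0 uv v1 vud))// expr2 mulrA ler_wpM2r// ler_wpM2r//.
    by rewrite lerDl.
  have uv0 : 0 <= u - v by rewrite subr_ge0 ltW.
  have nE : `|v - u| = u - v by rewrite distrC ger0_norm.
  rewrite nE in vud *.
  have H1 := near1 v u v0 (ltW vu) u1 vud.
  have H2 := lip1 v u v0 (ltW vu) u1 vud.
  have -> : y v - y u - (v - u) *: V (y u) =
    - (y u - y v - (u - v) *: V (y v)) + (u - v) *: (V (y u) - V (y v)) by lmod.
  rewrite (le_trans (ler_normD _ _))// normrN /C mulrDl mulrDl lerD//.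
    by rewrite -mulrA -expr2.
  rewrite normrZ ger0_norm// mulrC ler_wpM2r// -mulrA.
  by rewrite (le_trans (V1 _ _))// ler_wpM2l.
exists y; split; first by rewrite /y phi_id// lexx ler01.
  apply/within_continuous_eps => u u01 e e00.
  exists (Order.min delta (e / (K + K1 + 1))).
    by rewrite lt_min delta0 divr_gt0//; lra.
  move=> v v01; rewrite lt_min => /andP[/ltW vd ve].
  apply: le_lt_trans (lip u v u01 v01 vd) _.
  move: ve; rewrite ltr_pdivlMr; last by lra.
  by have := normr_ge0 (v - u); nra.
move=> u /andP[u0 u1]; apply/is_derive_eps => e e00.
pose r := Order.min (Order.min u (1 - u)) (Order.min delta (e / (C + 1))).
exists r; first by rewrite !lt_min u0 subr_gt0 u1 delta0 divr_gt0//; lra.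
move=> v; rewrite !lt_min => /andP[/andP[vu v1u] /andP[/ltW vd ve]].
have v01 : 0 <= v <= 1.
  by move: vu v1u; rewrite !ltr_norml => /andP[? ?] /andP[? ?]; apply/andP; split; lra.
have u01 : 0 <= u <= 1 by rewrite !ltW.
apply: le_trans (der u v u01 v01 vd) _; rewrite ler_wpM2r//.
move: ve; rewrite ltr_pdivlMr; last by lra.
by have := normr_ge0 (v - u); nra.
Qed.

Lemma ode_path_norm V W x x' y z (K B : R) : 0 <= K -> 0 <= B ->
  ode_path V x y -> ode_path W x' z ->
  (forall u, 0 < u < 1 -> `|V (y u) - W (z u)| <= K * `|y u - z u| + B) ->
  (forall u, 0 <= u <= 1 -> `|y u - z u| <= 2 * expR (2 * K) * (`|x - x'| + B)) /\
  `|y 1 - z 1 - (x - x')| <= K * (2 * expR (2 * K) * (`|x - x'| + B)) + B.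
Proof.
move=> K0 B0 [y0 cy dy] [z0 cz dz] VW.
pose d : R -> E := (y : R -> E) - z.
have cd : {within `[0, 1], continuous d}.
  by move=> u; apply: cvgB; [exact: cy|exact: cz].
have dd (u : R) : 0 < u < 1 -> is_derive u (1 : R) d (V (y u) - W (z u)).
  by move=> u01; have := dy u u01; have := dz u u01 => ? ?; exact: is_deriveB.
have d0 : `|x - x'| = `|d 0| by rewrite /d !fctE y0 z0.
rewrite d0; split=> [u u01|]; first by have := gronwall K0 B0 cd dd VW u01.
have := gronwall_increment K0 B0 cd dd VW.
by rewrite {1 2}/d !fctE y0 z0.
Qed.

Lemma time1_map_exists V (K : R) : tame K V -> 0 <= K -> exists m, time1_map V m.
Proof.
move=> tV K0; have [_ V1 _] := tV.
have V1' u v : `|V u - V v| <= K * `|u - v| + 0 by rewrite addr0.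
have [Y HY] : exists Y : E -> R -> E, forall x, ode_path V x (Y x).
  exists (fun x => sval (cid (ode_exists x tV K0))) => x.
  exact: svalP (cid (ode_exists x tV K0)).
exists (fun x => Y x 1) => x z; split=> [<-|[y yP <-]]; first by exists (Y x).
have [_] := ode_path_norm K0 (lexx 0) (HY x) yP
  (fun u _ => V1' _ _).
rewrite !subrr normr0 add0r !mulr0 addr0 subr0 normr_le0 subr_eq0.
by move/eqP.
Qed.

Lemma time1_map_path V m x : time1_map V m -> exists2 y, ode_path V x y & y 1 = m x.
Proof. by move=> /(_ x (m x))[+ _]; apply. Qed.

Lemma time1_map_unique V m m' : time1_map V m -> time1_map V m' -> m = m'.
Proof. by move=> mP m'P; apply/funext => x; apply/mP; exact: time1_map_path. Qed.

Lemma time1_map_zero V m : (forall x, V x = 0) -> time1_map V m -> m = id.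
Proof.
move=> V0 mP; apply/funext => x; apply/mP; exists (cst x) => //; split=> //.
  by apply: continuous_subspaceT => u; exact: cvg_cst.
by move=> u _; rewrite V0; exact: is_derive_cst.
Qed.

Lemma ode_path_reverse V x y : ode_path V x y -> ode_path (fun z => - V z) (y 1) (fun u => y (1 - u)).
Proof.
move=> [y0 /within_continuous_eps cy dy]; split; first by rewrite subr0.
  apply/within_continuous_eps => u /andP[u0 u1] e e0.
  have [|d d0 dP] := cy (1 - u) _ e e0; first by apply/andP; split; lra.
  exists d => // v /andP[v0 v1] vd; apply: dP; first by apply/andP; split; lra.
  by rewrite (_ : 1 - v - (1 - u) = - (v - u)) ?normrN//; ring.
move=> u /andP[u0 u1]; apply/is_derive_eps => e e0.
have /is_derive_eps/(_ e e0)[r r0 rP] : is_derive (1 - u) (1 : R) y (V (y (1 - u))).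
  by apply: dy; apply/andP; split; lra.
exists r => // v vr.
have E1 : 1 - v - (1 - u) = - (v - u) by ring.
have := rP (1 - v); rewrite E1 normrN => /(_ vr).
by rewrite scaleNr scalerN.
Qed.

Lemma time1_map_reverse V m m' : time1_map V m -> time1_map (fun z => - V z) m' ->
  forall x, m' (m x) = x.
Proof.
move=> mP m'P x; apply/m'P; have [y yP <-] := time1_map_path x mP.
by exists (fun u => y (1 - u)); [exact: ode_path_reverse yP|case: yP => ? _ _; rewrite subrr].
Qed.

(** Gronwall for the alternating sum of four solutions: the four-point property of V gives a linear
    term and a source [B], which is bounded by the distances between pairs of solutions. *)
Lemma time1_map_four V m (K : R) : tame K V -> 0 <= K -> time1_map V m ->
  let c := 2 * expR (2 * K) in
  (forall x y, `|m x - m y| <= (1 + K * c) * `|x - y|) /\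
  (forall x y x' y', `|m x - m y - (m x' - m y')| <=
     (1 + K * c) * `|x - y - (x' - y')| +
     (K * c + 1) * K * c * c * (`|x - x'| + `|y - y'|) * `|x' - y'|).
Proof.
move=> [V0 V1 V2] K0 mP c.
have c0 : 0 <= c by rewrite mulr_ge0// expR_ge0.
have V1' u v : `|V u - V v| <= K * `|u - v| + 0 by rewrite addr0.
have pair x x' y y' : ode_path V x y -> ode_path V x' y' ->
    (forall u, 0 <= u <= 1 -> `|y u - y' u| <= c * `|x - x'|) /\
    `|y 1 - y' 1 - (x - x')| <= K * (c * `|x - x'|).
  move=> yP y'P; have := ode_path_norm K0 (lexx 0) yP y'P
    (fun u _ => V1' _ _).
  by rewrite !addr0.
split=> [x x'|x1 x2 x3 x4].
  have [y yP <-] := time1_map_path x mP; have [y' y'P <-] := time1_map_path x' mP.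
  have [_ H] := pair _ _ _ _ yP y'P.
  have -> : y 1 - y' 1 = (x - x') + (y 1 - y' 1 - (x - x')) by lmod.
  by rewrite (le_trans (ler_normD _ _))// mulrDl mul1r lerD2l -mulrA.
have [y1 P1 <-] := time1_map_path x1 mP; have [y2 P2 <-] := time1_map_path x2 mP.
have [y3 P3 <-] := time1_map_path x3 mP; have [y4 P4 <-] := time1_map_path x4 mP.
have [H13 _] := pair _ _ _ _ P1 P3; have [H24 _] := pair _ _ _ _ P2 P4.
have [H34 _] := pair _ _ _ _ P3 P4.
pose B := K * (c * `|x1 - x3| + c * `|x2 - x4|) * (c * `|x3 - x4|).
have B0 : 0 <= B by rewrite !mulr_ge0 ?addr_ge0 ?mulr_ge0.
pose d : R -> E := ((y1 : R -> E) - y2) - ((y3 : R -> E) - y4).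
have [i1 c1 d1] := P1; have [i2 c2 d2] := P2; have [i3 c3 d3] := P3; have [i4 c4 d4] := P4.
have cd : {within `[0, 1], continuous d}.
  move=> u; apply: cvgB; apply: cvgB.
  - exact: c1.
  - exact: c2.
  - exact: c3.
  - exact: c4.
have dd (u : R) : 0 < u < 1 -> is_derive u (1 : R) d (V (y1 u) - V (y2 u) - (V (y3 u) - V (y4 u))).
  move=> u01; have := d1 u u01; have := d2 u u01; have := d3 u u01; have := d4 u u01 => ? ? ? ?.
  by apply: is_deriveB.
have dK (u : R) : 0 < u < 1 -> `|V (y1 u) - V (y2 u) - (V (y3 u) - V (y4 u))| <= K * `|d u| + B.
  move=> /andP[/ltW u0 /ltW u1]; have u01 : 0 <= u <= 1 by rewrite u0.
  have -> : V (y1 u) - V (y2 u) - (V (y3 u) - V (y4 u)) =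
    V (y1 u) - V (y2 u) - V (y3 u) + V (y4 u) by lmod.
  apply: le_trans (V2 _ _ _ _) _.
  have -> : y1 u - y2 u - y3 u + y4 u = d u by rewrite /d !fctE; lmod.
  rewrite lerD2l /B ler_pM ?mulr_ge0 ?addr_ge0//; last exact: H34.
  by rewrite ler_wpM2l// lerD; [|exact: H13|exact: H24].
have := gronwall_increment K0 B0 cd dd dK.
have dE1 : d 1 = y1 1 - y2 1 - (y3 1 - y4 1) by rewrite /d !fctE.
have dE0 : d 0 = x1 - x2 - (x3 - x4) by rewrite /d !fctE i1 i2 i3 i4.
rewrite dE1 dE0 -/c; set D1 := y1 1 - y2 1 - _; set D0 := x1 - x2 - _ => H.
have -> : D1 = D0 + (D1 - D0) by lmod.
rewrite (le_trans (ler_normD _ _))//.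
have -> : (1 + K * c) * `|D0| + (K * c + 1) * K * c * c * (`|x1 - x3| + `|x2 - x4|) * `|x3 - x4| =
  `|D0| + (K * (c * (`|D0| + B)) + B) by rewrite /B; ring.
by rewrite lerD2l.
Qed.

Lemma time1_map_dep V W m m' (K r : R) : tame K V -> 0 <= K -> 0 <= r ->
  (forall x, `|V x - W x| <= r) -> time1_map V m -> time1_map W m' ->
  forall x, `|m x - m' x| <= 2 * expR (2 * K) * r.
Proof.
move=> [_ V1 _] K0 r0 VW mP m'P x.
have [y yP <-] := time1_map_path x mP; have [z zP <-] := time1_map_path x m'P.
have [|+ _] := ode_path_norm K0 r0 yP zP.
  move=> u _; have -> : V (y u) - W (z u) = (V (y u) - V (z u)) + (V (z u) - W (z u)) by lmod.
  by rewrite (le_trans (ler_normD _ _))// lerD.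
by move=> /(_ 1); rewrite subrr normr0 add0r ler01 lexx; apply.
Qed.

End Solutions.
End Ode.

(** * Taylor expansion along time-1 maps *)

Section BoundedLipschitz.
Context (R : realType) (E : normedModType R).
Implicit Types (f g : E -> E) (c d : R).

Definition bounded_lipschitz c f :=
  (forall x, `|f x| <= c) /\ (forall x y, `|f x - f y| <= c * `|x - y|).

Lemma bounded_lipschitzW c d f : c <= d -> bounded_lipschitz c f -> bounded_lipschitz d f.
Proof.
move=> cd [H H']; split=> [x|x y]; first exact: le_trans (H x) cd.
by apply: le_trans (H' x y) _; rewrite ler_wpM2r.
Qed.

Lemma bounded_lipschitzD c d f g : bounded_lipschitz c f -> bounded_lipschitz d g ->
  bounded_lipschitz (c + d) (fun x => f x + g x).
Proof.
move=> [F F'] [G G']; split=> [x|x y]; first by rewrite (le_trans (ler_normD _ _))// lerD.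
have -> : f x + g x - (f y + g y) = (f x - f y) + (g x - g y) by lmod.
by rewrite (le_trans (ler_normD _ _))// mulrDl lerD.
Qed.

Lemma bounded_lipschitzZ k c f : bounded_lipschitz c f ->
  bounded_lipschitz (`|k| * c) (fun x => k *: f x).
Proof.
move=> [F F']; split=> [x|x y]; first by rewrite normrZ ler_wpM2l.
by rewrite -scalerBr normrZ -mulrA ler_wpM2l.
Qed.

Lemma bounded_lipschitzN c f : bounded_lipschitz c f -> bounded_lipschitz c (fun x => - f x).
Proof.
move=> [F F']; split=> [x|x y]; first by rewrite normrN.
by rewrite -opprD normrN.
Qed.

Lemma bounded_lipschitz0 : bounded_lipschitz 0 (fun=> 0).
Proof. by split=> [x|x y]; rewrite ?subrr normr0// mul0r. Qed.

Lemma bounded_lipschitz_sum (I : Type) (s : seq I) (P : pred I) (c : I -> R) (f : I -> E -> E) :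
  (forall i, P i -> bounded_lipschitz (c i) (f i)) ->
  bounded_lipschitz (\sum_(i <- s | P i) c i) (fun x => \sum_(i <- s | P i) f i x).
Proof.
move=> H; elim: s => [|i s IH].
  rewrite big_nil (_ : (fun _ => _) = fun=> 0); first exact: bounded_lipschitz0.
  by apply/funext => x; rewrite big_nil.
have [Pi|Pi] := boolP (P i).
  rewrite big_cons Pi (_ : (fun _ => _) = fun x => f i x + \sum_(j <- s | P j) f j x).
    exact: bounded_lipschitzD (H i Pi) IH.
  by apply/funext => x; rewrite big_cons Pi.
rewrite big_cons (negbTE Pi) (_ : (fun _ => _) = fun x => \sum_(j <- s | P j) f j x)//.
by apply/funext => x; rewrite big_cons (negbTE Pi).
Qed.

Lemma bounded_lipschitz_comp c d f (g : E -> E) : 0 <= c -> 1 <= d -> bounded_lipschitz c f ->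
  (forall x y, `|g x - g y| <= d * `|x - y|) -> bounded_lipschitz (c * d) (f \o g).
Proof.
move=> c0 d1 [F F'] G; split=> [x|x y] /=.
  by rewrite (le_trans (F _))// ler_peMr.
by rewrite (le_trans (F' _ _))// -mulrA ler_wpM2l.
Qed.

Lemma tameW c d f : c <= d -> tame c f -> tame d f.
Proof.
move=> cd [H0 H1 H2]; split=> [x|x y|a b a' b'].
- exact: le_trans (H0 x) cd.
- by rewrite (le_trans (H1 _ _))// ler_wpM2r.
- by rewrite (le_trans (H2 _ _ _ _))// lerD ?ler_wpM2r// addr_ge0.
Qed.

Lemma tame_sumZ (I : Type) (s : seq I) (P : pred I) (k : I -> R) c (f : I -> E -> E) :
  (forall i, P i -> tame c (f i)) ->
  tame (\sum_(i <- s | P i) `|k i| * c) (fun x => \sum_(i <- s | P i) k i *: f i x).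
Proof.
move=> H; elim: s => [|i s [IH0 IH1 IH2]].
  rewrite big_nil; split=> [x|x y|a b a' b']; rewrite !big_nil ?subrr ?addr0 ?subr0 normr0 ?mul0r//.
rewrite big_cons; case: ifP => Pi; last first.
  by split=> [x|x y|a b a' b']; rewrite !big_cons Pi.
have [H0 H1 H2] := H i Pi.
split=> [x|x y|a b a' b']; rewrite !big_cons Pi.
- by rewrite (le_trans (ler_normD _ _))// lerD// normrZ ler_wpM2l.
- set S := \sum_(j <- s | P j) k j *: f j x; set S' := \sum_(j <- s | P j) k j *: f j y.
  have -> : k i *: f i x + S - (k i *: f i y + S') = k i *: (f i x - f i y) + (S - S') by lmod.
  apply: le_trans (ler_normD _ _) _; rewrite [leRHS]mulrDl; apply: lerD (IH1 x y).
  by rewrite normrZ -mulrA ler_wpM2l.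
- have := IH2 a b a' b'.
  move: (\sum_(j <- s | P j) k j *: f j a) (\sum_(j <- s | P j) k j *: f j b)
    (\sum_(j <- s | P j) k j *: f j a') (\sum_(j <- s | P j) k j *: f j b') => Sa Sb Sa' Sb' HS.
  have -> : k i *: f i a + Sa - (k i *: f i b + Sb) - (k i *: f i a' + Sa') + (k i *: f i b' + Sb') =
    k i *: (f i a - f i b - f i a' + f i b') + (Sa - Sb - Sa' + Sb') by lmod.
  rewrite (le_trans (ler_normD _ _))//; apply: le_trans (lerD (lexx _) HS) _.
  rewrite normrZ; have := ler_wpM2l (normr_ge0 (k i)) (H2 a b a' b').
  by rewrite !mulrDl !mulrDr; lra.
Qed.

Lemma Cb2_tame (S : set (E -> E)) : Cb 2 S -> exists2 c, 0 <= c & forall f, S f -> tame c f.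
Proof.
move=> [/equiboundedW[C0 C00 HC0] D2].
have [C1 C10 HC1] := Db1_bound (DbW (isT : (1 <= 2)%N) D2).
have [C2 C20 HC2] := Db2_bound D2.
pose c := C0 + C1 + C2.
exists c => [|f Sf]; first by rewrite !addr_ge0.
have [df f1] := HC1 f Sf.
have f1c x v : `|'d f x v| <= c * `|v|.
  by rewrite (le_trans (f1 x v))// ler_wpM2r// /c; lra.
split.
- by move=> x; rewrite (le_trans (HC0 f Sf x))// /c; lra.
- exact: derivative_lipschitz.
- apply: four_point => //; first exact: Db_set1 D2 Sf.
  move=> x y v; have [_ _ H] := HC2 f Sf v; apply: le_trans (H x y) _.
  by rewrite !ler_wpM2r// /c; lra.
Qed.

Lemma Cb1_bounded_lipschitz (S : set (E -> E)) : Cb 1 S ->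
  exists2 c, 0 <= c & forall f, S f -> bounded_lipschitz c f.
Proof.
move=> [/equiboundedW[C0 C00 HC0] /Db1_lipschitz[C1 C10 HC1]].
exists (C0 + C1) => [|f Sf]; first by rewrite addr_ge0.
split=> [x|x y]; first by rewrite (le_trans (HC0 f Sf x))// lerDl.
by rewrite (le_trans (HC1 f Sf x y))// ler_wpM2r// lerDr.
Qed.

End BoundedLipschitz.

Section PolynomialCurves.
Context (R : realType).

Lemma is_derive_scalel (V : normedModType R) (c : R -> R) (c' u : R) (v : V) : is_derive u (1 : R) c c' ->
  is_derive u (1 : R) (fun s : R => c s *: v) (c' *: v).
Proof.
move=> /is_derive_eps H; apply/is_derive_eps => e e0.
have v0 : 0 < `|v| + 1 by rewrite ltr_wpDl.
have [r r0 rP] := H (e / (`|v| + 1)) ltac:(by rewrite divr_gt0).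
exists r => // s sr.
have -> : c s *: v - c u *: v - (s - u) *: (c' *: v) = (c s - c u - (s - u) *: c') *: v.
  by rewrite -[(s - u) *: c']/((s - u) * c'); lmod.
rewrite normrZ; apply: le_trans (ler_wpM2r (normr_ge0 v) (rP s sr)) _.
rewrite mulrAC ler_wpM2r// mulrAC ler_pdivrMr// ler_wpM2l ?(ltW e0)// lerDl//.
Qed.

Lemma is_derive_bigsum (V : normedModType R) (I : Type) (s : seq I) (P : pred I) (f : I -> R -> V)
  (f' : I -> V) (u : R) :
  (forall i, P i -> is_derive u (1 : R) (f i) (f' i)) ->
  is_derive u (1 : R) (fun t : R => \sum_(i <- s | P i) f i t) (\sum_(i <- s | P i) f' i).
Proof.
move=> H; elim: s => [|i s IH].
  rewrite big_nil (_ : (fun _ => _) = cst 0); first exact: is_derive_cst.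
  by apply/funext => x; rewrite big_nil.
have [Pi|Pi] := boolP (P i).
  rewrite big_cons Pi (_ : (fun _ => _) = f i + (fun t => \sum_(j <- s | P j) f j t)).
    by have := H i Pi => Hi; exact: is_deriveD.
  by apply/funext => x; rewrite big_cons Pi.
rewrite big_cons (negbTE Pi) (_ : (fun _ => _) = fun x => \sum_(j <- s | P j) f j x)//.
by apply/funext => x; rewrite big_cons (negbTE Pi).
Qed.

(** Termwise differentiation gives the product up to its top term, a multiple of a^(N+1) = 0. *)
Lemma is_derive_texp (l N : nat) (a : tensor R l N) (w : N.-bseq 'I_l) (u : R) : low 1 a ->
  is_derive u (1 : R) (fun s : R => texp (s *: a) w) ((texp (u *: a) * a) w).
Proof.
move=> a1.
have texpE (s : R) : texp (s *: a) w = \sum_(n < N.+1) s ^+ n * (n`!%:R^-1 * (a ^+ n) w).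
  rewrite /texp sum_ffunE; apply: eq_bigr => n _.
  by rewrite exprZn !tensor_scaleE mulrCA.
have -> : (fun s : R => texp (s *: a) w) = (fun s => \sum_(n < N.+1) s ^+ n * (n`!%:R^-1 * (a ^+ n) w)).
  by apply/funext => s; rewrite texpE.
have -> : (texp (u *: a) * a) w = \sum_(n < N.+1) (n%:R * u ^+ n.-1) * (n`!%:R^-1 * (a ^+ n) w).
  rewrite [RHS]big_ord_recl mul0r mul0r add0r /texp mulr_suml sum_ffunE big_ord_recr /=.
  rewrite exprZn -!scalerAl -exprSr (low_expr_eq0 a1 (ltnSn N)) !scaler0 [X in _ + X]ffunE addr0.
  apply: eq_bigr => n _; rewrite exprZn -!scalerAl -exprSr !tensor_scaleE /bump /= add1n.
  rewrite -[RHS]/(n.+1%:R * (u ^+ n * (n.+1`!%:R^-1 * (a ^+ n.+1) w)) : R).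
  rewrite factS natrM invfM.
  have n0 : n.+1%:R != 0 :> R by rewrite pnatr_eq0.
  rewrite -[LHS]/(n`!%:R^-1 * (u ^+ n * (a ^+ n.+1) w) : R).
  move: (_ w) => y; rewrite (mulrCA _ (u ^+ n)) [RHS]mulrCA; congr (_ * _).
  have cancel (c d z : R) : c != 0 -> d * z = c * (c^-1 * d * z) by move=> c0; field.
  exact: cancel.
apply: is_derive_bigsum => n _.
have H : is_derive u (1 : R) (fun s : R => s ^+ n) (n%:R * u ^+ n.-1).
  have := is_deriveX n (is_derive_id u (1 : R)).
  rewrite -[_ *: (1 : R)]/(_ * (1 : R)) mulr1.
  by rewrite (_ : id ^+ n = fun s : R => s ^+ n)//; apply/funext => s; rewrite fctE.
exact: (@is_derive_scalel R).
Qed.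

End PolynomialCurves.

(** * Taylor remainders indexed by words *)

Section Taylor.
Context (R : realType) (E : completeNormedModType R) (l N : nat) (F : {linear 'rV[R]_l -> (E -> E)}).
Hypothesis hF : forall v : 'rV[R]_l, Ckb N.+1 (F v).
Local Notation tensor := (tensor R l N).
Local Notation word := (N.-bseq 'I_l).
Local Notation op := (word_op F).
Implicit Types (v : seq 'I_l) (w : word) (Z : tensor).

Let fields : set (E -> E) := [set f | exists2 r, (r < N)%N & word_fields F r.+1 f].

Let Cb_fields : Cb 2 fields.
Proof.
have : forall r, (r < N)%N -> Cb 2 (word_fields F r.+1).
  move=> r rN; apply: CbW (Cb_word_fields hF _); last exact: ltnW (ltnW _).
  by rewrite subSn ?ltnS ?subn_gt0// ltnW.
move=> /Cb_bigcup; apply: Cb_sub => f [r rN fr]; by exists r.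
Qed.

Let fields_op v : (0 < size v <= N)%N -> fields (op v id).
Proof.
case: v => // i v /= wN; exists (size v) => //.
by exists (i :: v).
Qed.

Lemma word_op_differentiable v x : (size v <= N)%N -> differentiable (op v id) x.
Proof.
move=> wN; have [||[d _ _] _] := @Db_word_op R E l N F hF 1 v id; first exact: Db_id.
  by rewrite add1n !ltnS (leq_trans wN).
exact: d.
Qed.

Lemma word_op_tame : exists2 M : R, 0 <= M &
  forall v, (0 < size v <= N)%N -> tame M (op v id).
Proof. by have [M M0 HM] := Cb2_tame Cb_fields; exists M => // v /fields_op/HM. Qed.

(** These are the tail terms of the expansion. The derivative of a field with two bounded
    derivatives along another one has one bounded derivative. The empty v is treated apart, as the
    identity is in no bounded class. *)
Lemma diff_word_op_bounded_lipschitz : exists2 M : R, 0 <= M &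
  forall v (w : seq 'I_l), (size v <= N)%N -> (0 < size w <= N)%N ->
    bounded_lipschitz M (fun x => 'd (op v id) x (op w id x)).
Proof.
have F1 : Cb 1 fields by apply: CbW Cb_fields.
have F2 : Db 2 fields by case: Cb_fields.
have [M M0 HM] := Cb1_bounded_lipschitz (CbU F1 (Cb_apply F2 F1)).
exists M => // v w vN wN; apply: HM.
have [v0|v0] := posnP (size v).
  left; rewrite (size0nil v0) /= (_ : (fun x => _) = op w id); first exact: fields_op.
  by apply/funext => x; rewrite diff_val.
right; exists (op v id), (op w id); split=> //; apply: fields_op => //.
by rewrite v0.
Qed.

(** Only nonempty words contribute and h <= 1, so every coefficient is at most B h: the field, and
    later the deviation of its time-1 map from the identity, is of order h. *)
Lemma dop_field_tame (B : R) : 0 <= B -> exists2 K : R, 0 <= K &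
  forall Z (h : R), 0 <= h <= 1 -> low 1 Z -> (forall w, `|Z w| <= B * h ^+ size w) ->
    tame (K * h) (dop_field F Z).
Proof.
move=> B0; have [M M0 HM] := word_op_tame.
exists (\sum_(w : word) B * M) => [|Z h /andP[h0 h1] Z0 ZB].
  by apply: sumr_ge0 => w _; exact: mulr_ge0.
have -> : dop_field F Z = fun x => \sum_(w : word | (0 < size w)%N) Z w *: op w id x.
  apply/funext => x; rewrite /dop_field dopE [RHS]big_mkcond /=; apply: eq_bigr => w _.
  by case: ifPn => //; rewrite -eqn0Ngt => /eqP w0; rewrite Z0 ?w0// scale0r.
have HZ : forall w : word, (0 < size w)%N -> tame M (op w id).
  by move=> w w0; apply: HM; rewrite w0 size_bseq.
apply: (tameW _ (@tame_sumZ R E _ (index_enum _) (fun w => (0 < size w)%N) Z M (fun w => op w id) HZ)).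
rewrite mulr_suml [leLHS]big_mkcond /=; apply: ler_sum => w _.
case: ifPn => [w0|_]; last by rewrite !mulr_ge0.
rewrite mulrAC ler_wpM2r//; apply: le_trans (ZB w) _; rewrite ler_wpM2l//.
by rewrite -(prednK w0) exprS ler_piMr// exprn_ile1.
Qed.

(** Cutting at length m keeps the total word length within N when g is the field of a word of length
    N - m. *)
Definition dop_upto m Z g x := \sum_(w : word | (size w <= m)%N) Z w *: op w g x.

Lemma dop_upto_level m Z g x : dop_upto m Z g x = \sum_(r < m.+1) dop F (level r Z) g x.
Proof.
under eq_bigr => r _ do rewrite dop_level big_mkcond.
rewrite exchange_big /dop_upto [LHS]big_mkcond /=; apply: eq_bigr => w _.
case: ifPn => wm.
  rewrite (bigD1 (Ordinal (wm : size w < m.+1)%N)) //= eqxx big1 ?addr0// => r.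
  by move=> rw; case: eqP => // wr; case/eqP: rw; exact/val_inj.
rewrite big1// => r _; case: eqP => // wr; case/negP: wm.
by rewrite wr -ltnS.
Qed.

Lemma dop_upto_lie m Z g x : free_nilpotent_lie Z -> (m <= N)%N -> Db m [set g] ->
  dop_upto m Z g x = 'd g x (dop_upto m Z id x).
Proof.
move=> LZ mN Dg; rewrite !dop_upto_level linear_sum /=; apply: eq_bigr => r _.
have rm : (r <= m)%N by rewrite -ltnS.
by rewrite (dop_lie hF LZ (leq_trans rm mN) (DbW rm Dg)).
Qed.

(** [sum_tensor_mul] for a truncated sum: after the letters of w, there remain m - |w| letters for
    Z. *)
Lemma dop_upto_mul m (Z Z' : tensor) g x : (m <= N)%N -> dop_upto m (Z * Z') g x =
  \sum_(w : word | (size w <= m)%N) Z' w *: dop_upto (m - size w) Z (op w g) x.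
Proof.
move=> mN; have := sum_tensor_mul Z Z' (fun s => if (size s <= m)%N then op s g x else 0).
rewrite /dop_upto [X in X = _ -> _](_ : _ = dop_upto m (Z * Z') g x); last first.
  rewrite /dop_upto [RHS]big_mkcond /=; apply: eq_bigr => w _; case: ifP => //.
  by rewrite scaler0.
rewrite /dop_upto => ->.
under eq_bigr => v _ do rewrite big_mkcond.
rewrite exchange_big [RHS]big_mkcond /=; apply: eq_bigr => w _.
case: ifPn => [wm|wm]; last first.
  rewrite big1// => v _; rewrite size_cat; case: ifP => // _; case: ifPn => vw.
    by case/negP: wm; exact: leq_trans (leq_addl _ _) vw.
  by rewrite scaler0.
rewrite scaler_sumr [RHS]big_mkcond /=; apply: eq_bigr => v _.
rewrite size_cat leq_subRL// [(size w + _)%N]addnC.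
have [vw|vw] := leqP (size v + size w) m; last by rewrite scaler0 if_same.
by rewrite (leq_trans vw mN) scalerA word_op_cat mulrC.
Qed.

(** For y on the trajectory from x and g = exp(u Z), the Taylor remainder of order m of the field of
    v along this trajectory. *)
Definition remainder m (g : tensor) v y x := op v id y - dop_upto m g (op v id) x.

(** The derivative exp(u Z) Z of exp(u Z) prepends the words w of Z to v, giving remainders of
    smaller order. The words with |w| + |v| > N do not fit in the expansion and form the second
    sum. *)
Lemma is_derive_remainder m Z v (y : R -> E) (x : E) (u : R) : free_nilpotent_lie Z ->
  (size v + m = N)%N -> is_derive u (1 : R) y (dop_field F Z (y u)) ->
  is_derive u (1 : R) (fun s : R => remainder m (texp (s *: Z)) v (y s) x)
   (\sum_(w : word | (size w <= m)%N) Z w *: remainder (m - size w) (texp (u *: Z)) (w ++ v) (y u) x +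
    \sum_(w : word | (m < size w)%N) Z w *: 'd (op v id) (y u) (op w id (y u))).
Proof.
move=> LZ vm dy; have Z1 := lie_low LZ.
have mN : (m <= N)%N by rewrite -vm leq_addl.
have dw := word_op_differentiable (y u) (_ : (size v <= N)%N).
have {}dw : differentiable (op v id) (y u) by apply: dw; rewrite -vm leq_addr.
have D1 := is_derive_comp_curve dw dy.
have D2 : is_derive u (1 : R) (fun s : R => dop_upto m (texp (s *: Z)) (op v id) x)
    (dop_upto m (texp (u *: Z) * Z) (op v id) x).
  by apply: is_derive_bigsum => w _; exact/is_derive_scalel/is_derive_texp.
have := is_deriveB D1 D2; congr is_derive.
rewrite /dop_field dopE linear_sum /= (bigID (fun w : word => (size w <= m)%N)) /=.
rewrite addrAC; congr (_ + _); last first.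
  by apply: eq_big => w; rewrite -?ltnNge// => _; rewrite linearZ.
under eq_bigr => w _ do rewrite linearZ.
(* The Lie property is used here: differentiating the field of v along the short part of F(Z)
   amounts to applying the operator of Z to it, without higher order terms. *)
have -> : \sum_(w : word | (size w <= m)%N) Z w *: 'd (op v id) (y u) (op w id (y u)) =
    dop_upto m Z (op v id) (y u).
  rewrite (dop_upto_lie _ LZ mN) ?linear_sum /=.
    by apply: eq_bigr => w _; rewrite linearZ.
  have [||//] := @Db_word_op R E l N F hF m v id; first exact: Db_id.
  by rewrite addnC vm; exact/leqW/leqW.
rewrite dop_upto_mul// /dop_upto -sumrB; apply: eq_bigr => w wm.
by rewrite -scalerBr /remainder word_op_cat.
Qed.

Lemma bounded_lipschitz_primitive (c : R) (f f' : E -> R -> E) : 0 <= c ->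
  (forall x, {within `[0, 1], continuous (f x)}) ->
  (forall x (u : R), 0 < u < 1 -> is_derive u (1 : R) (f x) (f' x u)) -> (forall x, f x 0 = 0) ->
  (forall u, 0 < u < 1 -> bounded_lipschitz c (f' ^~ u)) ->
  forall u, 0 <= u <= 1 -> bounded_lipschitz c (f ^~ u).
Proof.
move=> c0 cf df f0 f'c u /andP[u0 u1].
have sub : `[0, u] `<=` `[0, 1].
  by move=> s /=; rewrite !in_itv /= => /andP[-> su]; exact: le_trans su u1.
have lt1 s : 0 < s < u -> 0 < s < 1 by move=> /andP[-> su]; exact: lt_le_trans su u1.
split=> [x|x y].
  have := mean_value_const u0 (continuous_subspaceW sub (cf x))
    (fun s su => df x s (lt1 s su)) (fun s su => (f'c s (lt1 s su)).1 x).
  by rewrite f0 !subr0 => /le_trans; apply; rewrite ler_piMr.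
pose d := (f x : R -> E) - f y.
have cd : {within `[0, 1], continuous d} by move=> s; apply: cvgB; [exact: cf|exact: cf].
have dd s : 0 < s < u -> is_derive s (1 : R) d (f' x s - f' y s).
  by move=> /lt1 su; have := df x s su; have := df y s su => dy dx; exact: is_deriveB.
have := mean_value_const u0 (continuous_subspaceW sub cd) dd
    (fun s su => (f'c s (lt1 s su)).2 x y).
rewrite /d !fctE !f0 !subr0 => /le_trans; apply.
by rewrite ler_piMr// mulr_ge0.
Qed.

Lemma remainder0 m v x : (size v + m = N)%N -> remainder m (texp (0 *: (0 : tensor))) v x x = 0.
Proof.
move=> vm; rewrite scale0r texp0 /remainder /dop_upto (bigD1 [bseq])//= tensor_oneE scale1r.
rewrite big1 ?addr0 ?subrr// => w /andP[_ w0]; rewrite tensor_oneE.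
case: eqP => [/size0nil w0'|]; last by rewrite scale0r.
by case/eqP: w0; exact/val_inj.
Qed.

(* Differentiating in u, the remainder of order m is expressed with the
   remainders of order less than m and terms of size h^{m+1}. *)
Lemma taylor (B : R) : 0 <= B -> exists2 C : R, 0 <= C &
  forall Z (h : R) (Y : E -> R -> E), 0 <= h <= 1 -> free_nilpotent_lie Z ->
    (forall w, `|Z w| <= B * h ^+ size w) -> (forall x, ode_path (dop_field F Z) x (Y x)) ->
  forall m v, (size v + m = N)%N -> forall u, 0 <= u <= 1 ->
    bounded_lipschitz (C * h ^+ m.+1) (fun x => remainder m (texp (u *: Z)) v (Y x u) x).
Proof.
move=> B0; have [K K0 HK] := dop_field_tame B0; have [M M0 HM] := diff_word_op_bounded_lipschitz.
pose L := 2 * expR (2 * K).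
have L1 : 1 <= L by have := expR_ge1Dx (2 * K); rewrite /L; lra.
suff H : forall n, exists2 C : R, 0 <= C &
  forall Z (h : R) (Y : E -> R -> E), 0 <= h <= 1 -> free_nilpotent_lie Z ->
    (forall w, `|Z w| <= B * h ^+ size w) -> (forall x, ode_path (dop_field F Z) x (Y x)) ->
  forall m v, (m < n)%N -> (size v + m = N)%N -> forall u, 0 <= u <= 1 ->
    bounded_lipschitz (C * h ^+ m.+1) (fun x => remainder m (texp (u *: Z)) v (Y x u) x).
  have [C C0 HC] := H N.+1; exists C => // Z h Y h01 LZ ZB YP m v vm u u01.
  by apply: HC => //; rewrite ltnS -vm leq_addl.
elim=> [|n [C C0 IH]]; first by exists 0.
pose C' := \sum_(w : word) B * (C + M * L).
have MC : 0 <= B * (C + M * L) by rewrite mulr_ge0// addr_ge0// mulr_ge0//; lra.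
have C'0 : 0 <= C' by apply: sumr_ge0 => w _.
exists (C + C') => [|Z h Y h01 LZ ZB YP m v]; first exact: addr_ge0.
have /andP[h0 h1] := h01.
rewrite ltnS leq_eqVlt => /predU1P[->{m}|mn] vm u u01; last first.
  apply: bounded_lipschitzW (IH Z h Y h01 LZ ZB YP m v mn vm u u01).
  by rewrite ler_wpM2r ?exprn_ge0// lerDl.
have Z1 := lie_low LZ; have nN : (n <= N)%N by rewrite -vm leq_addl.
have vN : (size v <= N)%N by rewrite -vm leq_addr.
have tZ : tame K (dop_field F Z).
  by apply: tameW (HK Z h h01 Z1 ZB); rewrite ler_piMr.
have YL s x y : 0 <= s <= 1 -> `|Y x s - Y y s| <= L * `|x - y|.
  move=> s01; have [_ V1 _] := tZ.
  have [|+ _] := ode_path_norm K0 (lexx 0) (YP x) (YP y); last by move=> /(_ s s01); rewrite addr0.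
  by move=> r _; rewrite addr0.
apply: bounded_lipschitzW (_ : bounded_lipschitz (C' * h ^+ n.+1) _).
  by rewrite ler_wpM2r ?exprn_ge0// lerDr.
have hn : 0 <= h ^+ n.+1 by rewrite exprn_ge0.
apply: (@bounded_lipschitz_primitive _ (fun x s => remainder n (texp (s *: Z)) v (Y x s) x)
  (fun x s => \sum_(w : word | (size w <= n)%N) Z w *:
      remainder (n - size w) (texp (s *: Z)) (w ++ v) (Y x s) x +
    \sum_(w : word | (n < size w)%N) Z w *: 'd (op v id) (Y x s) (op w id (Y x s)))) => //.
- exact: mulr_ge0.
- move=> x; have [_ cY _] := YP x; move=> s; apply: cvgB.
    by apply: continuous_comp; [exact: cY|exact/differentiable_continuous/word_op_differentiable].
  suff H : {within `[0, 1], continuous (fun s : R => dop_upto n (texp (s *: Z)) (op v id) x)} by exact: H.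
  apply: derive_within_continuous => r.
  by apply: is_derive_bigsum => w _; exact/is_derive_scalel/is_derive_texp.
- by move=> x s s01; apply: is_derive_remainder => //; case: (YP x) => _ _; apply.
- by move=> x; case: (YP x) => -> _ _; rewrite scale0r -(scale0r (0 : tensor)); exact: remainder0.
move=> s s01; have s01' : 0 <= s <= 1 by case/andP: s01 => /ltW -> /ltW ->.
have H w : bounded_lipschitz (B * (C + M * L) * h ^+ n.+1)
  (fun x => (if (size w <= n)%N then Z w *:
      remainder (n - size w) (texp (s *: Z)) (w ++ v) (Y x s) x else 0) +
    (if (n < size w)%N then Z w *: 'd (op v id) (Y x s) (op w id (Y x s)) else 0)).
  case: (leqP (size w) n) => wn.
    (* The empty word has coefficient 0. Any other word lowers the order, and the powers h^|w| and
       h^(n - |w| + 1) combine into h^(n + 1). *)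
    have [w0|w0] := posnP (size w).
      have -> : Z w = 0 by apply: Z1; rewrite w0.
      rewrite (_ : (fun x => _) = fun=> 0); last by apply/funext => x; rewrite scale0r addr0.
      by apply: bounded_lipschitzW (bounded_lipschitz0 _); exact: mulr_ge0.
    have nw : (n - size w < n)%N by rewrite ltn_subrL w0 (leq_trans w0).
    have vw : (size (w ++ v) + (n - size w) = N)%N 
      by rewrite size_cat [(size w + _)%N]addnC -addnA subnKC.
    have H := bounded_lipschitzZ (Z w) (IH Z h Y h01 LZ ZB YP _ _ nw vw s s01').
    rewrite (_ : (fun x => _ + 0) = (fun x => Z w *: remainder (n - size w) (texp (s *: Z)) (w ++ v) (Y x s) x)).
      apply: bounded_lipschitzW H.
      apply: le_trans (ler_wpM2r _ (ZB w)) _; first by rewrite mulr_ge0// exprn_ge0.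
      have -> : B * h ^+ size w * (C * h ^+ (n - size w).+1) = B * C * h ^+ n.+1.
        by rewrite -[in RHS](subnKC wn) -addnS exprD; ring.
      by rewrite ler_wpM2r// ler_wpM2l// lerDl mulr_ge0//; exact: le_trans ler01 L1.
    by apply/funext => x; rewrite addr0.
  (* A word longer than n already carries h^|w| <= h^(n + 1), since h <= 1. *)
  have wN : (0 < size w <= N)%N by rewrite (leq_ltn_trans _ wn)// size_bseq.
  have H := bounded_lipschitzZ (Z w) (bounded_lipschitz_comp M0 L1 (HM v w vN wN) (fun x y => YL s x y s01')).
  rewrite (_ : (fun x => 0 + _) = (fun x => Z w *: 'd (op v id) (Y x s) (op w id (Y x s)))).
    apply: bounded_lipschitzW H.
    have ML : 0 <= M * L by rewrite mulr_ge0//; exact: le_trans ler01 L1.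
    apply: le_trans (ler_wpM2r ML (ZB w)) _.
    rewrite mulrAC; apply: ler_pM; rewrite ?mulr_ge0 ?exprn_ge0//.
      by rewrite ler_wpM2l// lerDr.
    by apply: ler_wiXn2l.
  by apply/funext => x; rewrite add0r.
rewrite (_ : (fun x => _) = (fun x => \sum_(w : word) (
    (if (size w <= n)%N then Z w *:
      remainder (n - size w) (texp (s *: Z)) (w ++ v) (Y x s) x else 0) +
    (if (n < size w)%N then Z w *: 'd (op v id) (Y x s) (op w id (Y x s)) else 0)))).
  by rewrite /C' mulr_suml; apply: bounded_lipschitz_sum => w _; exact: H.
by apply/funext => x; rewrite big_split /= -!big_mkcond.
Qed.

(** m2 is expanded at m1 x, then each field of the expansion is expanded along m1 from x. The main
    terms assemble into the operator of exp(Z1) exp(Z2) = exp(Z3), that is, into the expansion of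
    m3, and only remainders of order h^(N + 1) are left. *)
Lemma taylor_comp (B : R) : 0 <= B -> exists2 C : R, 0 <= C &
  forall (h : R) Z1 Z2 Z3 m1 m2 m3, 0 <= h <= 1 ->
    free_nilpotent_lie Z1 -> free_nilpotent_lie Z2 -> free_nilpotent_lie Z3 ->
    (forall w, `|Z1 w| <= B * h ^+ size w) -> (forall w, `|Z2 w| <= B * h ^+ size w) ->
    (forall w, `|Z3 w| <= B * h ^+ size w) -> (forall w, `|texp Z2 w| <= B * h ^+ size w) ->
    time1_map (dop_field F Z1) m1 -> time1_map (dop_field F Z2) m2 ->
    time1_map (dop_field F Z3) m3 -> texp Z1 * texp Z2 = texp Z3 ->
  bounded_lipschitz (C * h ^+ N.+1) (fun x => m2 (m1 x) - m3 x).
Proof.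
move=> B0; have [K K0 HK] := dop_field_tame B0; have [C C0 HC] := taylor B0.
pose L := 2 * expR (2 * K).
have L1 : 1 <= L by have := expR_ge1Dx (2 * K); rewrite /L; lra.
have L0 : 0 <= L by exact: le_trans ler01 L1.
pose S := \sum_(w : word) B * C.
have S0 : 0 <= S by apply: sumr_ge0 => w _; exact: mulr_ge0.
exists (C * L + S + C) => [|h Z1 Z2 Z3 m1 m2 m3 h01 LZ1 LZ2 LZ3 B1 B2 B3 BX T1 T2 T3 ZE].
  by rewrite !addr_ge0// mulr_ge0.
have one : 0 <= (1 : R) <= 1 by rewrite ler01 /=.
have path Z m : free_nilpotent_lie Z -> (forall w, `|Z w| <= B * h ^+ size w) ->
    time1_map (dop_field F Z) m ->
    (forall x y, `|m x - m y| <= L * `|x - y|) /\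
    forall k v, (size v + k = N)%N ->
      bounded_lipschitz (C * h ^+ k.+1) (fun x => remainder k (texp Z) v (m x) x).
  move=> LZ BZ Tm.
  have [Y HY] : exists Y : E -> R -> E, forall x, ode_path (dop_field F Z) x (Y x) /\ Y x 1 = m x.
    have H x : exists y, ode_path (dop_field F Z) x y /\ y 1 = m x.
      by have [y yP y1] := time1_map_path x Tm; exists y.
    by exists (fun x => sval (cid (H x))) => x; exact: svalP (cid (H x)).
  have YP x := (HY x).1; have Y1 x := (HY x).2.
  split=> [x y|k v kv].
    have [|+ _] := ode_path_norm K0 (lexx 0) (YP x) (YP y).
      have [_ V1 _] : tame K (dop_field F Z).
        by case/andP: (h01) => h0 h1; apply: tameW (HK Z h h01 (lie_low LZ) BZ); rewrite ler_piMr.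
      by move=> r _; rewrite addr0.
    by move=> /(_ 1 one); rewrite addr0 !Y1.
  have := HC Z h Y h01 LZ BZ YP k v kv 1 one; rewrite scale1r.
  by congr bounded_lipschitz; apply/funext => x; rewrite Y1.
have [h0 h1] := andP h01.
have [L1' R1] := path Z1 m1 LZ1 B1 T1; have [_ R2] := path Z2 m2 LZ2 B2 T2.
have [_ R3] := path Z3 m3 LZ3 B3 T3.
have CN : 0 <= C * h ^+ N.+1 by rewrite mulr_ge0// exprn_ge0.
have mE Z m x : m x = remainder N (texp Z) [::] (m x) x + dop_upto N (texp Z) id x.
  by rewrite /remainder subrK.
have E2 x : dop_upto N (texp Z2) id (m1 x) = \sum_(w : word) texp Z2 w *:
    remainder (N - size w) (texp Z1) w (m1 x) x + dop_upto N (texp Z3) id x.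
  rewrite -ZE dop_upto_mul// /dop_upto.
  have all (G : word -> E) : \sum_(w : word | (size w <= N)%N) G w = \sum_w G w.
    by apply: eq_bigl => w; rewrite size_bseq.
  rewrite all [X in _ = _ + X]all.
  by rewrite -big_split /=; apply: eq_bigr => w _; rewrite -scalerDr /remainder subrK.
have -> : (fun x => m2 (m1 x) - m3 x) = (fun x =>
    (remainder N (texp Z2) [::] (m2 (m1 x)) (m1 x) +
     \sum_(w : word) texp Z2 w *: remainder (N - size w) (texp Z1) w (m1 x) x) +
    - remainder N (texp Z3) [::] (m3 x) x).
  apply/funext => x; rewrite {1}(mE Z2 m2 (m1 x)) {1}(mE Z3 m3 x) E2.
  move: (\sum_w _) (remainder _ _ _ _ _) (remainder _ _ _ _ _) (dop_upto _ _ _ _) => a b c d; lmod.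
rewrite 2!mulrDl; apply: bounded_lipschitzD; last by apply: bounded_lipschitzN; exact: R3.
apply: bounded_lipschitzD.
  by rewrite mulrAC; exact: bounded_lipschitz_comp CN L1 (R2 N [::] erefl) L1'.
rewrite mulr_suml; apply: bounded_lipschitz_sum => w _.
have wN : (size w + (N - size w) = N)%N by rewrite subnKC// size_bseq.
apply: bounded_lipschitzW (bounded_lipschitzZ _ (R1 _ _ wN)).
apply: le_trans (ler_wpM2r _ (BX w)) _; first by rewrite mulr_ge0// exprn_ge0.
by rewrite -[in leRHS]wN -addnS exprD mulrACA.
Qed.

End Taylor.

(** * Flows driven by rough paths *)

Section Weights.
Context (R : realType) (l N : nat).
Local Notation tensor := (tensor R l N).
Local Notation word := (N.-bseq 'I_l).
Implicit Types (a b g : tensor) (w : word) (h c d : R).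

(** All Hölder bounds at once, with h standing for |t - s|^(1/p). Algebraic operations preserve it
    with constants independent of h. *)
Definition weighted h c a := forall w, `|a w| <= c * h ^+ size w.

Lemma weightedW h c d a : 0 <= h -> c <= d -> weighted h c a -> weighted h d a.
Proof. by move=> h0 cd ca w; apply: le_trans (ca w) _; rewrite ler_wpM2r// exprn_ge0. Qed.

Lemma weighted_le h k c a : 0 <= c -> 0 <= h -> h <= k -> weighted h c a -> weighted k c a.
Proof. by move=> c0 h0 hk ca w; rewrite (le_trans (ca w))// ler_wpM2l// lerXn2r// nnegrE (le_trans h0). Qed.

Lemma weightedD h c d a b : weighted h c a -> weighted h d b -> weighted h (c + d) (a + b).
Proof.
by move=> ca db w; rewrite ffunE (le_trans (ler_normD _ _))// mulrDl; exact: lerD (ca w) (db w).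
Qed.

Lemma weightedZ h k c a : weighted h c a -> weighted h (`|k| * c) (k *: a).
Proof. by move=> ca w; rewrite tensor_scaleE normrM -mulrA ler_wpM2l. Qed.

Lemma weighted0 h : weighted h 0 0.
Proof. by move=> w; rewrite ffunE normr0 mul0r. Qed.

Lemma weighted_sum h (I : Type) (s : seq I) (P : pred I) (c : I -> R) (a : I -> tensor) :
  (forall i, P i -> weighted h (c i) (a i)) ->
  weighted h (\sum_(i <- s | P i) c i) (\sum_(i <- s | P i) a i).
Proof.
move=> H; elim/big_rec2: _ => [|i c' a' Pi]; first exact: weighted0.
exact: weightedD (H i Pi).
Qed.

Lemma weighted1 h : 0 <= h -> weighted h 1 1.
Proof.
move=> h0 w; rewrite tensor_oneE mul1r; case: eqP => [->|_]; first by rewrite normr1 expr0.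
by rewrite normr0 exprn_ge0.
Qed.

Lemma weightedB1 h c a : 0 <= h -> weighted h c a -> weighted h (c + 1) (a - 1).
Proof.
move=> h0 ca; apply: weightedD => //; have := @weightedZ h (-1) 1 1 (weighted1 h0).
by rewrite normrN1 mulr1 scaleN1r.
Qed.

Lemma weightedM h c d a b : 0 <= h -> 0 <= c -> 0 <= d -> weighted h c a -> weighted h d b ->
  weighted h (N.+1%:R * c * d) (a * b).
Proof.
move=> h0 c0 d0 ca db w; rewrite tensor_mulE; apply: le_trans (ler_norm_sum _ _ _) _.
have term (k : 'I_(size w).+1) :
    `|a (insub_bseq N (take k w)) * b (insub_bseq N (drop k w))| <= c * d * h ^+ size w.
  have kw : (k <= size w)%N by rewrite -ltnS.
  rewrite normrM; apply: le_trans (ler_pM _ _ (ca _) (db _)) _ => //.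
  by rewrite insub_bseq_take insub_bseq_drop size_takel// size_drop mulrACA -exprD subnKC.
apply: le_trans (ler_sum _ (fun k _ => term k)) _.
rewrite sumr_const card_ord -[leLHS]mulr_natl -!mulrA ler_wpM2r ?mulr_ge0 ?exprn_ge0//.
by rewrite ler_nat ltnS size_bseq.
Qed.

Lemma weightedX h c a n : 0 <= h -> 0 <= c -> weighted h c a ->
  weighted h ((N.+1%:R * c) ^+ n) (a ^+ n).
Proof.
move=> h0 c0 ca; elim: n => [|n IH]; first exact: weighted1.
rewrite !exprS; apply: weightedM => //.
by rewrite exprn_ge0// mulr_ge0.
Qed.

Lemma weighted_texp c : 0 <= c -> exists2 d, 0 <= d &
  forall h a, 0 <= h -> weighted h c a -> weighted h d (texp a).
Proof.
move=> c0; have D0 n : 0 <= (N.+1%:R * c) ^+ n by rewrite exprn_ge0// mulr_ge0.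
exists (\sum_(n < N.+1) (N.+1%:R * c) ^+ n) => [|h a h0 ca]; first exact: sumr_ge0.
apply: weighted_sum => n _. apply: (weightedW h0 _ (weightedZ _ (weightedX n h0 c0 ca))).
rewrite ler_piMl// ger0_norm ?invr_ge0// invf_le1 ?ltr0n ?fact_gt0//.
by rewrite (ler_nat _ 1) fact_gt0.
Qed.

Let tlog_coef n : `|(-1) ^+ n.+1 / n%:R : R| <= 1.
Proof.
rewrite normrM normrX normrN1 expr1n mul1r; case: n => [|n]; first by rewrite invr0 normr0.
by rewrite ger0_norm ?invr_ge0// invf_le1 ?ltr0n// (ler_nat _ 1).
Qed.

Lemma weighted_tlog c : 0 <= c -> exists2 d, 0 <= d &
  forall h g, 0 <= h -> weighted h c g -> weighted h d (tlog g).
Proof.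
move=> c0; have c1 : 0 <= c + 1 by rewrite addr_ge0.
have D0 n : 0 <= (N.+1%:R * (c + 1)) ^+ n by rewrite exprn_ge0// mulr_ge0.
exists (\sum_(1 <= n < N.+1) (N.+1%:R * (c + 1)) ^+ n) => [|h g h0 cg].
  by apply: sumr_ge0.
have cg1 := weightedB1 h0 cg.
apply: weighted_sum => n _; apply: (weightedW h0 _ (weightedZ _ (weightedX n h0 c1 cg1))).
by rewrite ler_piMl.
Qed.

Lemma weighted_tlog_sub c : 0 <= c -> exists2 S, 0 <= S & forall h d g g', 0 <= h -> 0 <= d ->
  weighted h c g -> weighted h c g' -> weighted h d (g - g') ->
  weighted h (S * d) (tlog g - tlog g').
Proof.
move=> c0; have c1 : 0 <= c + 1 by rewrite addr_ge0.
pose D n := (N.+1%:R * (c + 1)) ^+ n; have D0 n : 0 <= D n by rewrite exprn_ge0// mulr_ge0.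
have [S HS] : exists S : nat -> R, forall n, 0 <= S n /\ forall h d a b, 0 <= h -> 0 <= d ->
    weighted h (c + 1) a -> weighted h (c + 1) b -> weighted h d (a - b) ->
    weighted h (S n * d) (a ^+ n - b ^+ n).
  (* The recursion follows a^(n+1) - b^(n+1) = a (a^n - b^n) + (a - b) b^n, each product costing the
     factor N + 1 of [weightedM]. *)
  pose S := nat_rect (fun=> R) 0 (fun n s => N.+1%:R * (c + 1) * s + N.+1%:R * D n).
  exists S; elim=> [|n [Sn0 IH]].
    by split=> // h d a b h0 d0 _ _ _; rewrite !expr0 subrr mul0r; exact: weighted0.
  split=> [|h d a b h0 d0 ca cb dab]; first by rewrite /= addr_ge0// !mulr_ge0.
  have -> : a ^+ n.+1 - b ^+ n.+1 = a * (a ^+ n - b ^+ n) + (a - b) * b ^+ n.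
    by rewrite mulrBr mulrBl -!exprS addrA subrK.
  have -> : S n.+1 * d = N.+1%:R * (c + 1) * (S n * d) + N.+1%:R * d * D n.
    by rewrite /=; ring.
  apply: weightedD; apply: weightedM => //; [exact: mulr_ge0|exact: IH|exact: weightedX].
have S0 n : 0 <= S n by have [] := HS n.
exists (\sum_(1 <= n < N.+1) S n) => [|h d g g' h0 d0 cg cg' dgg].
  by apply: sumr_ge0.
rewrite /tlog -sumrB mulr_suml; apply: weighted_sum => n _; rewrite -scalerBr.
have dgg1 : weighted h d (g - 1 - (g' - 1)) by rewrite opprB addrA subrK.
apply: (weightedW h0 _ (weightedZ _ ((HS n).2 h d _ _ h0 d0 (weightedB1 h0 cg) (weightedB1 h0 cg') dgg1))).
by rewrite ler_piMl// mulr_ge0.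
Qed.

End Weights.

(** * From Hölder norms to weighted bounds on increments *)

Section RoughBounds.
Context (R : realType) (l N : nat) (p T : R).
Hypothesis p0 : 0 < p.
Local Notation tensor := (tensor R l N).
Local Notation word := (N.-bseq 'I_l).
Implicit Types (X Y : R -> tensor) (A : R -> R -> tensor) (w : word) (s t B d : R).

Let holder_normP A B : (holder_norm p T A <= B%:E)%E -> forall s t w, 0 <= s -> s < t -> t <= T ->
  (0 < size w)%N -> `|A s t w| <= B * ((t - s) `^ p^-1) ^+ size w.
Proof.
move=> H s t w s0 st tT w0; have ts : 0 < t - s by rewrite subr_gt0.
have wN : (size w < N.+1)%N by rewrite ltnS size_bseq.
have -> : ((t - s) `^ p^-1) ^+ size w = `|t - s| `^ ((size w)%:R / p).
  by rewrite -powR_mulrn ?powR_ge0// -powRrM mulrC gtr0_norm.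
rewrite -ler_pdivrMr ?powR_gt0 ?normr_gt0 ?gt_eqF//.
have Aw : `|A s t w| <= level_norm (size w) (A s t).
  by apply: le_bigmax_cond.
apply: le_trans (ler_wpM2r _ Aw) _; first by rewrite invr_ge0 powR_ge0.
rewrite -lee_fin; apply: le_trans H.
apply: (@bigmax_sup_seq _ _ _ _ _ (size w)) => //; first by rewrite mem_index_iota w0.
by apply: ereal_sup_ubound; exists s, t.
Qed.

Definition mesh_scale s t := (t - s) `^ p^-1.
Local Notation h := mesh_scale.

Lemma mesh_scale_ge0 s t : 0 <= h s t.
Proof. exact: powR_ge0. Qed.

Lemma mesh_scale_le s t s' t' : s' <= s -> s <= t -> t <= t' -> h s t <= h s' t'.
Proof.
move=> ss st tt; apply: ge0_ler_powR; rewrite ?nnegrE ?invr_ge0 ?subr_ge0 ?(ltW p0)//; last exact: lerB.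
by rewrite (le_trans ss)// (le_trans st).
Qed.

Lemma mesh_scale_le1 s t : s <= t -> t - s <= 1 -> h s t <= 1.
Proof.
move=> st ts; rewrite /h (_ : 1 = 1 `^ p^-1 :> R); last by rewrite powR1.
by apply: ge0_ler_powR; rewrite ?nnegrE ?invr_ge0 ?subr_ge0 ?(ltW p0).
Qed.

Lemma mesh_scaleX s t n : h s t ^+ n = (t - s) `^ (n%:R / p).
Proof. by rewrite -powR_mulrn ?powR_ge0// -powRrM mulrC. Qed.

Definition rough B X := (forall t, 0 <= t <= T -> free_nilpotent_group (X t)) /\
  (forall s t, 0 <= s -> s <= t -> t <= T -> weighted (h s t) B (increment X s t)).

Section Increments.
Context (X : R -> tensor).
Hypothesis GX : forall t, 0 <= t <= T -> free_nilpotent_group (X t).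

Lemma increment_refl t : 0 <= t <= T -> increment X t t = 1.
Proof. by move=> /GX/free_nilpotent_group_unit/mulVr. Qed.

Lemma incrementM s u t : 0 <= u <= T -> increment X s u * increment X u t = increment X s t.
Proof. by move=> /GX/free_nilpotent_group_unit uX; rewrite /increment -mulrA mulVKr. Qed.

Lemma increment_group s t : 0 <= s <= T -> 0 <= t <= T -> free_nilpotent_group (increment X s t).
Proof. by move=> sT tT; apply: free_nilpotent_groupM; [apply: free_nilpotent_groupV|]; exact: GX. Qed.

End Increments.

(** The Hölder norm ignores level 0, where an increment has coefficient 1: hence B + 1. *)
Let incrementP X B : (forall t, 0 <= t <= T -> free_nilpotent_group (X t)) -> 0 <= B ->
  (forall s t w, 0 <= s -> s < t -> t <= T -> (0 < size w)%N ->
    `|increment X s t w| <= B * h s t ^+ size w) -> rough (B + 1) X.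
Proof.
move=> GX B0 H; split=> // s t s0 st tT w.
have sT : 0 <= s <= T by rewrite s0 (le_trans st).
have t0T : 0 <= t <= T by rewrite tT andbT (le_trans s0).
have hw : 0 <= h s t ^+ size w by rewrite exprn_ge0// mesh_scale_ge0.
have [w0|w0] := posnP (size w).
  have -> : increment X s t w = 1.
    have := free_nilpotent_group_low (increment_group GX sT t0T).
    move=> /(_ w); rewrite w0 => /(_ isT)/eqP.
    by rewrite !ffunE w0 eqxx subr_eq0 => /eqP.
  by rewrite w0 expr0 mulr1 normr1 lerDr.
have [ts|ts] := ltP s t.
  by apply: le_trans (H s t w s0 ts tT w0) _; rewrite ler_wpM2r// lerDl.
have -> : t = s by apply/le_anti; rewrite ts.
rewrite increment_refl// tensor_oneE gtn_eqF// normr0 mulr_ge0// ?addr_ge0//.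
by rewrite exprn_ge0// mesh_scale_ge0.
Qed.

Lemma rough_path_bound X : (forall t, 0 <= t <= T -> free_nilpotent_group (X t)) ->
  (holder_norm p T (increment X) < +oo)%E -> exists2 B, 0 <= B & rough B X.
Proof.
move=> GX H; have n0 : (0 <= holder_norm p T (increment X))%E by exact: bigmax_ge_id.
have nE : holder_norm p T (increment X) = (fine (holder_norm p T (increment X)))%:E.
  by rewrite fineK// ge0_fin_numE.
exists (fine (holder_norm p T (increment X)) + 1); first by rewrite addr_ge0// fine_ge0.
apply: incrementP => //; first exact: fine_ge0.
by apply: holder_normP; rewrite -nE.
Qed.

Lemma rough_path_dist X Y B d : 0 <= B -> 0 <= d -> rough B X ->
  (forall t, 0 <= t <= T -> free_nilpotent_group (Y t)) -> (rp_dist p T X Y <= d%:E)%E ->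
  rough (B + d + 1) Y /\ forall s t, 0 <= s -> s <= t -> t <= T ->
    weighted (h s t) d (increment X s t - increment Y s t).
Proof.
move=> B0 d0 [GX BX] GY /holder_normP H; split.
  apply: incrementP => // [|s t w s0 st tT w0]; first exact: addr_ge0.
  have -> : increment Y s t w = increment X s t w - (increment X s t - increment Y s t) w.
    by rewrite !ffunE opprB addrC subrK.
  rewrite (le_trans (ler_normB _ _))// mulrDl lerD//; last exact: H.
  by apply: BX => //; exact: ltW.
move=> s t s0 st tT w.
have sT : 0 <= s <= T by rewrite s0 (le_trans st).
have t0T : 0 <= t <= T by rewrite tT andbT (le_trans s0).
have hw : 0 <= d * h s t ^+ size w by rewrite mulr_ge0// exprn_ge0// mesh_scale_ge0.
have [w0|w0] := posnP (size w).
  have low0 Z : free_nilpotent_group Z -> Z w = 1.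
    move=> /free_nilpotent_group_low/(_ w); rewrite w0 => /(_ isT)/eqP.
    by rewrite !ffunE w0 eqxx subr_eq0 => /eqP.
  have sub (a b : tensor) : (a - b) w = a w - b w by rewrite !ffunE.
  by rewrite sub !low0 ?subrr ?normr0//; apply: increment_group.
have [ts|ts] := ltP s t; first exact: H.
have ts' : t = s by apply/le_anti; rewrite ts.
by move: hw; rewrite ts' !increment_refl// subrr ffunE normr0.
Qed.

End RoughBounds.

(** * Comparison of flows by telescoping *)

Section FlowComparison.
Context (R : realType) (E : normedModType R) (T : R).
Hypothesis T0 : 0 < T.
Implicit Types (phi psi mu nu : R -> R -> E -> E) (s t a C L K delta r : R).

Definition lipschitz_flow L phi := forall s t, 0 <= s -> s <= t -> t <= T ->
  forall x y, `|phi s t x - phi s t y| <= L * `|x - y|.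

Definition close a C delta phi psi := forall s t, 0 <= s -> s <= t -> t <= T -> t - s <= delta ->
  forall x, `|phi s t x - psi s t x| <= C * (t - s) `^ a.

(** n (T / n)^a = T^a n^(1 - a) tends to 0 as a > 1. *)
Lemma pieces_small a C delta e : 1 < a -> 0 <= C -> 0 < delta -> 0 < e ->
  exists n : nat, T / n.+1%:R <= delta /\ n.+1%:R * (C * (T / n.+1%:R) `^ a) <= e.
Proof.
move=> a1 C0 d0 e0.
have CT : 0 < C * T + 1 by rewrite ltr_wpDl// mulr_ge0// ltW.
have [||d d00 dP] := @powR_small R (a - 1) (e / (C * T + 1)); [by rewrite subr_gt0|by rewrite divr_gt0|].
have [n Hn] := @invn_small R (Order.min delta d / T) ltac:(by rewrite divr_gt0// lt_min d0).
have x0 : 0 < T / n.+1%:R by rewrite divr_gt0.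
have xd : T / n.+1%:R <= Order.min delta d.
  by have := Hn n (leqnn n); rewrite ler_pdivlMr// mulrC.
move: xd; rewrite le_min => /andP[xdelta xd]; exists n; split=> //.
have := dP _ (ltW x0) xd; set x := T / n.+1%:R in x0 xdelta xd *.
rewrite ltr_pdivlMr// => /ltW; apply: le_trans.
have -> : x `^ a = x `^ (a - 1) * x.
  by rewrite -{3}(powRr1 (ltW x0)) -powRD ?subrK//; apply/implyP => _; rewrite gt_eqF.
have -> : n.+1%:R * (C * (x `^ (a - 1) * x)) = x `^ (a - 1) * (C * (n.+1%:R * x)) by ring.
have -> : n.+1%:R * x = T by rewrite /x mulrC divfK.
by rewrite ler_wpM2l ?powR_ge0// lerDl.
Qed.

Let piece (s t : R) (n i : nat) := s + i%:R * ((t - s) / n.+1%:R).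

Let pieceP s t n i : 0 <= s -> s <= t -> t <= T -> (i <= n)%N ->
  [/\ s <= piece s t n i, piece s t n i <= piece s t n i.+1, piece s t n i.+1 <= t
    & piece s t n i.+1 - piece s t n i <= T / n.+1%:R].
Proof.
move=> s0 st tT iN; have d0 : 0 <= (t - s) / n.+1%:R by rewrite divr_ge0// subr_ge0.
have tE : s + n.+1%:R * ((t - s) / n.+1%:R) = t by rewrite mulrC divfK// addrC subrK.
rewrite /piece; split.
- by rewrite lerDl mulr_ge0.
- by rewrite lerD2l ler_wpM2r// ler_nat.
- by rewrite -[leRHS]tE lerD2l ler_wpM2r// ler_nat.
- rewrite (_ : _ - _ = (t - s) / n.+1%:R); last by rewrite -natr1; ring.
  rewrite ler_wpM2r ?invr_ge0//.
  by rewrite lerBlDr (le_trans tT)// lerDl.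
Qed.

(** The maps psi up to u followed by phi from u to t interpolate between the two flows. Moving u by
    one piece costs r, amplified by the Lipschitz constant of phi alone. *)
Lemma flow_telescope phi psi L r n : flow T phi -> flow T psi -> 0 <= L ->
  lipschitz_flow L phi ->
  (forall s t, 0 <= s -> s <= t -> t <= T -> t - s <= T / n.+1%:R ->
    forall x, `|phi s t x - psi s t x| <= r) ->
  forall s t, 0 <= s -> s <= t -> t <= T ->
    forall x, `|phi s t x - psi s t x| <= n.+1%:R * (L * r).
Proof.
move=> [phi1 phiM] [psi1 psiM] L0 phiL H s t s0 st tT x.
suff I i : (i <= n.+1)%N -> `|phi s t x - phi (piece s t n i) t (psi s (piece s t n i) x)| <= i%:R * (L * r).
  have := I n.+1 (leqnn _); have -> : piece s t n n.+1 = t by rewrite /piece mulrC divfK// addrC subrK.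
  by rewrite phi1// tT (le_trans s0).
elim: i => [_|i IH]; first by rewrite /piece mul0r addr0 psi1 ?s0 ?(le_trans st)//= subrr normr0 mul0r.
rewrite ltnS => iN; have {}IH := IH (leqW iN).
have [] := pieceP s0 st tT iN; set u := piece s t n i in IH *; set v := piece s t n i.+1 => su uv vt vu.
have u0 := le_trans s0 su; have uT : u <= T by exact: le_trans uv (le_trans vt tT).
have vT := le_trans vt tT.
set y := psi s u x in IH.
have -> : phi s t x - phi v t (psi s v x) = (phi s t x - phi u t y) +
    (phi v t (phi u v y) - phi v t (psi u v y)).
  by rewrite (psiM s u v)// (phiM u v t u0)//= -/y; lmod.
apply: le_trans (ler_normD _ _) _; rewrite -natr1 mulrDl mul1r; apply: lerD => //.
apply: le_trans (phiL v t (le_trans u0 uv) vt tT _ _) _.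
by rewrite ler_wpM2l//; exact: H.
Qed.

(** Regularity is asked of phi only, so that psi may be an arbitrary solution flow. *)
Lemma flow_unique phi psi a C delta L : 1 < a -> 0 <= C -> 0 < delta -> 0 <= L ->
  flow T phi -> flow T psi -> lipschitz_flow L phi -> close a C delta phi psi ->
  forall s t, 0 <= s -> s <= t -> t <= T -> phi s t =1 psi s t.
Proof.
move=> a1 C0 d0 L0 fphi fpsi phiL H s t s0 st tT x.
apply/eqP; rewrite -subr_eq0 -normr_le0; apply/ler_addgt0Pr => e e0; rewrite add0r.
have [n [nd ne]] := pieces_small a1 (mulr_ge0 L0 C0) d0 e0.
apply: le_trans ne; rewrite -mulrA.
apply: (flow_telescope fphi fpsi L0 phiL) => // u v u0 uv vT vu y.
apply: le_trans (H u v u0 uv vT (le_trans vu nd) y) _; rewrite ler_wpM2l//.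
by apply: ge0_ler_powR; rewrite ?nnegrE ?subr_ge0 ?divr_ge0 ?(ltW T0)// ltW// (lt_trans _ a1).
Qed.

(* The almost flow nu of the time reversal inverts mu exactly; the error made by
   replacing mu and nu with phi and psi is of order |t - s|^a on each piece. *)
Lemma flow_inverse phi psi mu nu a C delta L : 1 < a -> 0 <= C -> 0 < delta -> 0 <= L ->
  flow T phi -> flow T psi -> lipschitz_flow L psi ->
  close a C delta phi mu -> close a C delta psi nu ->
  (forall s t, 0 <= s -> s <= t -> t <= T -> forall x, nu (T - t) (T - s) (mu s t x) = x) ->
  forall s t, 0 <= s -> s <= t -> t <= T -> forall x, psi (T - t) (T - s) (phi s t x) = x.
Proof.
move=> a1 C0 d0 L0 [phi1 phiM] [psi1 psiM] psiL Hphi Hpsi numu s t s0 st tT x.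
apply/eqP; rewrite -subr_eq0 -normr_le0; apply/ler_addgt0Pr => e e0; rewrite add0r.
have C'0 : 0 <= L * (L * C + C) by rewrite mulr_ge0// addr_ge0// mulr_ge0.
have [n [nd ne]] := pieces_small a1 C'0 d0 e0.
apply: le_trans ne.
suff I i : (i <= n.+1)%N ->
    `|psi (T - piece s t n i) (T - s) (phi s (piece s t n i) x) - x| <=
      i%:R * (L * (L * C + C) * (T / n.+1%:R) `^ a).
  have := I n.+1 (leqnn _).
  by have -> : piece s t n n.+1 = t by rewrite /piece mulrC divfK// addrC subrK.
elim: i => [_|i IH].
  rewrite /piece mul0r addr0 phi1 ?s0 ?(le_trans st)//= psi1 ?subrr ?normr0 ?mul0r//.
  by rewrite subr_ge0 (le_trans st)//= lerBlDr lerDl.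
rewrite ltnS => iN; have {}IH := IH (leqW iN).
have [] := pieceP s0 st tT iN; set u := piece s t n i in IH *; set v := piece s t n i.+1 => su uv vt vu.
have u0 := le_trans s0 su; have uT : u <= T by exact: le_trans uv (le_trans vt tT).
have vT := le_trans vt tT; have v0 := le_trans u0 uv.
set y := phi s u x in IH.
have E1 : T - u - (T - v) = v - u by rewrite opprB addrC addrA subrK.
have Tuv : T - v <= T - u by rewrite lerD2l lerN2.
have Tu : T - u <= T by rewrite lerBlDr lerDl.
have Tsu : T - u <= T - s by rewrite lerD2l lerN2.
have Ts : T - s <= T by rewrite lerBlDr lerDl.
have Tv0 : 0 <= T - v by rewrite subr_ge0.
have Tu0 : 0 <= T - u by rewrite subr_ge0.
have -> : psi (T - v) (T - s) (phi s v x) - x =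
    (psi (T - u) (T - s) (psi (T - v) (T - u) (phi u v y)) - psi (T - u) (T - s) y) +
    (psi (T - u) (T - s) y - x).
  by rewrite (phiM s u v)// (psiM (T - v) (T - u) (T - s))//= -/y; lmod.
apply: le_trans (ler_normD _ _) _; rewrite -natr1 mulrDl mul1r [leRHS]addrC; apply: lerD => //.
apply: le_trans (psiL _ _ Tu0 Tsu Ts _ _) _; rewrite -[leRHS]mulrA ler_wpM2l//.
have -> : psi (T - v) (T - u) (phi u v y) - y =
    (psi (T - v) (T - u) (phi u v y) - psi (T - v) (T - u) (mu u v y)) +
    (psi (T - v) (T - u) (mu u v y) - nu (T - v) (T - u) (mu u v y)).
  by rewrite numu//; lmod.
have vud := le_trans vu nd.
have H1 := le_trans (psiL _ _ Tv0 Tuv Tu _ _) (ler_wpM2l L0 (Hphi u v u0 uv vT vud y)).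
have H2 := Hpsi _ _ Tv0 Tuv Tu (_ : _ <= delta) (mu u v y).
rewrite E1 in H2; have {}H2 := H2 vud.
apply: le_trans (ler_normD _ _) (le_trans (lerD H1 H2) _).
rewrite mulrA -mulrDl ler_wpM2l ?addr_ge0 ?mulr_ge0//.
by apply: ge0_ler_powR; rewrite ?nnegrE ?subr_ge0 ?divr_ge0 ?(ltW T0)// ltW// (lt_trans _ a1).
Qed.

End FlowComparison.

(** * Sewing, uniqueness, inversion and stability for time-1 maps of rough increments *)

Section RoughFlows.
Context (R : realType) (E : completeNormedModType R) (l N : nat) (F : {linear 'rV[R]_l -> (E -> E)}).
Hypothesis hF : forall v : 'rV[R]_l, Ckb N.+1 (F v).
Context (p T : R).
Hypotheses (p0 : 0 < p) (pN : p < N.+1%:R) (T0 : 0 < T).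
Local Notation tensor := (tensor R l N).
Local Notation rough := (@rough R l N p T).
Local Notation h := (@mesh_scale R p).
Local Notation a := (N.+1%:R / p).
Implicit Types (X Y : R -> tensor) (Z : tensor) (mu phi : R -> R -> E -> E) (s t B C K d : R).

Definition euler X mu := forall s t, 0 <= s -> s <= t -> t <= T ->
  time1_map (dop_field F (tlog (increment X s t))) (mu s t).

Lemma regularity_gt1 : 1 < a. Proof. by rewrite ltr_pdivlMr// mul1r. Qed.

Lemma euler_exists X : (forall t, 0 <= t <= T -> free_nilpotent_group (X t)) -> exists mu, euler X mu.
Proof.
move=> GX.
have H s t : exists m, 0 <= s -> s <= t -> t <= T ->
    time1_map (dop_field F (tlog (increment X s t))) m.
  have [s0|s0] := boolP (0 <= s); last by exists id => // /(negP s0).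
  have [st|st] := boolP (s <= t); last by exists id => // _ /(negP st).
  have [tT|tT] := boolP (t <= T); last by exists id => // _ _ /(negP tT).
  set Z := tlog _; have [LZ _] : free_nilpotent_lie Z /\ texp Z = increment X s t.
    apply: free_nilpotent_group_log; apply: (increment_group GX); first by rewrite s0 (le_trans st).
    by rewrite tT (le_trans s0).
  (* Mere existence needs no scaling: h = 1 and this crude bound make the field of Z tame. *)
  have B0 : 0 <= \sum_w `|Z w| by exact: sumr_ge0.
  have [K K0 HK] := dop_field_tame hF B0.
  have tZ : tame (K * 1) (dop_field F Z).
    apply: HK; [by rewrite ler01 /=|exact: lie_low|].
    by move=> w; rewrite expr1n mulr1 (bigD1 w)//= lerDl sumr_ge0.
  have [m mP] := time1_map_exists tZ ltac:(by rewrite mulr1).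
  by exists m.
exists (fun s t => sval (cid (H s t))) => s t; exact: svalP (cid (H s t)).
Qed.

Lemma rough_log B : 0 <= B -> exists2 D, B <= D & forall X, rough B X ->
  forall s t, 0 <= s -> s <= t -> t <= T ->
  let Z := tlog (increment X s t) in
  [/\ free_nilpotent_lie Z, texp Z = increment X s t, weighted (h s t) D Z
    & weighted (h s t) D (texp Z)].
Proof.
move=> B0; have [D D0 HD] := @weighted_tlog R l N B B0.
exists (B + D) => [|X [GX BX] s t s0 st tT Z]; first by rewrite lerDl.
have [LZ eZ] : free_nilpotent_lie Z /\ texp Z = increment X s t.
  apply: free_nilpotent_group_log; apply: (increment_group GX); first by rewrite s0 (le_trans st).
  by rewrite tT (le_trans s0).
have h0 := mesh_scale_ge0 p s t.
split=> //.
  by apply: weightedW h0 _ (HD _ _ h0 (BX s t s0 st tT)); rewrite lerDr.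
by rewrite eZ; apply: weightedW h0 _ (BX s t s0 st tT); rewrite lerDl.
Qed.

(** C is chosen before eps because [sewing_const_exists] computes eps from C; only delta depends on
    eps. All constants depend on X through B alone. *)
Lemma rough_almost_flow B : 0 <= B -> exists2 C, 0 <= C & forall eps : R, 0 < eps ->
  exists2 delta, 0 < delta <= 1 & forall X mu, rough B X -> euler X mu ->
  forall d, d <= delta -> almost_flow T d eps C a mu.
Proof.
move=> B0; have [D BD HD] := rough_log B0; have D0 := le_trans B0 BD.
have [K K0 HK] := dop_field_tame hF D0; have [C1 C10 HC] := taylor_comp hF D0.
pose c := 2 * expR (2 * K).
have c0 : 0 <= c by rewrite mulr_ge0// expR_ge0.
pose C2 := (K * c + 1) * K * c * c.
have C20 : 0 <= C2 by rewrite !mulr_ge0// addr_ge0// mulr_ge0.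
exists (C1 + C2) => [|eps e0]; first exact: addr_ge0.
have Kc : 0 < K * c + 1 by rewrite ltr_wpDl// mulr_ge0.
(* For t - s <= d0, the excess K h c of the Lipschitz constants of the time-1 maps over 1 is at most
   eps. *)
have [||d0 d00 d0P] := @powR_small R p^-1 (eps / (K * c + 1)); [by rewrite invr_gt0|by rewrite divr_gt0|].
exists (Order.min d0 1) => [|X mu rX eX d]; first by rewrite lt_min d00 ltr01 ge_min lexx orbT.
rewrite le_min => /andP[dd0 d1].
have main s t : 0 <= s -> s <= t -> t <= T -> t - s <= d ->
    [/\ h s t <= 1, tame (K * h s t) (dop_field F (tlog (increment X s t))),
        K * h s t * (2 * expR (2 * (K * h s t))) <= eps &
        K * h s t * (2 * expR (2 * (K * h s t))) <= K * c /\ 2 * expR (2 * (K * h s t)) <= c].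
  move=> s0 st tT ts; have h0 := mesh_scale_ge0 p s t.
  have h1 := mesh_scale_le1 p0 st (le_trans ts d1).
  have [LZ _ BZ _] := HD X rX s t s0 st tT.
  have tZ := HK _ (h s t) (_ : 0 <= h s t <= 1) (lie_low LZ) BZ.
  have Kh : K * h s t <= K by rewrite ler_piMr.
  have ec : 2 * expR (2 * (K * h s t)) <= c by rewrite ler_wpM2l// ler_expR ler_wpM2l.
  have e00 : 0 <= 2 * expR (2 * (K * h s t)) by rewrite mulr_ge0// expR_ge0.
  split=> //; first by apply: tZ; rewrite h0.
    apply: le_trans (ler_wpM2l (mulr_ge0 K0 h0) ec) _.
    have := d0P (t - s) (_ : 0 <= t - s) (le_trans ts dd0).
    rewrite subr_ge0 => /(_ st); rewrite ltr_pdivlMr// => /ltW; apply: le_trans.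
    by rewrite mulrAC mulrC ler_wpM2l// lerDl.
  by split=> //; apply: ler_pM => //; exact: mulr_ge0.
have [GX BX] := rX.
split.
- move=> t tT; have [t0 t1] := andP tT; apply: (time1_map_zero _ (eX t t t0 (lexx t) t1)).
  move=> x; rewrite (increment_refl GX)//.
  have -> : tlog (1 : tensor) = 0 by rewrite -(@texp0 R l N) tlog_texp//; exact/lie_low/lie0.
  by rewrite /dop_field dop0.
- move=> s t s0 st tT ts x y; have [h1 tZ Ke [_ _]] := main s t s0 st tT ts.
  have Kh0 : 0 <= K * h s t by rewrite mulr_ge0// mesh_scale_ge0.
  have [H _] := time1_map_four tZ Kh0 (eX s t s0 st tT).
  by apply: le_trans (H x y) _; rewrite ler_wpM2r// lerD2l.
- move=> s u t s0 su ut tT ts; have st := le_trans su ut.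
  have u0 := le_trans s0 su; have uT := le_trans ut tT.
  have [h1 _ _ _] := main s t s0 st tT ts.
  have h0 := mesh_scale_ge0 p s t.
  have [L1 E1 W1 _] := HD X rX s u s0 su uT; have [L2 E2 W2 W2'] := HD X rX u t u0 ut tT.
  have [L3 E3 W3 _] := HD X rX s t s0 st tT.
  have mono s' u' Z : s <= s' -> s' <= u' -> u' <= t -> weighted (h s' u') D Z -> weighted (h s t) D Z.
    by move=> ? ? ?; apply: weighted_le => //; [exact: mesh_scale_ge0|exact: mesh_scale_le].
  have h01 : 0 <= h s t <= 1 by rewrite h0.
  have ZE : texp (tlog (increment X s u)) * texp (tlog (increment X u t)) = texp (tlog (increment X s t)).
    by rewrite E1 E2 E3 (incrementM GX)// u0.
  have [H1 H2] := HC (h s t) _ _ _ _ _ _ h01 L1 L2 L3 (mono _ _ _ (lexx s) su ut W1)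
    (mono _ _ _ su ut (lexx t) W2) W3 (mono _ _ _ su ut (lexx t) W2') (eX _ _ s0 su uT) (eX _ _ u0 ut tT)
    (eX _ _ s0 st tT) ZE.
  have P0 : 0 <= (t - s) `^ a by exact: powR_ge0.
  rewrite mesh_scaleX in H1 H2.
  split=> [x|x y]; first by apply: le_trans (H1 x) _; rewrite ler_wpM2r// lerDl.
  by apply: le_trans (H2 x y) _; rewrite !ler_wpM2r// lerDl.
- move=> s t s0 st tT ts x y x' y'; have [h1 tZ Ke [Kc' cc']] := main s t s0 st tT ts.
  have h0 := mesh_scale_ge0 p s t.
  have Kh0 : 0 <= K * h s t by rewrite mulr_ge0.
  have Kh : K * h s t <= K by rewrite ler_piMr.
  have [_ H] := time1_map_four tZ Kh0 (eX s t s0 st tT).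
  have c'0 : 0 <= 2 * expR (2 * (K * h s t)) by rewrite mulr_ge0// expR_ge0.
  apply: le_trans (H x y x' y') _; apply: lerD; first by rewrite ler_wpM2r// lerD2l.
  rewrite ler_wpM2r// ler_wpM2r ?addr_ge0//; apply: (@le_trans _ _ C2); last by rewrite lerDr.
  move: c'0 cc' Kc'; set c' := 2 * _ => c'0 cc' Kc'.
  have k0 : 0 <= K * h s t * c' by exact: mulr_ge0.
  apply: ler_pM => //; first by rewrite !mulr_ge0// addr_ge0.
  apply: ler_pM => //; first by rewrite !mulr_ge0// addr_ge0.
  by apply: ler_pM => //; rewrite ?addr_ge0// lerD2r.
Qed.

Lemma rough_flow B : 0 <= B -> exists delta K, [/\ 0 < delta <= 1, 0 <= K &
  forall X mu, rough B X -> euler X mu -> exists phi, [/\ flow T phi, close T a K delta phi mu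
    & exists2 L, 0 <= L & lipschitz_flow T L phi]].
Proof.
move=> B0; have [C C0 HC] := rough_almost_flow B0.
have [eps [K [d0 [e0 K0 d00 HK]]]] := sewing_const_exists regularity_gt1 C0.
have [delta /andP[delta0 delta1] Hd] := HC eps e0.
have m0 : 0 < Order.min d0 delta by rewrite lt_min d00.
have md : Order.min d0 delta <= delta by rewrite ge_min lexx orbT.
exists (Order.min d0 delta), K; split=> //; first by rewrite m0 (le_trans md).
move=> X mu rX eX.
have [|phi [fphi aphi [L L0 Lphi]]] := HK E T _ mu m0 _ (ltW T0) (Hd X mu rX eX _ md).
  by rewrite ge_min lexx.
by exists phi; split=> //; exists L.
Qed.

(** The logarithm is Lipschitz on weighted balls and the field is linear in the tensor, so the
    fields differ by O(d); Gronwall carries this over to the time-1 maps. *)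
Lemma euler_dep B : 0 <= B -> exists2 S, 0 <= S & forall X Y muX muY d, rough B X -> rough B Y ->
  euler X muX -> euler Y muY -> 0 < d ->
  (forall s t, 0 <= s -> s <= t -> t <= T -> weighted (h s t) d (increment X s t - increment Y s t)) ->
  forall s t, 0 <= s -> s <= t -> t <= T -> t - s <= 1 -> forall x, `|muX s t x - muY s t x| <= S * d.
Proof.
move=> B0; have [D BD HD] := rough_log B0; have D0 := le_trans B0 BD.
have [K K0 HK] := dop_field_tame hF D0.
have [S S0 HS] := @weighted_tlog_sub R l N B B0.
have [K' K'0 HK'] := dop_field_tame hF S0.
have c0 : 0 <= 2 * expR (2 * K) by rewrite mulr_ge0// expR_ge0.
exists (2 * expR (2 * K) * K') => [|X Y muX muY d rX rY eX eY d0 H s t s0 st tT ts x].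
  exact: mulr_ge0.
have h0 := mesh_scale_ge0 p s t; have h1 := mesh_scale_le1 p0 st ts.
have [LX _ WX _] := HD X rX s t s0 st tT; have [LY _ _ _] := HD Y rY s t s0 st tT.
have tX : tame K (dop_field F (tlog (increment X s t))).
  by apply: tameW (HK _ (h s t) _ (lie_low LX) WX); rewrite ?h0// ler_piMr.
rewrite -[leRHS]mulrA; apply: (time1_map_dep tX K0 _ _ (eX s t s0 st tT) (eY s t s0 st tT)).
  by rewrite mulr_ge0// ltW.
move=> y; rewrite /dop_field -dopB.
have W := HS (h s t) d _ _ h0 (ltW d0) (rX.2 s t s0 st tT) (rY.2 s t s0 st tT) (H s t s0 st tT).
set Z := tlog _ - tlog _ in W *.
(* Rescaling gives a tensor whose weighted bound is free of d, to which [dop_field_tame] applies;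
   the factor d is restored by linearity. *)
have -> : Z = d *: (d^-1 *: Z) by rewrite scalerA divff ?scale1r// gt_eqF.
rewrite dopZ normrZ gtr0_norm// mulrC ler_wpM2r ?(ltW d0)//.
have W' : weighted (h s t) S (d^-1 *: Z).
  have := weightedZ d^-1 W; rewrite gtr0_norm ?invr_gt0// mulrCA mulVf ?mulr1// gt_eqF//.
have low1 : low 1 (d^-1 *: Z) by apply/lowZ/lowD; [|apply: lowN]; exact: lie_low.
have [H0 _ _] := HK' _ (h s t) ltac:(by rewrite h0) low1 W'.
by apply: le_trans (H0 y) _; rewrite ler_piMr.
Qed.

(** Increments of the reversed path are inverses, so their logarithms change sign. Their bounds
    follow by writing the inverse as exp(-log). *)
Lemma rough_reverse B : 0 <= B -> exists2 B', 0 <= B' & forall X, rough B X ->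
  rough B' (fun r => X (T - r)) /\
  forall s t, 0 <= s -> s <= t -> t <= T ->
    tlog (increment (fun r => X (T - r)) s t) = - tlog (increment X (T - t) (T - s)).
Proof.
move=> B0; have [D BD HD] := rough_log B0; have D0 := le_trans B0 BD.
have [D' D'0 HD'] := @weighted_texp R l N D D0.
exists D' => // X rX; have [GX BX] := rX.
have TP t : 0 <= t <= T -> 0 <= T - t <= T.
  by move=> /andP[? ?]; rewrite subr_ge0 lerBlDr lerDl; apply/andP.
have inc s t : 0 <= s -> s <= t -> t <= T -> [/\ 0 <= s <= T, 0 <= t <= T &
    increment (fun r => X (T - r)) s t = (increment X (T - t) (T - s))^-1].
  move=> s0 st tT; have s1 : 0 <= s <= T by rewrite s0 (le_trans st).
  have t1 : 0 <= t <= T by rewrite tT (le_trans s0).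
  split=> //; have Us := free_nilpotent_group_unit (GX _ (TP _ s1)).
  have Ut := free_nilpotent_group_unit (GX _ (TP _ t1)).
  by rewrite /increment invrM ?unitrV// invrK.
have log s t : 0 <= s -> s <= t -> t <= T ->
    tlog (increment (fun r => X (T - r)) s t) = - tlog (increment X (T - t) (T - s)).
  move=> s0 st tT; have [s1 t1 ->] := inc s t s0 st tT.
  by apply: tlogV; apply: (increment_group GX); exact: TP.
split=> //; split=> [t /TP|s t s0 st tT]; first exact: GX.
have [s1 t1 ->] := inc s t s0 st tT.
have Tt0 : 0 <= T - t by rewrite subr_ge0.
have Ts : T - s <= T by rewrite lerBlDr lerDl.
have Tst : T - t <= T - s by rewrite lerD2l lerN2.
have [LZ eZ WZ _] := HD X rX _ _ Tt0 Tst Ts.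
have hE : h (T - t) (T - s) = h s t by rewrite /mesh_scale; congr (_ `^ _); ring.
rewrite -eZ texp_inv; last exact: lie_low.
apply: HD'; first exact: mesh_scale_ge0.
by rewrite -hE => w; rewrite ffunE normrN; exact: WZ.
Qed.

Lemma euler_reverse X mu nu : euler X mu -> euler (fun r => X (T - r)) nu ->
  (forall s t, 0 <= s -> s <= t -> t <= T ->
    tlog (increment (fun r => X (T - r)) s t) = - tlog (increment X (T - t) (T - s))) ->
  forall s t, 0 <= s -> s <= t -> t <= T ->
    (forall x, nu (T - t) (T - s) (mu s t x) = x) /\ (forall x, mu s t (nu (T - t) (T - s) x) = x).
Proof.
move=> eX eY log s t s0 st tT.
have Tt0 : 0 <= T - t by rewrite subr_ge0.
have Ts : T - s <= T by rewrite lerBlDr lerDl.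
have Tst : T - t <= T - s by rewrite lerD2l lerN2.
have H := eY _ _ Tt0 Tst Ts; rewrite log// !subKr in H.
have dN Z : dop_field F (- Z) = fun x => - dop_field F Z x.
  by apply/funext => x; rewrite /dop_field -scaleN1r dopZ scaleN1r.
rewrite dN in H; split=> x; first exact: time1_map_reverse (eX s t s0 st tT) H x.
apply: (time1_map_reverse H); have -> : (fun z => - - dop_field F (tlog (increment X s t)) z) =
  dop_field F (tlog (increment X s t)) by apply/funext => z; rewrite opprK.
exact: eX.
Qed.

Lemma roughW B C X : B <= C -> rough B X -> rough C X.
Proof.
move=> BC [GX BX]; split=> // s t s0 st tT.
exact: weightedW (mesh_scale_ge0 p s t) BC (BX s t s0 st tT).
Qed.

Lemma sup_dist_le (f g : E -> E) (r : R) :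
  (sup_dist f g <= r%:E)%E <-> (forall x, `|f x - g x| <= r).
Proof.
split=> [H x|H]; last by apply: ge_ereal_sup => _ [x _ <-]; rewrite lee_fin.
by rewrite -lee_fin; apply: le_trans H; apply: ereal_sup_ubound; exists x.
Qed.

Lemma solution_flow_unique X mu phi C delta L a' psi : 0 <= C -> 0 < delta -> 0 <= L ->
  euler X mu -> flow T phi -> close T a C delta phi mu -> lipschitz_flow T L phi ->
  1 < a' -> solution_flow F T a' X psi ->
  forall s t, 0 <= s -> s <= t -> t <= T -> psi s t =1 phi s t.
Proof.
move=> C0 delta0 L0 eX fphi phimu Lphi a'1 [fpsi [nu nuP [delta' [c [delta'0 c0 psinu]]]]].
move=> s t s0 st tT x; symmetry; move: s t s0 st tT x.
(* The two flows may come with different exponents. On intervals of length at most 1, both powers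
   are bounded by the one with the smaller exponent, which still exceeds 1. *)
have m1 : 1 < Order.min a a' by rewrite lt_min regularity_gt1.
have md : 0 < Order.min delta (Order.min delta' 1) by rewrite !lt_min delta0 delta'0 /=.
have Cc : 0 <= C + c by rewrite addr_ge0// ltW.
apply: (flow_unique T0 m1 Cc md L0 fphi fpsi Lphi) => s t s0 st tT.
rewrite !le_min => /and3P[ts ts' ts1] x.
have muE : mu s t = nu s t := time1_map_unique (eX s t s0 st tT) (nuP s t s0 st tT).
have H1 := phimu s t s0 st tT ts x.
have := psinu s t s0 st tT ts'; rewrite ger0_norm ?subr_ge0// => /sup_dist_le/(_ x) H2.
have small b : Order.min a a' <= b -> (t - s) `^ b <= (t - s) `^ (Order.min a a').
  move=> ab; have [->|ts0] := eqVneq (t - s) 0.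
    have m0 : 0 < Order.min a a' := lt_trans ltr01 m1.
    by rewrite !powR0 ?gt_eqF// (lt_le_trans m0 ab).
  by apply: ger_powR => //; rewrite lt_neqAle eq_sym ts0 subr_ge0 st.
have -> : phi s t x - psi s t x = (phi s t x - mu s t x) - (psi s t x - nu s t x) by rewrite muE; lmod.
apply: le_trans (ler_normB _ _) (le_trans (lerD H1 H2) _); rewrite mulrDl; apply: lerD.
  by rewrite ler_wpM2l// small// ge_min lexx.
by rewrite ler_wpM2l ?(ltW c0)// small// ge_min lexx orbT.
Qed.

Lemma close_le b C C' delta delta' phi mu : C <= C' -> delta' <= delta ->
  close T b C delta phi mu -> close T b C' delta' phi mu.
Proof.
move=> CC dd H s t s0 st tT ts x; apply: le_trans (H s t s0 st tT (le_trans ts dd) x) _.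
by rewrite ler_wpM2r// powR_ge0.
Qed.

Lemma rough_solution B X : 0 <= B -> rough B X -> exists mu phi C delta L,
  [/\ euler X mu, flow T phi, close T a C delta phi mu & lipschitz_flow T L phi] /\
  [/\ 0 <= C, 0 < delta & 0 <= L].
Proof.
move=> B0 rX; have [mu eX] := euler_exists rX.1.
have [delta [C [/andP[delta0 _] C0 H]]] := rough_flow B0.
have [phi [fphi phimu [L L0 Lphi]]] := H X mu rX eX.
by exists mu, phi, C, delta, L.
Qed.

Lemma lipschitz_homeo phi psi L : 0 <= L ->
  (forall s t, 0 <= s -> s <= t -> t <= T ->
    [/\ forall x, psi s t (phi s t x) = x, forall x, phi s t (psi s t x) = x,
        forall x y, `|phi s t x - phi s t y| <= L * `|x - y|
      & forall x y, `|psi s t x - psi s t y| <= L * `|x - y|]) ->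
  unif_lipschitz_homeo T phi.
Proof.
move=> L0 H; have cont (f : E -> E) : (forall x y, `|f x - f y| <= L * `|x - y|) -> continuous f.
  move=> fL x; apply/cvgrPdist_le => e e0; have L1 : 0 < L + 1 by rewrite ltr_wpDl.
  apply/nbhs_ballP; exists (e / (L + 1)); first by rewrite /= divr_gt0.
  move=> y; rewrite -ball_normE /= ltr_pdivlMr// => /ltW; apply: le_trans.
  by apply: le_trans (fL x y) _; rewrite mulrC ler_wpM2l// lerDl.
exists psi => [s t s0 st tT|]; last first.
  exists L => s t s0 st tT; have [_ _ L1 L2] := H s t s0 st tT.
  by split=> -[x y] _ /=; [exact: L1|exact: L2].
by have [c1 c2 L1 L2] := H s t s0 st tT; split=> //; exact: cont.
Qed.

(** Time reversal is an involution: [flow_inverse] is applied to phi and the flow psi of the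
    reversed path, then with their roles exchanged, giving the left and the right inverse. *)
Lemma rough_homeo B X mu phi C delta L : 0 <= B -> rough B X -> 0 <= C -> 0 < delta -> 0 <= L ->
  euler X mu -> flow T phi -> close T a C delta phi mu -> lipschitz_flow T L phi ->
  unif_lipschitz_homeo T phi.
Proof.
move=> B0 rX C0 delta0 L0 eX fphi phimu Lphi.
have [B' B'0 /(_ X rX)[rX' log]] := rough_reverse B0.
have [nu [psi [C' [delta' [L' [[eX' fpsi psinu Lpsi] [C'0 delta'0 L'0]]]]]]] := rough_solution B'0 rX'.
have inv := euler_reverse eX eX' log.
have d0 : 0 < Order.min delta delta' by rewrite lt_min delta0.
have CC0 : 0 <= C + C' by exact: addr_ge0.
have phimu' : close T a (C + C') (Order.min delta delta') phi mu.
  by apply: close_le phimu; rewrite ?lerDl// ge_min lexx.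
have psinu' : close T a (C + C') (Order.min delta delta') psi nu.
  by apply: close_le psinu; rewrite ?lerDr// ge_min lexx orbT.
have inv1 s t : 0 <= s -> s <= t -> t <= T -> forall x, nu (T - t) (T - s) (mu s t x) = x.
  by move=> s0 st tT; have [] := inv s t s0 st tT.
have K1 := flow_inverse T0 regularity_gt1 CC0 d0 L'0 fphi fpsi Lpsi phimu' psinu' inv1.
have TP s t : 0 <= s -> s <= t -> t <= T -> [/\ 0 <= T - t, T - t <= T - s & T - s <= T].
  by move=> s0 st tT; rewrite subr_ge0 lerD2l lerN2 lerBlDr lerDl.
have inv' s t : 0 <= s -> s <= t -> t <= T -> forall x, mu (T - t) (T - s) (nu s t x) = x.
  move=> s0 st tT; have [Tt0 Tst Ts] := TP s t s0 st tT.
  by have [_] := inv _ _ Tt0 Tst Ts; rewrite !subKr.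
have K2 := flow_inverse T0 regularity_gt1 CC0 d0 L0 fpsi fphi Lphi psinu' phimu' inv'.
apply: (@lipschitz_homeo phi (fun s t => psi (T - t) (T - s)) (L + L')); first exact: addr_ge0.
move=> s t s0 st tT; have [Tt0 Tst Ts] := TP s t s0 st tT; split=> [x|x|x y|x y].
- exact: K1.
- by have := K2 _ _ Tt0 Tst Ts x; rewrite !subKr.
- by apply: le_trans (Lphi s t s0 st tT x y) _; rewrite ler_wpM2r// lerDl.
- by apply: le_trans (Lpsi _ _ Tt0 Tst Ts x y) _; rewrite ler_wpM2r// lerDr.
Qed.

Lemma solution_flow_continuous X phi B : 0 <= B -> rough B X -> solution_flow F T a X phi ->
  forall e : R, 0 < e -> exists2 d, 0 < d & forall Y psi,
    (forall t, 0 <= t <= T -> free_nilpotent_group (Y t)) -> solution_flow F T a Y psi ->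
    (rp_dist p T X Y < d%:E)%E -> (flow_dist T phi psi < e%:E)%E.
Proof.
(* For d <= 1, [rough_path_dist] bounds Y by B + d + 1 <= B + 1 + 1, so the constants below serve X
   and Y alike. *)
move=> B0 rX Sphi e e0; have B1 : 0 <= B + 1 + 1 by rewrite !addr_ge0.
have [delta [C [/andP[delta0 delta1] C0 HC]]] := rough_flow B1.
have [S S0 HS] := euler_dep B1.
have rX' : rough (B + 1 + 1) X by apply: roughW rX; rewrite -addrA lerDl.
have [mu eX] := euler_exists rX.1.
have [phi' [fphi phimu [L L0 Lphi]]] := HC X mu rX' eX.
have C2 : 0 <= L * (C + C) by rewrite mulr_ge0// addr_ge0.
have e4 : 0 < e / 4 by rewrite divr_gt0.
(* The partition is fixed before d. The distances of both flows to their time-1 maps cost e / 4 in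
   total, whatever Y; d is then chosen so that the difference of the time-1 maps over the pieces
   costs another e / 4. *)
have [n [nd ne]] := pieces_small T0 regularity_gt1 C2 delta0 e4.
pose Q := n.+1%:R * (L * S); have Q0 : 0 <= Q by rewrite !mulr_ge0.
have Q1 : 0 < Q + 1 by rewrite ltr_wpDl.
have [d [d0 d1 dQ]] : exists d, [/\ 0 < d, d <= 1 & Q * d <= e / 4].
  exists (Order.min 1 (e / 4 / (Q + 1))); split; first by rewrite lt_min ltr01 divr_gt0.
    by rewrite ge_min lexx.
  apply: (@le_trans _ _ (Q * (e / 4 / (Q + 1)))); first by rewrite ler_wpM2l// ge_min lexx orbT.
  rewrite mulrA ler_pdivrMr// mulrC ler_wpM2l ?(ltW e4)// lerDl//.
exists d => // Y psi GY Spsi XY.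
have [rY dXY] := rough_path_dist B0 (ltW d0) rX GY (ltW XY).
have rY' : rough (B + 1 + 1) Y by apply: roughW rY; rewrite lerD2r lerD2l.
have [nu eY] := euler_exists GY.
have [psi' [fpsi psinu [L' L'0 Lpsi]]] := HC Y nu rY' eY.
(* By uniqueness the given solutions are the sewn flows, and so inherit their uniform constants. *)
have phiE := solution_flow_unique C0 delta0 L0 eX fphi phimu Lphi regularity_gt1 Sphi.
have psiE := solution_flow_unique C0 delta0 L'0 eY fpsi psinu Lpsi regularity_gt1 Spsi.
apply: (@le_lt_trans _ _ (e / 2)%:E); last by rewrite lte_fin; lra.
apply: ge_ereal_sup => _ [s [t [s0 st tT ->]]]; apply/sup_dist_le => x.
rewrite phiE// psiE//.
have piece u v : 0 <= u -> u <= v -> v <= T -> v - u <= T / n.+1%:R -> forall y,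
    `|phi' u v y - psi' u v y| <= (C + C) * (T / n.+1%:R) `^ a + S * d.
  move=> u0 uv vT vu y; have vud := le_trans vu nd.
  have pow : (v - u) `^ a <= (T / n.+1%:R) `^ a.
    apply: ge0_ler_powR; rewrite ?nnegrE ?subr_ge0 ?divr_ge0 ?(ltW T0) ?(ltW p0)//.
  have H1 := le_trans (phimu u v u0 uv vT vud y) (ler_wpM2l C0 pow).
  have H2 := le_trans (psinu u v u0 uv vT vud y) (ler_wpM2l C0 pow).
  have H3 := HS X Y mu nu d rX' rY' eX eY d0 dXY u v u0 uv vT (le_trans vud delta1) y.
  have -> : phi' u v y - psi' u v y = (phi' u v y - mu u v y) + (mu u v y - nu u v y) -
    (psi' u v y - nu u v y) by lmod.
  apply: le_trans (ler_normB _ _) _; apply: le_trans (lerD (ler_normD _ _) (lexx _)) _.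
  by rewrite mulrDl; lra.
apply: le_trans (flow_telescope fphi fpsi L0 Lphi piece s0 st tT x) _.
have -> : n.+1%:R * (L * ((C + C) * (T / n.+1%:R) `^ a + S * d)) =
  n.+1%:R * (L * (C + C) * (T / n.+1%:R) `^ a) + Q * d by rewrite /Q; ring.
by apply: le_trans (lerD ne dQ) _; lra.
Qed.

End RoughFlows.

Theorem theorem23 (R : realType) (E : completeNormedModType R) (l : nat)
    (p T : R) (hp : 2 <= p) (hT : 0 < T)
    (F : {linear 'rV[R]_l -> (E -> E)})
    (hF : continuous_to_Ckb (Num.truncn p).+1 F) :
  exists2 a : R, 1 < a &
    (forall X : R -> tensor R l (Num.truncn p),
      weak_geometric_rough_path p T X ->
      exists phi : R -> R -> E -> E,
        [/\ solution_flow F T a X phi,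
            forall (a' : R) (phi' : R -> R -> E -> E), 1 < a' ->
              solution_flow F T a' X phi' ->
              forall s t : R, 0 <= s -> s <= t -> t <= T -> phi' s t =1 phi s t
          & unif_lipschitz_homeo T phi]) /\
    (forall (X : R -> tensor R l (Num.truncn p)) (phi : R -> R -> E -> E),
      weak_geometric_rough_path p T X -> solution_flow F T a X phi ->
      forall e : R, 0 < e -> exists2 d : R, 0 < d &
        forall (Y : R -> tensor R l (Num.truncn p)) (psi : R -> R -> E -> E),
          weak_geometric_rough_path p T Y -> solution_flow F T a Y psi ->
          (rp_dist p T X Y < d%:E)%E -> (flow_dist T phi psi < e%:E)%E).
Proof.
have p0 : 0 < p by apply: lt_le_trans hp.
have pN : p < (Num.truncn p).+1%:R by exact: truncnS_gt.
have F1 := hF.1.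
exists ((Num.truncn p).+1%:R / p); first exact: regularity_gt1.
split=> [X [GX HX]|X phi [GX HX] Sphi e e0]; have [B B0 rX] := rough_path_bound GX HX.
  have [mu [phi [C [delta [L [[eX fphi phimu Lphi] [C0 delta0 L0]]]]]]] :=
    rough_solution F1 p0 pN hT B0 rX.
  exists phi; split.
  (* The sewing constant may be 0, while a solution flow asks for a positive one: hence [C + 1]. *)
  - split=> //; exists mu => //; exists delta, (C + 1); split=> //; first by rewrite ltr_wpDl.
    move=> s t s0 st tT ts; apply/sup_dist_le => x.
    apply: le_trans (phimu s t s0 st tT ts x) _; rewrite ger0_norm ?subr_ge0//.
    by rewrite ler_wpM2r ?powR_ge0// lerDl.
  - move=> a' phi' a'1; exact: (solution_flow_unique p0 pN hT C0 delta0 L0 eX fphi phimu Lphi a'1).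
  - exact: (rough_homeo F1 p0 pN hT B0 rX C0 delta0 L0 eX fphi phimu Lphi).
have [d d0 H] := solution_flow_continuous F1 p0 pN hT B0 rX Sphi e0.
by exists d => // Y psi [GY _]; exact: H.
Qed.
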